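(* Let $\sigma\in L^\infty(\mathbb{T})$ be a non-negative jump rate such that the spectral gap in $L^2_p$ of the Goldstein-Taylor generator $A_\sigma$ is locally maximised at $\sigma$. Then the spectral gap is not determined by a simple eigenvalue.
   Context: $\mathbb{T}$ is the torus (circle) of length $2\pi$. The Goldstein-Taylor model with jump rate $\sigma=\sigma(x)\ge 0$ is $\partial_t u+\partial_x u=\frac{\sigma}{2}(v-u)$, $\partial_t v-\partial_x v=\frac{\sigma}{2}(u-v)$ for $x\in\mathbb{T}$. With $\rho=(u+v)/\sqrt2$ and $j=(u-v)/\sqrt2$ it reads $\partial_t\rho+\partial_x j=0$, $\partial_t j+\partial_x\rho=-\sigma(x)j$. $L^2_p=\{(\rho,j)\in L^2(\mathbb{T};\mathbb{C})^2:\int_{\mathbb{T}}\rho\,dx=0\}$ with norm $\|(\rho,j)\|_2^2=\|\rho\|_2^2+\|j\|_2^2$. $A_\sigma$ is the closed operator on $L^2_p$ given by $A_\sigma(\rho,j)=(-\partial_x j,\,-\partial_x\rho-\sigma j)$; it generates the evolution above. The spectral gap is $-\sup\{\operatorname{Re}\lambda:\lambda\in\mathrm{spec}(A_\sigma)\}$, the spectrum being taken in $L^2_p$. ''Locally maximised'' means that the gap at $\sigma$ is at least the gap at every non-negative jump rate in a neighbourhood of $\sigma$ in $L^\infty(\mathbb{T})$. An eigenvalue is simple if its spectral projection has one-dimensional image; it may be real or non-real. The conclusion is also described in words as: for a locally optimal jump rate the spectral gap is determined by multiple, possibly degenerate, eigenvectors. *)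

(* Defs.v *)
From HB Require Import structures.
From mathcomp Require Import all_boot all_order all_algebra.
From mathcomp Require Import complex.
From mathcomp Require Import all_classical all_reals all_analysis.

Set Implicit Arguments.
Unset Strict Implicit.
Unset Printing Implicit Defensive.

Import Order.TTheory GRing.Theory Num.Theory.
Import numFieldNormedType.Exports.

Local Open Scope classical_set_scope.
Local Open Scope ring_scope.
Local Open Scope complex_scope.

Local Notation Re := complex.Re.
Local Notation Im := complex.Im.

(* The torus of length 2 pi is represented by its
   fundamental domain [0, 2 pi[: functions on it are functions R -> _ taken
   modulo a.e. equality for [torus R], so values outside [0, 2 pi[ are
   irrelevant. Elements of the L^2 spaces are never quotiented; equality of
   elements is always [state_eq]. *)

Section Torus.
Variable R : realType.

Definition torus : {measure set (measurableTypeR R) -> \bar R} :=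
  mrestr (@lebesgue_measure R)
    (measurable_itv `[0, 2 * pi[ : measurable (`[0, 2 * pi[ : set R)).

Definition cintegral (f : R -> R[i]) : R[i] :=
  (\int[torus]_x Re (f x)) +i* (\int[torus]_x Im (f x)).

Definition L2 (f : R -> R[i]) : Prop :=
  (fun x => Re (f x)) \in Lfun torus 2%:E /\
  (fun x => Im (f x)) \in Lfun torus 2%:E.

Definition smooth_periodic (phi : R -> R) : Prop :=
  (forall n x, derivable (derive1n n phi) x 1) /\
  periodic phi (2 * pi).

(* g = d f / dx in the sense of distributions on the torus; the periodicity of
   the test functions is what encodes the absence of a boundary. *)
Definition weak_derivative (f g : R -> R[i]) : Prop :=
  forall phi, smooth_periodic phi ->
    cintegral (fun x => f x * (derive1 phi x)%:C) =
    - cintegral (fun x => g x * (phi x)%:C).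

(* A pair (rho, j). *)
Definition state : Type := ((R -> R[i]) * (R -> R[i]))%type.

Definition state0 : state := (fun=> 0, fun=> 0).

Definition state_scale (z : R[i]) (f : state) : state :=
  (fun x => z * f.1 x, fun x => z * f.2 x).

Definition state_sub (f g : state) : state :=
  (fun x => f.1 x - g.1 x, fun x => f.2 x - g.2 x).

Definition state_eq (f g : state) : Prop :=
  f.1 = g.1 %[ae torus] /\ f.2 = g.2 %[ae torus].

Definition L2p (f : state) : Prop :=
  [/\ L2 f.1, L2 f.2 & cintegral f.1 = 0].

Definition state_dot (f g : state) : R[i] :=
  cintegral (fun x => f.1 x * conjc (g.1 x) + f.2 x * conjc (g.2 x)).

Definition state_norm (f : state) : R := Num.sqrt (Re (state_dot f f)).

(* The graph of A_sigma on its maximal domain: f is in the domain and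
   A_sigma f = h. *)
Definition generator (sigma : R -> R) (f h : state) : Prop :=
  [/\ L2p f, L2p h &
    exists drho dj : R -> R[i],
      [/\ L2 drho, L2 dj, weak_derivative f.1 drho, weak_derivative f.2 dj &
        state_eq h (fun x => - dj x,
                    fun x => - drho x - (sigma x)%:C * f.2 x)]].

(* (z - A_sigma) u = f *)
Definition resolvent_eq (sigma : R -> R) (z : R[i]) (u f : state) : Prop :=
  generator sigma u (state_sub (state_scale z u) f).

Definition resolvent_set (sigma : R -> R) : set R[i] :=
  [set z |
    (forall f, L2p f ->
      exists2 u, resolvent_eq sigma z u f &
        forall v, resolvent_eq sigma z v f -> state_eq v u) /\
    (exists C : R, forall f u, resolvent_eq sigma z u f ->
      state_norm u <= C * state_norm f)].

Definition spectrum (sigma : R -> R) : set R[i] := ~` resolvent_set sigma.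

Definition spectral_gap (sigma : R -> R) : \bar R :=
  (- ereal_sup [set (Re z)%:E | z in spectrum sigma])%E.

Definition circle (lambda : R[i]) (r theta : R) : R[i] :=
  lambda + r%:C * (cos theta +i* sin theta).

(* The integral of F(z) dz over the positively oriented circle. *)
Definition circle_integral (lambda : R[i]) (r : R) (F : R[i] -> R[i]) : R[i] :=
  cintegral (fun theta => F (circle lambda r theta) *
                          ('i%C * (circle lambda r theta - lambda))).

(* h = P f, where P is the Riesz projection, i.e. (2 pi i)^-1 times the integral
   of (z - A_sigma)^-1 dz over the circle of centre lambda and radius r; the
   vector-valued integral is understood weakly. *)
Definition spectral_projection (sigma : R -> R) (lambda : R[i]) (r : R)
    (f h : state) : Prop :=
  L2p h /\
  exists2 u : R[i] -> state,
    (forall theta, resolvent_eq sigma (circle lambda r theta)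
                                (u (circle lambda r theta)) f) &
    forall g, L2p g ->
      state_dot h g =
      ((2 * pi)%:C * 'i%C)^-1 *
      circle_integral lambda r (fun z => state_dot (u z) g).

Definition eigenvalue (sigma : R -> R) (lambda : R[i]) : Prop :=
  exists2 f, generator sigma f (state_scale lambda f) & ~ state_eq f state0.

Definition one_dimensional (V : set state) : Prop :=
  exists2 e, V e /\ ~ state_eq e state0 &
    forall h, V h -> exists c : R[i], state_eq h (state_scale c e).

(* The spectral projection does not depend on the radius r chosen so that
   lambda is the only spectral point in the closed disc. *)
Definition simple_eigenvalue (sigma : R -> R) (lambda : R[i]) : Prop :=
  eigenvalue sigma lambda /\
  exists r : R,
    [/\ 0 < r,
        forall z, z != lambda -> `|z - lambda| <= r%:C -> resolvent_set sigma z &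
        one_dimensional
          [set h | exists2 f, L2p f & spectral_projection sigma lambda r f h]].

(* lambda attains the gap and the remaining spectrum stays strictly to its left.
   The conjugate of lambda is left out because the spectrum of A_sigma is
   symmetric under conjugation (sigma is real), so that a non-real lambda always
   comes with its conjugate. *)
Definition gap_determined_by (sigma : R -> R) (lambda : R[i]) : Prop :=
  spectral_gap sigma = (- Re lambda)%:E /\
  (ereal_sup [set (Re z)%:E | z in spectrum sigma `\` [set lambda; conjc lambda]]
     < (Re lambda)%:E)%E.

Definition jump_rate (sigma : R -> R) : Prop :=
  sigma \in Lfun torus +oo%E /\ {ae torus, forall x, 0 <= sigma x}.

Definition gap_locally_maximised (sigma : R -> R) : Prop :=
  exists2 eps : R, 0 < eps &
    forall tau, jump_rate tau ->
      ('N[torus]_(+oo)[EFin \o (tau \- sigma)%R] < eps%:E)%E ->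
      (spectral_gap tau <= spectral_gap sigma)%E.

End Torus.

(* Main.v *)
(* Let [e = (rho, j)] be an eigenvector for the simple eigenvalue [lambda]. Since
   [lambda] is simple, [B = \int (rho^2 - j^2)] does not vanish; put
   [w = - j^2 / B]. Replacing [sigma] by [sigma + eps tau] moves [lambda] by
   [- eps \int tau w] to first order, so local optimality means
   [\int tau (Re w) <= 0] for every feasible [tau]. Taking for [tau] the positive
   part of [Re w], then [sigma (Re w)], gives [Re w <= 0] and [sigma (Re w) = 0].
   The function [q = Im (conj j * j')] satisfies
   [q' = Im lambda * (2 Re lambda + sigma) * |j|^2] and vanishes where
   [sigma > 0], because [Re w] is maximal there; integrating [q^2 q'] then yields
   [(2 Re lambda + sigma) j = 0] when [lambda] is neither real nor imaginary. In
   all cases the identity [\int (2 lambda + sigma) w = lambda] forces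
   [\int Re w > 0], a contradiction.

   The first-order expansion needs the eigenvalues of [sigma + eps tau] to
   converge to [lambda]. Non-compactness at high frequency is excluded since
   there the spectrum clusters on the line [Re z = - (\int sigma) / (4 pi)],
   which lies strictly to the left of [lambda]. Both facts come from the
   Riemann-Lebesgue lemma applied along the characteristics: the trace of the
   monodromy matrix at [z] is close to [E + 1 / E] with
   [E = \exp(2 pi z + (\int sigma) / 2)], and the points where it equals [2] are located
   by a Hurwitz argument for the polynomial Picard approximations. *)

Require Import Defs.
From HB Require Import structures.
From mathcomp Require Import all_boot all_order all_algebra.
From mathcomp Require Import complex.
From mathcomp Require Import all_classical all_reals all_analysis.
From mathcomp Require Import measurable_realfun ess_sup_inf ring lra.

Set Implicit Arguments.
Unset Strict Implicit.
Unset Printing Implicit Defensive.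

Import Order.TTheory GRing.Theory Num.Theory.
Import numFieldNormedType.Exports.

Local Open Scope classical_set_scope.
Local Open Scope ring_scope.
Local Open Scope complex_scope.

Local Notation Re := complex.Re.
Local Notation Im := complex.Im.
Local Notation N := (@ComplexField.Normc.normc _).

(** The generator is symmetric for the bilinear form [\int (rho rho' - j j')], taken without
    conjugation. So [(rho, -j)] is the left eigenvector belonging to [(rho, j)], [B] is the pairing
    of the two, and [- w] is the density of the derivative of the eigenvalue. The eigenvalue is
    never followed as a function of [eps]. Local optimality supplies, for each small [eps], some
    eigenvalue of the perturbed generator with real part at least [Re lambda - eps^2]; the supremum
    may fail to be attained, and this slack is [o(eps)]. Once these eigenvalues are bounded, they
    and their eigenvectors converge along a subsequence, and pairing a perturbed eigenvector with
    the limit gives an exact identity from which the sign of the first variation is read off. The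
    limit can only be [lambda] or its conjugate, because the rest of the spectrum lies strictly to
    the left. Since [sigma] is only bounded and measurable, every differential equation is treated
    in integral form, as [f x = f 0 + P g x]. *)

Section ComplexAlgebra.
Variable R : realType.
Implicit Types x y : R[i].

Lemma ReD x y : Re (x + y) = Re x + Re y. Proof. by case: x y => [? ?] [? ?]. Qed.
Lemma ImD x y : Im (x + y) = Im x + Im y. Proof. by case: x y => [? ?] [? ?]. Qed.
Lemma ReN x : Re (- x) = - Re x. Proof. by case: x. Qed.
Lemma ImN x : Im (- x) = - Im x. Proof. by case: x. Qed.
Lemma ReM x y : Re (x * y) = Re x * Re y - Im x * Im y.
Proof. by case: x y => [? ?] [? ?]. Qed.
Lemma ImM x y : Im (x * y) = Re x * Im y + Im x * Re y.
Proof. by case: x y => [? ?] [? ?]. Qed.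
Lemma ReJ x : Re (conjc x) = Re x. Proof. by case: x. Qed.
Lemma ImJ x : Im (conjc x) = - Im x. Proof. by case: x. Qed.
Lemma ReC (a : R) : Re a%:C = a. Proof. by []. Qed.
Lemma ImC (a : R) : Im a%:C = 0. Proof. by []. Qed.
Definition reimE := (ReD, ImD, ReN, ImN, ReM, ImM, ReJ, ImJ, ReC, ImC).

Lemma ceqP x y : Re x = Re y -> Im x = Im y -> x = y.
Proof. by case: x y => [? ?] [? ?] /= -> ->. Qed.

Lemma N_ge0 x : 0 <= N x. Proof. by case: x => a b; exact: sqrtr_ge0. Qed.
Lemma N_sqr x : N x ^+ 2 = Re x ^+ 2 + Im x ^+ 2.
Proof. by case: x => a b; rewrite sqr_sqrtr// addr_ge0// sqr_ge0. Qed.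
Lemma N_mulJ x : x * conjc x = (N x ^+ 2)%:C.
Proof. by rewrite N_sqr; apply: ceqP; rewrite !reimE; ring. Qed.
Lemma NM x y : N (x * y) = N x * N y. Proof. exact: ComplexField.Normc.normcM. Qed.
Lemma NC (a : R) : N a%:C = `|a|. Proof. by rewrite /= expr0n addr0 sqrtr_sqr. Qed.
Lemma N0 : N (0 : R[i]) = 0. Proof. exact: ComplexField.Normc.normc0. Qed.
Lemma N1 : N (1 : R[i]) = 1. Proof. exact: ComplexField.Normc.normc1. Qed.
Lemma NN x : N (- x) = N x. Proof. exact: normcN. Qed.
Lemma NJ x : N (conjc x) = N x. Proof. by case: x => a b /=; rewrite sqrrN. Qed.
Lemma NX x n : N (x ^+ n) = N x ^+ n.
Proof. by elim: n => [|n IH]; rewrite ?expr0 ?N1// !exprS NM IH. Qed.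
Lemma NV x : N x^-1 = (N x)^-1. Proof. exact: ComplexField.Normc.normcV. Qed.
Lemma leND x y : N (x + y) <= N x + N y. Proof. exact: le_normcD. Qed.
Lemma leNB x y : N (x - y) <= N x + N y. Proof. by rewrite -(NN y) leND. Qed.
Lemma N_distC x y : N (x - y) = N (y - x). Proof. by rewrite -NN opprB. Qed.
Lemma N_eq0 x : (N x == 0) = (x == 0).
Proof. by apply/eqP/eqP => [/ComplexField.Normc.eq0_normc//|->]; rewrite N0. Qed.
Lemma N_gt0 x : (0 < N x) = (x != 0). Proof. by rewrite lt0r N_ge0 andbT N_eq0. Qed.
Lemma Re_leN x : `|Re x| <= N x.
Proof.
rewrite -(ler_pXn2r (ltn0Sn 1)) ?nnegrE ?N_ge0// N_sqr real_normK ?num_real//.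
by rewrite lerDl sqr_ge0.
Qed.
Lemma Im_leN x : `|Im x| <= N x.
Proof.
rewrite -(ler_pXn2r (ltn0Sn 1)) ?nnegrE ?N_ge0// N_sqr real_normK ?num_real//.
by rewrite lerDr sqr_ge0.
Qed.
Lemma N_leRI x : N x <= `|Re x| + `|Im x|.
Proof.
rewrite [x in N x]complexE (le_trans (leND _ _))// NM !NC.
by rewrite (_ : N 'i%C = 1) ?mul1r// /= expr0n expr1n add0r sqrtr1.
Qed.

End ComplexAlgebra.

(** * The torus as a finite measure space *)

Section TorusMeasure.
Variable R : realType.

Lemma torus_setT : torus R setT = (2 * pi)%:E.
Proof.
rewrite /torus /= /mrestr setTI lebesgue_measure_itv /= lte_fin.
by rewrite mulr_gt0 ?pi_gt0// oppr0 adde0.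
Qed.

Lemma torus_fin : fin_num_fun (torus R).
Proof.
move=> A mA; rewrite ge0_fin_numE// (@le_lt_trans _ _ (torus R setT))//.
  by apply: le_measure => //; rewrite inE.
by rewrite torus_setT ltry.
Qed.

(** Product measures ask for more structure than the bare measure [torus R] carries; this is the
    same measure with its finiteness attached. *)
Definition tmu : {finite_measure set (measurableTypeR R) -> \bar R} :=
  HB.pack (Measure.sort (torus R)) (Measure.class (torus R))
    (@Measure_isFinite.Build _ _ _ (torus R) torus_fin).

Lemma torus_set1 (x : R) : torus R [set x] = 0%E.
Proof.
apply/eqP; rewrite eq_le measure_ge0 andbT -(@lebesgue_measure_set1 R x).
by apply: le_measure; rewrite ?inE//; apply: measurableI => //; exact: measurable_itv.
Qed.

Lemma ae_torus (Q : R -> Prop) :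
  (forall x, 0 <= x < 2 * pi -> Q x) -> {ae torus R, forall x, Q x}.
Proof.
move=> HQ; exists (~` `[0, 2 * pi[); split.
- by apply: measurableC; exact: measurable_itv.
- by rewrite /torus /= /mrestr setICl measure0.
- by move=> x /= nQ; apply: contra_not nQ => Ix; apply: HQ; move: Ix; rewrite in_itv.
Qed.

End TorusMeasure.

Section Ae.
Variable R : realType.
Local Notation mu := (torus R).
Implicit Types P Q : R -> Prop.

Lemma aeS P Q : (forall x, P x -> Q x) ->
  {ae mu, forall x, P x} -> {ae mu, forall x, Q x}.
Proof. exact: (@filterS _ _ (ae_filter_ringOfSetsType mu)). Qed.

Lemma aeI P Q : {ae mu, forall x, P x} -> {ae mu, forall x, Q x} ->
  {ae mu, forall x, P x /\ Q x}.
Proof. exact: (@filterI _ _ (ae_filter_ringOfSetsType mu)). Qed.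

Lemma ae_eqP T (f g : R -> T) :
  f = g %[ae mu] <-> {ae mu, forall x, f x = g x}.
Proof. by split; apply: aeS => x; [exact|]. Qed.

End Ae.

(** * Integration over the torus, real and complex *)

Section RealIntegral.
Variable R : realType.
Local Notation mu := (torus R).
Implicit Types f g h : R -> R.

Definition rint h := mu.-integrable setT (EFin \o h).
Definition rmeas h := @measurable_fun _ _ (measurableTypeR R) (measurableTypeR R) setT h.
Definition rbm h := rmeas h /\ exists K, forall x, `|h x| <= K.
Definition J h : R := \int[mu]_x h x.

Lemma rint_meas h : rint h -> rmeas h.
Proof. by case/integrableP => /measurable_EFinP. Qed.

Lemma rintD f g : rint f -> rint g -> rint (fun x => f x + g x).
Proof. by move=> hf hg; have := integrableD measurableT hf hg. Qed.
Lemma rintZ c f : rint f -> rint (fun x => c * f x).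
Proof. by move=> hf; have := integrableZl measurableT c hf. Qed.
Lemma rintN f : rint f -> rint (fun x => - f x).
Proof. by move=> /(rintZ (-1)); under eq_fun do rewrite mulN1r. Qed.
Lemma rintB f g : rint f -> rint g -> rint (fun x => f x - g x).
Proof. by move=> hf hg; exact: rintD (rintN hg). Qed.
Lemma rint_norm f : rint f -> rint (fun x => `|f x|).
Proof. by move=> hf; have := integrable_abse hf. Qed.
Lemma rint_le f g : rmeas f -> (forall x, `|f x| <= g x) -> rint g -> rint f.
Proof.
move=> mf fg; apply: le_integrable => //; first exact/measurable_EFinP.
by move=> x _ /=; rewrite lee_fin (le_trans (fg x))// ler_norm.
Qed.
Lemma rint_cst c : rint (fun=> c).
Proof. exact: (@finite_measure_integrable_cst _ _ _ (tmu R)). Qed.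
Lemma rbm_rint h : rbm h -> rint h.
Proof. by move=> [mh [K hK]]; exact: rint_le (rint_cst K). Qed.
Lemma rint_rbmM h g : rbm h -> rint g -> rint (fun x => h x * g x).
Proof.
move=> [mh [K hK]] ig; apply: (@rint_le _ (fun x => K * `|g x|)).
- by apply: measurable_funM => //; exact: rint_meas.
- by move=> x; rewrite normrM ler_wpM2r.
- by apply: rintZ; exact: rint_norm.
Qed.

Lemma rmeas_cst c : rmeas (fun=> c). Proof. exact: measurable_cst. Qed.
Lemma rmeasD f g : rmeas f -> rmeas g -> rmeas (fun x => f x + g x).
Proof. exact: measurable_funD. Qed.
Lemma rmeasM f g : rmeas f -> rmeas g -> rmeas (fun x => f x * g x).
Proof. exact: measurable_funM. Qed.
Lemma rmeasN f : rmeas f -> rmeas (fun x => - f x).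
Proof. by move=> mf; have := rmeasM (rmeas_cst (-1)) mf; under eq_fun do rewrite mulN1r. Qed.
Lemma rmeasB f g : rmeas f -> rmeas g -> rmeas (fun x => f x - g x).
Proof. by move=> mf mg; exact: rmeasD (rmeasN mg). Qed.
Lemma rmeas_norm f : rmeas f -> rmeas (fun x => `|f x|).
Proof. by move=> mf; exact: measurableT_comp. Qed.
Lemma rmeas_continuous f : continuous f -> rmeas f.
Proof. exact: continuous_measurable_fun. Qed.

Lemma rbm_cst c : rbm (fun=> c).
Proof. by split; [exact: rmeas_cst | exists `|c|]. Qed.
Lemma rbmD f g : rbm f -> rbm g -> rbm (fun x => f x + g x).
Proof.
move=> [mf [K hK]] [mg [L hL]]; split; first exact: rmeasD.
by exists (K + L) => x; rewrite (le_trans (ler_normD _ _))// lerD.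
Qed.
Lemma rbmM f g : rbm f -> rbm g -> rbm (fun x => f x * g x).
Proof.
move=> [mf [K hK]] [mg [L hL]]; split; first exact: rmeasM.
by exists (K * L) => x; rewrite normrM ler_pM.
Qed.

Lemma JD f g : rint f -> rint g -> J (fun x => f x + g x) = J f + J g.
Proof. by move=> hf hg; exact: RintegralD. Qed.
Lemma JZ c f : rint f -> J (fun x => c * f x) = c * J f.
Proof. by move=> hf; exact: RintegralZl. Qed.
Lemma JN f : rint f -> J (fun x => - f x) = - J f.
Proof.
by move=> /(JZ (-1)); rewrite mulN1r => <-; congr J; apply/funext => x; rewrite mulN1r.
Qed.
Lemma JB f g : rint f -> rint g -> J (fun x => f x - g x) = J f - J g.
Proof. by move=> hf hg; rewrite JD ?JN//; exact: rintN. Qed.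
Lemma J_cst c : J (fun=> c) = 2 * pi * c.
Proof. by rewrite /J Rintegral_cst// torus_setT mulrC. Qed.

Lemma J_ae f g : rmeas f -> rmeas g -> f = g %[ae mu] -> J f = J g.
Proof.
move=> mf mg fg; rewrite /J /Rintegral; congr fine; apply: ae_eq_integral => //.
- exact/measurable_EFinP.
- exact/measurable_EFinP.
- by apply: aeS fg => x /= fgx Dx; rewrite (fgx Dx).
Qed.

Lemma J_ge0 f : (forall x, 0 <= f x) -> 0 <= J f.
Proof. by move=> f0; exact: Rintegral_ge0. Qed.

Lemma le_J_ae f g : rint f -> rint g -> {ae mu, forall x, f x <= g x} -> J f <= J g.
Proof.
move=> hf hg fg; rewrite -subr_ge0 -JB//.
have -> : J (fun x => g x - f x) = J (fun x => `|g x - f x|).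
  apply: J_ae.
  - by apply: rint_meas; exact: rintB.
  - by apply: rint_meas; apply: rint_norm; exact: rintB.
  - by apply/ae_eqP; apply: aeS fg => x fgx; rewrite ger0_norm ?subr_ge0.
exact: J_ge0.
Qed.

Lemma le_J f g : rint f -> rint g ->
  (forall x, 0 <= x < 2 * pi -> f x <= g x) -> J f <= J g.
Proof. by move=> hf hg fg; apply: le_J_ae => //; exact: ae_torus. Qed.

Lemma J_eq0 f : rint f -> {ae mu, forall x, 0 <= f x} -> J f = 0 ->
  {ae mu, forall x, f x = 0}.
Proof.
move=> hf f0 J0.
have eqf : {ae mu, forall x, f x = `|f x|} by apply: aeS f0 => x ?; rewrite ger0_norm.
have J1 : J (fun x => `|f x|) = 0.
  rewrite -J0; apply/esym/J_ae; [exact: rint_meas|by apply: rint_meas; apply: rint_norm|].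
  exact/ae_eqP.
have : (\int[mu]_x `|(EFin \o f) x|)%E = 0%E.
  have hn := rint_norm hf.
  rewrite -[LHS]fineK; last exact: integrable_fin_num.
  by congr EFin; exact: J1.
move/(ae_eq_integral_abs _ measurableT) => /(_ (proj1 (integrableP _ _ _ hf))).
by apply: aeS => x /(_ I) /= [].
Qed.

End RealIntegral.

Section ComplexIntegral.
Variable R : realType.
Local Notation mu := (torus R).
Implicit Types f g h : R -> R[i].

Definition cmeas f := rmeas (fun x => Re (f x)) /\ rmeas (fun x => Im (f x)).
Definition cint f := rint (fun x => Re (f x)) /\ rint (fun x => Im (f x)).
Definition bm f := cmeas f /\ exists K, forall x, N (f x) <= K.

Lemma cint_meas f : cint f -> cmeas f.
Proof. by case=> /rint_meas ? /rint_meas ?. Qed.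

Lemma cmeas_cst c : cmeas (fun=> c).
Proof. by split; exact: rmeas_cst. Qed.
Lemma cmeasC (a : R -> R) : rmeas a -> cmeas (fun x => (a x)%:C).
Proof. by move=> ma; split => //; exact: rmeas_cst. Qed.
Lemma cmeasD f g : cmeas f -> cmeas g -> cmeas (fun x => f x + g x).
Proof.
move=> [? ?] [? ?]; split.
  by under eq_fun do rewrite ReD; exact: rmeasD.
by under eq_fun do rewrite ImD; exact: rmeasD.
Qed.
Lemma cmeasM f g : cmeas f -> cmeas g -> cmeas (fun x => f x * g x).
Proof.
move=> [? ?] [? ?]; split.
  by under eq_fun do rewrite ReM; apply: rmeasB; exact: rmeasM.
by under eq_fun do rewrite ImM; apply: rmeasD; exact: rmeasM.
Qed.
Lemma cmeasJ f : cmeas f -> cmeas (fun x => conjc (f x)).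
Proof.
move=> [? ?]; split; first by under eq_fun do rewrite ReJ.
by under eq_fun do rewrite ImJ; exact: rmeasN.
Qed.
Lemma cmeasN f : cmeas f -> cmeas (fun x => - f x).
Proof.
move=> [? ?]; split; first by under eq_fun do rewrite ReN; exact: rmeasN.
by under eq_fun do rewrite ImN; exact: rmeasN.
Qed.
Lemma cmeas_N f : cmeas f -> rmeas (fun x => N (f x)).
Proof.
move=> [mr mi].
have -> : (fun x => N (f x)) =
    (fun x => Num.sqrt (Re (f x) * Re (f x) + Im (f x) * Im (f x))).
  apply/funext => x; rewrite -!expr2 -N_sqr sqrtr_sqr ger0_norm//; exact: N_ge0.
apply: (@measurableT_comp _ _ _ _ _ _ (@Num.sqrt R)).
  by apply: continuous_measurable_fun; exact: sqrt_continuous.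
by apply: rmeasD; exact: rmeasM.
Qed.

Lemma bm_cst c : bm (fun=> c).
Proof. by split; [exact: cmeas_cst | exists (N c)]. Qed.
Lemma bmD f g : bm f -> bm g -> bm (fun x => f x + g x).
Proof.
move=> [mf [K hK]] [mg [L hL]]; split; first exact: cmeasD.
by exists (K + L) => x; rewrite (le_trans (leND _ _))// lerD.
Qed.
Lemma bmM f g : bm f -> bm g -> bm (fun x => f x * g x).
Proof.
move=> [mf [K hK]] [mg [L hL]]; split; first exact: cmeasM.
by exists (K * L) => x; rewrite NM ler_pM// N_ge0.
Qed.
Lemma bmJ f : bm f -> bm (fun x => conjc (f x)).
Proof. by move=> [mf [K hK]]; split; [exact: cmeasJ | exists K => x; rewrite NJ]. Qed.
Lemma bmN f : bm f -> bm (fun x => - f x).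
Proof. by move=> [mf [K hK]]; split; [exact: cmeasN | exists K => x; rewrite NN]. Qed.
Lemma bmB f g : bm f -> bm g -> bm (fun x => f x - g x).
Proof. by move=> mf mg; exact: bmD (bmN mg). Qed.
Lemma bmZ c f : bm f -> bm (fun x => c * f x).
Proof. by move=> hf; apply: bmM => //; exact: bm_cst. Qed.
Lemma bmC (a : R -> R) : rbm a -> bm (fun x => (a x)%:C).
Proof. by move=> [ma [K hK]]; split; [exact: cmeasC | exists K => x; rewrite NC]. Qed.
Lemma bm_rbmN f : bm f -> rbm (fun x => N (f x)).
Proof.
move=> [mf [K hK]]; split; first exact: cmeas_N.
by exists K => x; rewrite ger0_norm ?N_ge0.
Qed.
Lemma bm_rbm_Re f : bm f -> rbm (fun x => Re (f x)).
Proof. by move=> [[? ?] [K hK]]; split => //; exists K => x; exact: le_trans (Re_leN _) _. Qed.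
Lemma bm_rbm_Im f : bm f -> rbm (fun x => Im (f x)).
Proof. by move=> [[? ?] [K hK]]; split => //; exists K => x; exact: le_trans (Im_leN _) _. Qed.

Lemma cint_le f (g : R -> R) : cmeas f -> rint g -> (forall x, N (f x) <= g x) -> cint f.
Proof.
move=> [mr mi] ig fg; split.
  by apply: rint_le ig => // x; exact: le_trans (Re_leN _) _.
by apply: rint_le ig => // x; exact: le_trans (Im_leN _) _.
Qed.
Lemma cint_N f : cint f -> rint (fun x => N (f x)).
Proof.
move=> cf; have [cr ci] := cf.
apply: (@rint_le _ _ (fun x => `|Re (f x)| + `|Im (f x)|)).
- by apply: cmeas_N; exact: cint_meas.
- by move=> x; rewrite ger0_norm ?N_ge0// N_leRI.
- by apply: rintD; exact: rint_norm.
Qed.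
Lemma bm_cint f : bm f -> cint f.
Proof. by move=> [mf [K hK]]; exact: cint_le (rint_cst K) _. Qed.
Lemma cintD f g : cint f -> cint g -> cint (fun x => f x + g x).
Proof.
move=> [? ?] [? ?]; split; first by under eq_fun do rewrite ReD; exact: rintD.
by under eq_fun do rewrite ImD; exact: rintD.
Qed.
Lemma cint_bmM f g : bm f -> cint g -> cint (fun x => f x * g x).
Proof.
move=> [mf [K hK]] ig; apply: (@cint_le _ (fun x => K * N (g x))).
- by apply: cmeasM => //; exact: cint_meas.
- by apply: rintZ; exact: cint_N.
- by move=> x; rewrite NM ler_wpM2r// N_ge0.
Qed.
Lemma cint_Mbm f g : cint f -> bm g -> cint (fun x => f x * g x).
Proof. by move=> cf bg; under eq_fun do rewrite mulrC; exact: cint_bmM. Qed.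
Lemma cintZ c f : cint f -> cint (fun x => c * f x).
Proof. by move=> hf; apply: cint_bmM => //; exact: bm_cst. Qed.
Lemma cintN f : cint f -> cint (fun x => - f x).
Proof. by move=> /(cintZ (-1)); under eq_fun do rewrite mulN1r. Qed.
Lemma cintB f g : cint f -> cint g -> cint (fun x => f x - g x).
Proof. by move=> hf hg; exact: cintD (cintN hg). Qed.

Lemma cintegralE f :
  cintegral f = (J (fun x => Re (f x))) +i* (J (fun x => Im (f x))).
Proof. by []. Qed.
Lemma Re_cintegral f : Re (cintegral f) = J (fun x => Re (f x)). Proof. by []. Qed.
Lemma Im_cintegral f : Im (cintegral f) = J (fun x => Im (f x)). Proof. by []. Qed.

Lemma cintegralD f g : cint f -> cint g ->
  cintegral (fun x => f x + g x) = cintegral f + cintegral g.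
Proof.
move=> [? ?] [? ?]; apply: ceqP; rewrite !(Re_cintegral, Im_cintegral, reimE) -JD//.
  by congr J; apply/funext => x; rewrite ReD.
by congr J; apply/funext => x; rewrite ImD.
Qed.
Lemma cintegralZ c f : cint f -> cintegral (fun x => c * f x) = c * cintegral f.
Proof.
move=> [? ?]; apply: ceqP; rewrite !(Re_cintegral, Im_cintegral, reimE) -!JZ//.
  rewrite -JB; [|exact: rintZ|exact: rintZ].
  by congr J; apply/funext => x; rewrite ReM.
rewrite -JD; [|exact: rintZ|exact: rintZ].
by congr J; apply/funext => x; rewrite ImM.
Qed.
Lemma cintegralN f : cint f -> cintegral (fun x => - f x) = - cintegral f.
Proof.
move=> /(cintegralZ (-1)); rewrite mulN1r => <-.
by congr cintegral; apply/funext => x; rewrite mulN1r.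
Qed.
Lemma cintegralB f g : cint f -> cint g ->
  cintegral (fun x => f x - g x) = cintegral f - cintegral g.
Proof. by move=> hf hg; rewrite cintegralD ?cintegralN//; exact: cintN. Qed.
Lemma cintegralJ f : cint f -> cintegral (fun x => conjc (f x)) = conjc (cintegral f).
Proof.
move=> [? ?]; apply: ceqP; rewrite !(Re_cintegral, Im_cintegral, reimE).
  by congr J; apply/funext => x; rewrite ReJ.
by rewrite -JN//; congr J; apply/funext => x; rewrite ImJ.
Qed.
Lemma cintegral_cst c : cintegral (fun=> c) = (2 * pi)%:C * c :> R[i].
Proof. by apply: ceqP; rewrite !(Re_cintegral, Im_cintegral, reimE) !J_cst; ring. Qed.
Lemma cintegral_ae f g : cmeas f -> cmeas g -> f = g %[ae mu] ->
  cintegral f = cintegral g.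
Proof.
move=> [? ?] [? ?] /ae_eqP fg; apply: ceqP; rewrite !(Re_cintegral, Im_cintegral).
  by apply: J_ae => //; apply/ae_eqP; apply: aeS fg => x ->.
by apply: J_ae => //; apply/ae_eqP; apply: aeS fg => x ->.
Qed.
Lemma eq_cintegral f g : cmeas f -> cmeas g ->
  (forall x, 0 <= x < 2 * pi -> f x = g x) -> cintegral f = cintegral g.
Proof. by move=> mf mg fg; apply: cintegral_ae => //; apply/ae_eqP; exact: ae_torus. Qed.

(* Rotating the integral onto the positive real axis. *)
Lemma le_N_cintegral f : cint f -> N (cintegral f) <= J (fun x => N (f x)).
Proof.
move=> cf; have [I0|I0] := eqVneq (cintegral f) 0.
  by rewrite I0 N0; apply: J_ge0 => x; exact: N_ge0.
pose c := conjc (cintegral f) / (N (cintegral f))%:C.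
have NI : 0 < N (cintegral f) by rewrite N_gt0.
have Nc : N c = 1.
  by rewrite /c NM NV NC NJ ger0_norm ?N_ge0// divff// gt_eqF.
have cI : c * cintegral f = (N (cintegral f))%:C.
  rewrite /c mulrAC (mulrC (conjc _)) N_mulJ expr2 rmorphM -mulrA divff ?mulr1//.
  by rewrite -N_eq0 NC normr_eq0 gt_eqF.
rewrite -[leLHS]ReC -cI -cintegralZ// Re_cintegral.
apply: le_J; [by case: (cintZ c cf) | exact: cint_N|].
by move=> x _; rewrite (le_trans (ler_norm _))// (le_trans (Re_leN _))// NM Nc mul1r.
Qed.

Lemma le_N_cintegral_bd f K : cint f -> (forall x, 0 <= x < 2 * pi -> N (f x) <= K) ->
  N (cintegral f) <= 2 * pi * K.
Proof.
move=> cf fK; rewrite (le_trans (le_N_cintegral cf))// -J_cst.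
by apply: le_J => //; [exact: cint_N|exact: rint_cst].
Qed.

Lemma cintegral_sum (I : Type) (s : seq I) (F : I -> R -> R[i]) :
  (forall i, cint (F i)) ->
  cint (fun x => \sum_(i <- s) F i x) /\
  cintegral (fun x => \sum_(i <- s) F i x) = \sum_(i <- s) cintegral (F i).
Proof.
move=> cF; elim: s => [|i s [ih1 ih2]].
  under eq_fun do rewrite big_nil; rewrite big_nil; split.
    by apply: bm_cint; exact: bm_cst.
  by rewrite cintegral_cst mulr0.
under eq_fun do rewrite big_cons; rewrite big_cons; split; first exact: cintD.
by rewrite cintegralD// ih2.
Qed.

End ComplexIntegral.

(** * Fubini's theorem and primitives *)

Section Fubini.
Variable R : realType.
Local Notation mu := (torus R).
Local Notation T := (measurableTypeR R).
Implicit Types f g : R -> R.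

Section DominatedKernel.
Variables (h : R -> R -> R) (a b : R -> R).
Hypothesis mh : measurable_fun setT (fun p : T * T => h p.1 p.2).
Hypotheses (ia : rint a) (ib : rint b).
Hypothesis hab : forall t s, `|h t s| <= `|a t| * `|b s|.

Let rmeas1 t : rmeas (h t).
Proof.
by have := @measurableT_comp _ _ _ _ _ _ _ _ _ mh (pair1_measurable (t : T)).
Qed.

Let rmeas2 s : rmeas (h^~ s).
Proof.
by have := @measurableT_comp _ _ _ _ _ _ _ _ _ mh (pair2_measurable (s : T)).
Qed.

Let rint1 t : rint (h t).
Proof.
apply: rint_le (rmeas1 t) (hab t) _.
by apply: rintZ; exact: rint_norm.
Qed.

Let rint2 s : rint (h^~ s).
Proof.
apply: rint_le (rmeas2 s) (hab^~ s) _.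
by under eq_fun do rewrite mulrC; apply: rintZ; exact: rint_norm.
Qed.

Let ih : (tmu R \x tmu R)%E.-integrable setT (fun p : T * T => (h p.1 p.2)%:E).
Proof.
apply/integrable12ltyP; first exact/measurable_EFinP.
apply: (@le_lt_trans _ _ (\int[tmu R]_t (`|a t| * J (fun s => `|b s|))%:E)%E).
  apply: ge0_le_integral => //.
  - by move=> t _; apply: integral_ge0.
  - apply: (@measurable_fun_fubini_tonelli_F _ _ T T R (tmu R)
      (fun p => (`|h p.1 p.2|)%:E)) => //.
    by apply/measurable_EFinP; exact: measurableT_comp.
  - apply/measurable_EFinP; apply: rmeasM; last exact: rmeas_cst.
    by apply: rmeas_norm; exact: rint_meas.
  - move=> t _ /=.
    rewrite [leLHS](_ : _ = (J (fun s => `|h t s|))%:E); last first.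
      by rewrite /J /Rintegral fineK//; apply: (integrable_fin_num measurableT (rint_norm (rint1 t))).
    rewrite lee_fin -JZ; last exact: rint_norm.
    apply: le_J => //; first exact: rint_norm.
    by apply: rintZ; exact: rint_norm.
rewrite -ge0_fin_numE.
  apply: (@integrable_fin_num _ _ _ (tmu R) setT measurableT).
  have -> : (fun t => (`|a t| * J (fun s => `|b s|))%:E) =
      EFin \o (fun t => J (fun s => `|b s|) * `|a t|).
    by apply/funext => t /=; rewrite mulrC.
  by apply: rintZ; exact: rint_norm.
by apply: integral_ge0 => t _; rewrite lee_fin mulr_ge0// J_ge0.
Qed.

Lemma J_Fubini : J (fun t => J (fun s => h t s)) = J (fun s => J (fun t => h t s)).
Proof.
have := Fubini ih; rewrite /J /Rintegral => /(congr1 fine) FE.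
transitivity (fine (\int[tmu R]_x \int[tmu R]_y (h x y)%:E)%E).
  congr fine; apply: eq_integral => t _; rewrite fineK//.
  exact: (integrable_fin_num measurableT (rint1 t)).
rewrite FE; congr fine; apply: eq_integral => s _; rewrite fineK//.
exact: (integrable_fin_num measurableT (rint2 s)).
Qed.

Lemma rint_Fubini : rint (fun t => J (fun s => h t s)).
Proof.
have := integrable_fubini_F ih; rewrite /rint; congr (_.-integrable _ _).
apply/funext => t /=; rewrite /J /Rintegral fineK//.
exact: (integrable_fin_num measurableT (rint1 t)).
Qed.

End DominatedKernel.

(** Integrating over the whole torus against this kernel, rather than over [[0, x]], keeps the
    domain fixed, so that primitives of primitives are iterated integrals to which Fubini
    applies. *)
Definition ind (x t : R) : R := if t <= x then 1 else 0.

Lemma ind_ge0 x t : 0 <= ind x t. Proof. by rewrite /ind; case: ifP. Qed.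
Lemma norm_ind x t : `|ind x t| <= 1.
Proof. by rewrite /ind; case: ifP; rewrite ?normr1 ?normr0. Qed.

Lemma measurable_ind2 : measurable_fun setT (fun p : T * T => ind p.1 p.2).
Proof.
apply: measurable_fun_ifT => //; first exact: measurable_fun_ler.
Qed.

Lemma rbm_ind x : rbm (ind x).
Proof.
split; last by exists 1; exact: norm_ind.
by have := @measurableT_comp _ _ _ _ _ _ _ _ _ measurable_ind2 (pair1_measurable (x : T)).
Qed.

Definition Pr f x := J (fun t => ind x t * f t).

Lemma rint_ind x f : rint f -> rint (fun t => ind x t * f t).
Proof. by apply: rint_rbmM; exact: rbm_ind. Qed.

Lemma rbm_Pr f : rint f -> rbm (Pr f).
Proof.
move=> hf; split.
  apply: rint_meas; apply: (@rint_Fubini _ (fun=> 1) f) => //.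
  - apply: measurable_funM; first exact: measurable_ind2.
    by apply: measurableT_comp => //; exact: rint_meas.
  - exact: rint_cst.
  - by move=> t s; rewrite normrM ler_wpM2r// normr1 norm_ind.
exists (J (fun t => `|f t|)) => x.
rewrite (le_trans (le_normr_Rintegral measurableT (rint_ind x hf)))//.
apply: le_J => //; [exact/rint_norm/rint_ind|exact: rint_norm|].
by move=> t _; rewrite normrM ler_piMl// norm_ind.
Qed.

(** Integration by parts for merely integrable functions: the square [[0, x]^2] is cut along its
    diagonal into two triangles, and Fubini exchanges the order of integration on one of them. *)
Lemma Pr_mul f g x : rint f -> rint g ->
  Pr f x * Pr g x = Pr (fun t => f t * Pr g t + Pr f t * g t) x.
Proof.
move=> hf hg.
pose h t s := ind x t * f t * (ind t s * g s).
have E1 : J (fun t => J (h t)) = J (fun s => J (h^~ s)).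
  apply: (@J_Fubini _ f g) => //.
    apply: measurable_funM.
      apply: (@measurableT_comp _ _ _ _ _ _ (fun t => ind x t * f t)) => //.
      by apply: rmeasM; [case: (rbm_ind x)|exact: rint_meas].
    apply: measurable_funM; first exact: measurable_ind2.
    by apply: measurableT_comp => //; exact: rint_meas.
  move=> t s; rewrite !normrM.
  by apply: ler_pM; rewrite ?mulr_ge0 ?normr_ge0//; apply: ler_piMl; rewrite ?normr_ge0 ?norm_ind.
have bf := rbm_Pr hf; have bg := rbm_Pr hg.
have i1 : rint (fun t => ind x t * (f t * Pr g t)).
  by apply: rint_ind; under eq_fun do rewrite mulrC; exact: rint_rbmM.
have i2 : rint (fun t => ind x t * (Pr f t * g t)).
  by apply: rint_ind; exact: rint_rbmM.
rewrite {3}/Pr; under [in RHS]eq_fun do rewrite mulrDr.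
rewrite JD//.
have -> : J (fun t => ind x t * (f t * Pr g t)) = J (fun t => J (h t)).
  congr J; apply/funext => t; rewrite /h JZ; last exact: rint_ind.
  by rewrite mulrA.
rewrite E1.
have i3 s : rint (fun t => ind x t * ind t s * f t).
  apply: (@rint_le _ _ (fun t => `|f t|)).
  - apply: rmeasM; last exact: rint_meas.
    apply: rmeasM; first by case: (rbm_ind x).
    by have := @measurableT_comp _ _ _ _ _ _ _ _ _ measurable_ind2 (pair2_measurable (s : T)).
  - move=> t; rewrite !normrM; apply: ler_piMl; first exact: normr_ge0.
    by apply: mulr_ile1; rewrite ?normr_ge0 ?norm_ind.
  - exact: rint_norm.
have hE : (fun s => J (h^~ s)) = (fun s => J (fun t => ind x t * ind t s * f t) * g s).
  apply/funext => s; rewrite mulrC -JZ//; congr J; apply/funext => t; rewrite /h; ring.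
have ih : rint (fun s => J (h^~ s)).
  rewrite /h.
  apply: (@rint_Fubini (fun s t => ind x t * f t * (ind t s * g s)) g f) => //.
    apply: measurable_funM.
      apply: (@measurableT_comp _ _ _ _ _ _ (fun t => ind x t * f t)) => //.
      by apply: rmeasM; [case: (rbm_ind x)|exact: rint_meas].
    apply: measurable_funM; last by apply: measurableT_comp => //; exact: rint_meas.
    by have := @measurableT_comp _ _ _ _ _ _ _ _ _ measurable_ind2 (@measurable_swap _ _ T T).
  move=> t s; rewrite !normrM [leRHS]mulrC.
  by apply: ler_pM; rewrite ?mulr_ge0 ?normr_ge0//; apply: ler_piMl; rewrite ?normr_ge0 ?norm_ind.
rewrite -JD//.
rewrite -[Pr f x * Pr g x]JZ; last exact: rint_ind.
congr J; apply/funext => s; have -> := congr1 (@^~ s) hE.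
have [sx|xs] := leP s x.
  have -> : ind x s = 1 by rewrite /ind sx.
  rewrite !mul1r -mulrDl; congr (_ * _).
  rewrite [Pr f s]/Pr -JD//; last exact: rint_ind.
  apply: J_ae.
  - by apply: rint_meas; exact: rint_ind.
  - by apply: rint_meas; apply: rintD => //; exact: rint_ind.
  (* The two closed triangles overlap on the diagonal, so the kernels agree only for [t != s]. *)
  - apply/ae_eqP; exists [set s]; split; [exact: measurable_set1|exact: torus_set1|].
    move=> t /=; apply: contra_notP => /eqP ts; rewrite /ind.
    have [tx|xt] := leP t x; have [st|ts'] := leP s t.
    + by rewrite [t <= s]leNgt lt_neqAle eq_sym ts st /= !mul1r mul0r addr0.
    + by rewrite (ltW ts') mulr0 mul0r add0r.
    + by rewrite [t <= s]leNgt (le_lt_trans sx xt)/= !mul0r addr0.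
    + by move: (lt_trans ts' (le_lt_trans sx xt)); rewrite ltxx.
have -> : ind x s = 0 by rewrite /ind leNgt xs.
rewrite !mul0r mulr0 addr0.
rewrite (_ : (fun t => _) = fun=> 0) ?J_cst ?mulr0 ?mul0r//.
apply/funext => t; rewrite /ind; have [tx|] := leP t x; rewrite ?mul0r//.
by rewrite [s <= t]leNgt (le_lt_trans tx xs)/= mulr0 mul0r.
Qed.

End Fubini.

(** * Classical derivatives and the fundamental theorem of calculus on the torus *)

Section PointwiseDerivatives.
Variable R : realType.
Implicit Types (f g : R -> R) (x : R).

Lemma isd_cst (c : R) x : is_derive x 1 (fun=> c) 0.
Proof. exact: is_derive_cst. Qed.
Lemma isd_id x : is_derive x 1 (fun y => y) 1.
Proof. exact: is_derive_id. Qed.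
Lemma isdD f g x df dg : is_derive x 1 f df -> is_derive x 1 g dg ->
  is_derive x 1 (fun y => f y + g y) (df + dg).
Proof. by move=> h1 h2; exact: is_deriveD. Qed.
Lemma isdM f g x df dg : is_derive x 1 f df -> is_derive x 1 g dg ->
  is_derive x 1 (fun y => f y * g y) (df * g x + f x * dg).
Proof.
by move=> h1 h2; apply: is_derive_eq (is_deriveM h1 h2) _; rewrite /GRing.scale/=; ring.
Qed.
Lemma isdZ c f x df : is_derive x 1 f df -> is_derive x 1 (fun y => c * f y) (c * df).
Proof.
by move=> h1; apply: is_derive_eq (isdM (isd_cst c x) h1) _; rewrite mul0r add0r.
Qed.
Lemma isd_comp f g x df dg : is_derive (g x) 1 f df -> is_derive x 1 g dg ->
  is_derive x 1 (fun y => f (g y)) (df * dg).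
Proof. by move=> h1 h2; exact: is_derive1_comp. Qed.
Lemma isd_expZ (c : R) x : is_derive x 1 (fun y => expR (c * y)) (c * expR (c * x)).
Proof.
apply: is_derive_eq (isd_comp (is_derive_expR _) (isdZ c (isd_id x))) _.
by rewrite mulr1 mulrC.
Qed.
Lemma isd_continuous f (df : R -> R) : (forall x, is_derive x 1 f (df x)) -> continuous f.
Proof.
by move=> h x; apply: differentiable_continuous; apply/derivable1_diffP; apply: ex_derive.
Qed.

End PointwiseDerivatives.

Section RealPrimitive.
Variable R : realType.
Local Notation mu := (torus R).
Local Notation leb := (@lebesgue_measure R).
Local Notation D := (`[0, 2 * pi[%classic : set R).
Implicit Types f g : R -> R.

Lemma twopi_gt0 : 0 < 2 * pi :> R. Proof. by rewrite mulr_gt0 ?pi_gt0. Qed.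
Hint Resolve twopi_gt0 : core.

Let mD : measurable (D : set (measurableTypeR R)).
Proof. exact: measurable_itv. Qed.

Let integral_torus (f : R -> \bar R) : mu.-integrable setT f ->
  (\int[mu]_x f x = \int[leb]_(x in D) f x)%E.
Proof.
move=> hf; rewrite (negligible_integral (measurableC mD))//; last first.
  by rewrite /= /mrestr setICl measure0.
rewrite setDE setCK setTI; apply: eq_measure_integral => A mA AD.
by rewrite /= /mrestr setIidl.
Qed.

Lemma J_lebesgue f : rint f -> J f = \int[leb]_(x in D) f x.
Proof. by move=> hf; rewrite /J /Rintegral integral_torus. Qed.

Lemma rint_lebesgue f : rint f -> leb.-integrable D (EFin \o f).
Proof.
move=> hf; have hn := integrable_abse hf; apply/integrableP; split.
  by apply: measurable_funTS; exact: (measurable_int mu).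
by rewrite -(integral_torus hn); case/integrableP : hf.
Qed.

Lemma Pr_lebesgue f x : rint f -> 0 <= x < 2 * pi ->
  Pr f x = \int[leb]_(t in `[0, x]) f t.
Proof.
move=> hf /andP[x0 x2]; rewrite /Pr J_lebesgue; last exact: rint_ind.
have -> : (`[0, x] : set R)%classic = D `&` `]-oo, x].
  apply/seteqP; split => t /=; rewrite !in_itv /=.
    by move=> /andP[t0 tx]; rewrite t0 tx (le_lt_trans tx).
  by move=> [/andP[-> _] ->].
rewrite Rintegral_mkcondr; apply: eq_Rintegral => t _.
rewrite /ind patchE; case: ifPn => tx.
  by rewrite mul1r mem_set//= in_itv.
by rewrite mul0r memNset//= in_itv /=; exact/negP.
Qed.

Lemma Pr_2pi f : rint f -> Pr f (2 * pi) = J f.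
Proof.
move=> hf; apply: J_ae; [by apply: rint_meas; exact: rint_ind|exact: rint_meas|].
by apply/ae_eqP; apply: ae_torus => t /andP[_ /ltW t2]; rewrite /ind t2 mul1r.
Qed.

Lemma Pr_0 f : rint f -> Pr f 0 = 0.
Proof.
by move=> hf; rewrite Pr_lebesgue// ?lexx// set_itv1 Rintegral_set1.
Qed.

(* A primitive over the torus is constant on each side of [0, 2 pi]; composing
   with [clamp] gives any other function this shape. *)
Definition clamp (x : R) : R := Num.max 0 (Num.min x (2 * pi)).

Lemma clamp_itv x : 0 <= clamp x <= 2 * pi.
Proof.
by rewrite /clamp le_max lexx /= ge_max (ltW twopi_gt0) ge_min lexx orbT.
Qed.

Lemma clamp_id x : 0 <= x <= 2 * pi -> clamp x = x.
Proof. by move=> /andP[x0 x2]; rewrite /clamp min_l// max_r. Qed.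

Lemma ind_clamp x t : 0 < t < 2 * pi -> ind (clamp x) t = ind x t.
Proof.
move=> /andP[t0 t2]; rewrite /ind /clamp le_max [t <= 0]leNgt t0 /=.
by rewrite le_min (ltW t2) andbT.
Qed.

Lemma ae_torus_oo (Q : R -> Prop) :
  (forall x, 0 < x < 2 * pi -> Q x) -> {ae mu, forall x, Q x}.
Proof.
move=> HQ; have n0 : {ae mu, forall x, x != 0}.
  exists [set 0]; split => //; first exact: torus_set1.
  by move=> x /= /negP; rewrite negbK => /eqP.
have : {ae mu, forall x, 0 <= x < 2 * pi} by exact: ae_torus.
move=> /(aeI n0); apply: aeS => x [x0 /andP[x1 x2]]; apply: HQ.
by rewrite lt_neqAle eq_sym x0 x1 x2.
Qed.

Lemma Pr_clamp f x : rint f -> Pr f (clamp x) = Pr f x.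
Proof.
move=> hf; apply: J_ae; [by apply: rint_meas; exact: rint_ind..|].
by apply/ae_eqP; apply: ae_torus_oo => t ?; rewrite ind_clamp.
Qed.

Lemma le_Pr f g x : rint f -> rint g ->
  (forall t, 0 <= t < 2 * pi -> f t <= g t) -> Pr f x <= Pr g x.
Proof.
move=> hf hg fg; apply: le_J; [exact: rint_ind..|].
by move=> t ?; rewrite ler_wpM2l ?ind_ge0 ?fg.
Qed.

Lemma Pr_FTC (F f : R -> R) x : (forall t : R, is_derive t 1 F (f t)) ->
  continuous f -> rint f -> 0 <= x <= 2 * pi -> Pr f x = F x - F 0.
Proof.
move=> dF cf hf /andP[x0 x2].
have cF : continuous F := isd_continuous dF.
have FTC y : 0 < y -> \int[leb]_(t in `[0, y]) f t = F y - F 0.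
  move=> y0; rewrite /Rintegral (continuous_FTC2 (F := F) y0) //.
  - exact: continuous_subspaceT.
  - split.
    + by move=> t _; apply: ex_derive.
    + exact/cvg_at_right_filter/cF.
    + exact/cvg_at_left_filter/cF.
  - by move=> t _; rewrite derive1E; apply: derive_val.
move: x2; rewrite le_eqVlt => /orP[/eqP ->|x2].
  rewrite Pr_2pi// J_lebesgue// Rintegral_itv_bndo_bndc ?FTC//.
  exact: rint_lebesgue.
move: x0; rewrite le_eqVlt => /orP[/eqP <-|x0]; first by rewrite Pr_0 ?subrr.
by rewrite Pr_lebesgue ?FTC// (ltW x0).
Qed.

Lemma rint_continuous f : continuous f -> rint f.
Proof.
move=> cf.
have [M [_ HM]] : bounded_set (f @` `[0, 2 * pi]).
  apply: compact_bounded; apply: continuous_compact; last exact: segment_compact.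
  exact: continuous_subspaceT.
pose g x := f (clamp x).
have fg : {ae mu, forall x, f x = g x}.
  by apply: ae_torus => x /andP[x0 /ltW x2]; rewrite /g clamp_id ?x0.
have mf : rmeas f by exact: rmeas_continuous.
apply/integrableP; split; first exact/measurable_EFinP.
apply: (@le_lt_trans _ _ (\int[mu]_x (M + 1)%:E)%E).
  apply: ae_ge0_le_integral => //.
  - by apply: measurableT_comp => //; exact/measurable_EFinP.
  - move=> x _; rewrite lee_fin (le_trans (normr_ge0 (f 0)))//.
    by apply: HM; rewrite ?ltrDl//; exists 0 => //=; rewrite in_itv /= lexx ltW.
  - apply: aeS fg => x fgx _; rewrite /comp fgx lee_fin; apply: HM; rewrite ?ltrDl//.
    by exists (clamp x) => //=; rewrite in_itv /= clamp_itv.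
rewrite integral_cst// torus_setT -EFinM ltry//.
Qed.

(* Lebesgue differentiation of the primitive. *)
Lemma Pr_eq0 f : rint f -> (forall x, 0 <= x < 2 * pi -> Pr f x = 0) ->
  {ae mu, forall x, f x = 0}.
Proof.
move=> hf P0.
pose g := f \_ D.
have ig : leb.-integrable setT (EFin \o g).
  by rewrite -restrict_EFin; apply/integrable_restrict => //; rewrite setTI; exact: rint_lebesgue.
have := @FTC1Ny R g.
have ig' y : leb.-integrable `]-oo, y] (EFin \o g).
  by apply: (integrableS measurableT).
move=> /(_ ig' (integrable_locally mD (rint_lebesgue hf))) /=.
pose F (x : R) := \int[leb]_(t in `]-oo, x]) g t.
have F0 x : x < 2 * pi -> F x = 0.
  move=> x2; rewrite /F /g -Rintegral_mkcondr.
  have [x0|x0] := leP 0 x.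
    rewrite -[RHS](P0 x) ?x0// Pr_lebesgue ?x0//; congr Rintegral.
    apply/seteqP; split => t /=; rewrite !in_itv /=.
      by move=> [-> /andP[-> _]].
    by move=> /andP[t0 tx]; rewrite t0 tx (le_lt_trans tx).
  rewrite (_ : _ `&` _ = set0) ?Rintegral_set0//.
  apply/seteqP; split => t //=; rewrite !in_itv /= => -[tx /andP[t0 _]].
  by move: (le_lt_trans (le_trans t0 tx) x0); rewrite ltxx.
move=> [A [mA A0 HA]].
exists (A `|` ~` D); split.
- by apply: measurableU => //; exact: measurableC.
- apply/eqP; rewrite eq_le measure_ge0 andbT.
  rewrite /= /mrestr setIUl setICl setU0 -A0.
  by apply: le_measure; rewrite ?inE//; exact: measurableI.
- move=> x /= fx; have [Dx|] := pselect (D x); last by right.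
  left; apply: HA => /= -[_ dF]; apply: fx.
  have -> : f x = g x by rewrite /g patchE mem_set.
  rewrite -dF derive1E.
  move: Dx; rewrite /= in_itv /= => /andP[_ x2].
  have -> : 'D_1 (fun x : R => \int[leb]_(t in `]-oo, x]) g t) x = 'D_1 (cst 0) x :> R.
    apply: near_eq_derive.
    near=> t; apply: F0; near: t; exact: lt_nbhsl.
  by rewrite derive_cst.
Unshelve. all: by end_near. Qed.

End RealPrimitive.

(** * Absolutely continuous complex functions *)

Section ComplexPrimitive.
Variable R : realType.
Local Notation mu := (torus R).
Implicit Types f g : R -> R[i].

Definition P f x := cintegral (fun t => (ind x t)%:C * f t).

Lemma cint_ind x f : cint f -> cint (fun t => (ind x t)%:C * f t).
Proof. by apply: cint_bmM; apply: bmC; exact: rbm_ind. Qed.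

Lemma Re_P f x : Re (P f x) = Pr (fun t => Re (f t)) x.
Proof.
rewrite Re_cintegral; congr J; apply/funext => t.
by rewrite ReM ReC ImC mul0r subr0.
Qed.
Lemma Im_P f x : Im (P f x) = Pr (fun t => Im (f t)) x.
Proof.
rewrite Im_cintegral; congr J; apply/funext => t.
by rewrite ImM ReC ImC mul0r addr0.
Qed.

Lemma PD f g x : cint f -> cint g -> P (fun t => f t + g t) x = P f x + P g x.
Proof.
move=> hf hg; rewrite -cintegralD; [|exact: cint_ind..].
by congr cintegral; apply/funext => t; rewrite mulrDr.
Qed.
Lemma PZ c f x : cint f -> P (fun t => c * f t) x = c * P f x.
Proof.
move=> hf; rewrite -cintegralZ; last exact: cint_ind.
by congr cintegral; apply/funext => t; rewrite mulrCA.
Qed.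
Lemma PN f x : cint f -> P (fun t => - f t) x = - P f x.
Proof.
move=> hf; rewrite -mulN1r -PZ//.
by congr (P _ x); apply/funext => t; rewrite mulN1r.
Qed.
Lemma PB f g x : cint f -> cint g -> P (fun t => f t - g t) x = P f x - P g x.
Proof. by move=> hf hg; rewrite PD ?PN//; exact: cintN. Qed.
Lemma PJ f x : cint f -> P (fun t => conjc (f t)) x = conjc (P f x).
Proof.
move=> hf; rewrite -cintegralJ; last exact: cint_ind.
by congr cintegral; apply/funext => t; apply: ceqP; rewrite !reimE; ring.
Qed.
Lemma P_ae f g x : cmeas f -> cmeas g -> f = g %[ae mu] -> P f x = P g x.
Proof.
have mi : cmeas (fun t => (ind x t)%:C).
  by apply: cmeasC; case: (rbm_ind x).
move=> mf mg /ae_eqP fg; apply: cintegral_ae; [exact: cmeasM..|].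
by apply/ae_eqP; apply: aeS fg => t ->.
Qed.
Lemma P_2pi f : cint f -> P f (2 * pi) = cintegral f.
Proof. by move=> [? ?]; apply: ceqP; rewrite (Re_P, Im_P) Pr_2pi. Qed.
Lemma P_0 f : cint f -> P f 0 = 0.
Proof. by move=> [? ?]; apply: ceqP; rewrite (Re_P, Im_P) Pr_0. Qed.

Lemma le_N_P f x : cint f -> N (P f x) <= Pr (fun t => N (f t)) x.
Proof.
move=> hf; rewrite (le_trans (le_N_cintegral (cint_ind x hf)))//.
rewrite le_eqVlt; apply/orP; left; apply/eqP; congr J; apply/funext => t.
by rewrite NM NC ger0_norm ?ind_ge0.
Qed.

Lemma bm_P f : cint f -> bm (P f).
Proof.
move=> hf; have [hr hi] := hf; split.
  have [m1 _] := rbm_Pr hr; have [m2 _] := rbm_Pr hi.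
  by split; [under eq_fun do rewrite Re_P|under eq_fun do rewrite Im_P].
exists (J (fun t => N (f t))) => x; rewrite (le_trans (le_N_P _ hf))//.
apply: le_J; [by apply: rint_ind; exact: cint_N|exact: cint_N|].
move=> t _; rewrite ler_piMl ?N_ge0// (le_trans (ler_norm _))//; exact: norm_ind.
Qed.

Lemma P_mul f g x : cint f -> cint g ->
  P f x * P g x = P (fun t => f t * P g t + P f t * g t) x.
Proof.
move=> hf hg; have [fr fi] := hf; have [gr gi] := hg.
have b1 := rbm_Pr fr; have b2 := rbm_Pr fi; have b3 := rbm_Pr gr; have b4 := rbm_Pr gi.
have mm u v : rint u -> rbm v -> rint (fun t => u t * v t).
  by move=> hu hv; under eq_fun do rewrite mulrC; exact: rint_rbmM.
have key (u v : R -> R) : rint u -> rint v ->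
    rint (fun t => u t * Pr v t + Pr u t * v t).
  move=> hu hv; apply: rintD; first by apply: mm => //; exact: rbm_Pr.
  by apply: rint_rbmM => //; exact: rbm_Pr.
have PrD u v : rint u -> rint v -> Pr (fun t => u t + v t) x = Pr u x + Pr v x.
  move=> hu hv; rewrite /Pr -JD; [|exact: rint_ind..].
  by congr J; apply/funext => t; rewrite mulrDr.
have PrB u v : rint u -> rint v -> Pr (fun t => u t - v t) x = Pr u x - Pr v x.
  move=> hu hv; rewrite /Pr -JB; [|exact: rint_ind..].
  by congr J; apply/funext => t; rewrite mulrBr.
apply: ceqP.
  rewrite ReM !(Re_P, Im_P) !Pr_mul// -PrB; [|exact: key..].
  congr Pr; apply/funext => t; rewrite ReD !ReM !(Re_P, Im_P); ring.
rewrite ImM !(Re_P, Im_P) !Pr_mul// -PrD; [|exact: key..].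
congr Pr; apply/funext => t; rewrite ImD !ImM !(Re_P, Im_P); ring.
Qed.

(* [f] is absolutely continuous on the torus with derivative [g]. *)
Definition prim f g := cint g /\ forall x, f x = f 0 + P g x.

Lemma prim_bm f g : prim f g -> bm f.
Proof.
move=> [cg E]; have -> : f = fun x => f 0 + P g x by apply/funext.
by apply: bmD; [exact: bm_cst|exact: bm_P].
Qed.
Lemma prim_2pi f g : prim f g -> f (2 * pi) = f 0 + cintegral g.
Proof. by move=> [cg E]; rewrite E P_2pi. Qed.
Lemma prim_P c g : cint g -> prim (fun x => c + P g x) g.
Proof. by move=> cg; split => // x; rewrite P_0// addr0. Qed.
Lemma prim_cst c : prim (fun=> c) (fun=> 0).
Proof.
split; first by apply: bm_cint; exact: bm_cst.
move=> x; rewrite (_ : (fun=> 0) = fun t => 0 * (fun=> 1) t); last first.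
  by apply/funext => t; rewrite mul0r.
by rewrite PZ ?mul0r ?addr0//; apply: bm_cint; exact: bm_cst.
Qed.
Lemma primD f1 g1 f2 g2 : prim f1 g1 -> prim f2 g2 ->
  prim (fun x => f1 x + f2 x) (fun x => g1 x + g2 x).
Proof.
move=> [c1 E1] [c2 E2]; split; first exact: cintD.
by move=> x; rewrite PD// E1 E2; ring.
Qed.
Lemma primZ c f g : prim f g -> prim (fun x => c * f x) (fun x => c * g x).
Proof.
by move=> [c1 E1]; split; [exact: cintZ|move=> x; rewrite PZ// E1 mulrDr].
Qed.
Lemma primN f g : prim f g -> prim (fun x => - f x) (fun x => - g x).
Proof. by move=> [c1 E1]; split; [exact: cintN|move=> x; rewrite PN// E1 opprD]. Qed.
Lemma primB f1 g1 f2 g2 : prim f1 g1 -> prim f2 g2 ->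
  prim (fun x => f1 x - f2 x) (fun x => g1 x - g2 x).
Proof. by move=> h1 h2; apply: primD => //; exact: primN. Qed.
Lemma primJ f g : prim f g -> prim (fun x => conjc (f x)) (fun x => conjc (g x)).
Proof.
move=> [[c1 c2] E1]; split.
  split; first by under eq_fun do rewrite ReJ.
  by under eq_fun do rewrite ImJ; exact: rintN.
by move=> x; rewrite PJ// E1 rmorphD.
Qed.
Lemma primM f1 g1 f2 g2 : prim f1 g1 -> prim f2 g2 ->
  prim (fun x => f1 x * f2 x) (fun x => g1 x * f2 x + f1 x * g2 x).
Proof.
move=> h1 h2; have b1 := prim_bm h1; have b2 := prim_bm h2.
case: h1 h2 => [c1 E1] [c2 E2].
have i1 : cint (fun x => g1 x * f2 x) by exact: cint_Mbm.
have i2 : cint (fun x => f1 x * g2 x) by exact: cint_bmM.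
split; first exact: cintD.
move=> x.
have -> : (fun x => g1 x * f2 x + f1 x * g2 x) =
    (fun x => (f1 0 * g2 x + f2 0 * g1 x) + (g1 x * P g2 x + P g1 x * g2 x)).
  by apply/funext => t; rewrite (E1 t) (E2 t); ring.
have j1 := cint_Mbm c1 (bm_P c2); have j2 := cint_bmM (bm_P c1) c2.
rewrite PD; [|by apply: cintD; exact: cintZ|exact: cintD].
rewrite PD; [|exact: cintZ..].
by rewrite !PZ// -P_mul// E1 E2; ring.
Qed.

Lemma prim_eq f g g' : prim f g -> g =1 g' -> prim f g'.
Proof. by move=> + /funext <-. Qed.

End ComplexPrimitive.

(** * Gronwall's inequality *)

Section Gronwall.
Variable R : realType.
Implicit Types f g : R -> R.

(** The weight of Bielecki's norm [sup |f| / wexp C]. The rate [2 * C] makes [C * Pr] a contraction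
    of factor 1/2 in this norm, as [Pr_wexp] shows; Gronwall's inequality and the Picard iteration
    both rest on it. *)
Definition wexp (C x : R) : R := expR (2 * C * clamp x).

Lemma wexp_ge1 C x : 0 < C -> 1 <= wexp C x.
Proof.
move=> C0; rewrite -expR0 ler_expR; have /andP[? _] := clamp_itv x.
by rewrite !mulr_ge0// ltW.
Qed.
Lemma wexp_le C x : 0 < C -> wexp C x <= expR (4 * C * pi).
Proof.
move=> C0; rewrite ler_expR; have /andP[_ c2] := clamp_itv x.
rewrite (_ : 4 * C * pi = 2 * C * (2 * pi)); last by ring.
by rewrite ler_pM2l// mulr_gt0.
Qed.

Lemma clamp_continuous : continuous (@clamp R).
Proof.
move=> x.
have c1 : {for x, continuous (fun y : R => Num.min y (2 * pi))}.
  apply: (@continuous_min R R id (cst (2 * pi)) x); [exact: cvg_id|exact: cvg_cst].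
by apply: (@continuous_max R R (cst 0) _ x); [exact: cvg_cst|exact: c1].
Qed.

Lemma rbm_wexp C : 0 < C -> rbm (wexp C).
Proof.
move=> C0; split.
  apply: rmeas_continuous => x; apply: continuous_comp; last exact: continuous_expR.
  by apply: continuousM; [exact: cst_continuous|exact: clamp_continuous].
exists (expR (4 * C * pi)) => x.
by rewrite ger0_norm ?wexp_le// (le_trans ler01)// wexp_ge1.
Qed.

Lemma Pr_wexp C x : 0 < C -> C * Pr (wexp C) x <= wexp C x / 2.
Proof.
move=> C0; have c2 : 0 < 2 * C by rewrite mulr_gt0.
have iw : rint (wexp C) by apply: rbm_rint; exact: rbm_wexp.
pose f t : R := expR (2 * C * t).
have cf : continuous f.
  move=> t; apply: continuous_comp; last exact: continuous_expR.
  by apply: continuousM; [exact: cst_continuous|exact: id].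
have hf := rint_continuous cf.
have -> : Pr (wexp C) x = Pr f (clamp x).
  rewrite -(Pr_clamp x iw); apply: J_ae.
  - by apply: rint_meas; exact: rint_ind.
  - by apply: rint_meas; exact: rint_ind.
  - apply/ae_eqP; apply: ae_torus => t /andP[t0 /ltW t2].
    by rewrite /wexp (@clamp_id _ t) ?t0.
have dF t : is_derive (t : R) (1 : R) (fun t => (2 * C)^-1 * f t) (f t).
  apply: is_derive_eq (isdZ (2 * C)^-1 (isd_expZ (2 * C) t)) _.
  by rewrite /f; field; rewrite gt_eqF.
rewrite (Pr_FTC dF) ?clamp_itv//.
rewrite /f mulr0 expR0 mulr1 -[expR _]/(wexp C x).
rewrite (_ : C * _ = wexp C x / 2 - 1 / 2); last by field; rewrite gt_eqF.
by rewrite gerBl.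
Qed.

Lemma Pr_scale c f x : rint f -> Pr (fun t => c * f t) x = c * Pr f x.
Proof.
move=> hf; rewrite /Pr -JZ; last exact: rint_ind.
by congr J; apply/funext => t; rewrite mulrCA.
Qed.

(** Boundedness of [D] makes its weighted supremum [m] finite, and the hypothesis gives
    [m <= d + m / 2], whence the factor 2. The exponential bounds the weight. *)
Lemma gronwall (D : R -> R) (d C : R) : 0 < C -> 0 <= d -> rbm D ->
  (forall x, 0 <= D x) -> (forall x, D x <= d + C * Pr D x) ->
  forall x, D x <= 2 * d * expR (4 * C * pi).
Proof.
move=> C0 d0 bD D0 HD x.
have wge x := wexp_ge1 x C0.
have [mD [K hK]] := bD.
pose S := [set m | exists x, m = D x / wexp C x].
have wgt y : 0 < wexp C y by rewrite (lt_le_trans ltr01).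
have ubS : has_ubound S.
  exists K => _ [y ->]; rewrite ler_pdivrMr//.
  have K0 : 0 <= K by rewrite (le_trans _ (hK 0)).
  by rewrite (le_trans (ler_norm _))// (le_trans (hK y))// ler_peMr.
pose m := sup S.
have Dm y : D y <= m * wexp C y.
  by rewrite -ler_pdivrMr//; apply: ub_le_sup => //; exists y.
have m0 : 0 <= m.
  by rewrite -(pmulr_lge0 _ (wgt 0)) (le_trans (D0 0)).
have step y : D y <= (d + m / 2) * wexp C y.
  rewrite (le_trans (HD y))// mulrDl lerD//; first by rewrite ler_peMr.
  have h1 : Pr D y <= m * Pr (wexp C) y.
    rewrite -Pr_scale; last by apply: rbm_rint; exact: rbm_wexp.
    apply: le_Pr => //; first exact: rbm_rint.
    by apply: rintZ; apply: rbm_rint; exact: rbm_wexp.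
  rewrite (@le_trans _ _ (m * (C * Pr (wexp C) y)))//.
    by rewrite mulrCA ler_pM2l.
  by rewrite -mulrA ler_wpM2l// [leRHS]mulrC Pr_wexp.
have : m <= d + m / 2.
  apply: ge_sup; first by exists (D 0 / wexp C 0), 0.
  by move=> _ [y ->]; rewrite ler_pdivrMr.
move=> mm; have m2 : m <= 2 * d by lra.
rewrite (le_trans (Dm x))//; apply: ler_pM => //; first exact: ltW.
exact: wexp_le.
Qed.

End Gronwall.

(** * Geometric convergence and Picard iteration *)

Section GeometricLimits.
Variable R : realType.

Lemma expr2n_gt (x : R) : exists n, x < 2 ^+ n.
Proof.
exists (Num.truncn `|x|).+1; rewrite (le_lt_trans (ler_norm x))//.
rewrite (lt_le_trans (truncnS_gt _))// -natrX ler_nat.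
by apply: ltnW; exact: ltn_expl.
Qed.

Lemma le0_half (x K : R) : (forall n, x <= K / 2 ^+ n) -> x <= 0.
Proof.
move=> h; rewrite leNgt; apply/negP => x0.
have [n] := expr2n_gt (K / x); rewrite ltr_pdivrMr// => Kx.
by move: (h n); rewrite ler_pdivlMr ?exprn_gt0// mulrC leNgt Kx.
Qed.

Lemma half_cvg0 (K : R) : (fun n => K / 2 ^+ n) @ \oo --> (0 : R).
Proof.
have := @cvg_geometric R K 2^-1; rewrite ger0_norm// => /(_ _).
rewrite (_ : geometric K 2^-1 = fun n => K / 2 ^+ n).
  by apply; rewrite invf_lt1// ltr1n.
by apply/funext => n; rewrite /geometric /= exprVn.
Qed.

(** The remaining increments sum to at most [A / 2 ^ n], so [u n - A / 2 ^ n] increases and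
    [u n + A / 2 ^ n] decreases; the limit is the supremum of the former. *)
Lemma geometric_limit (u : nat -> R) (A : R) :
  (forall n, `|u n.+1 - u n| <= A / 2 ^+ n.+1) ->
  exists l, forall n, `|l - u n| <= A / 2 ^+ n.
Proof.
move=> hu.
have e2 n : 2 ^+ n.+1 = 2 * 2 ^+ n :> R by rewrite exprS.
have half n : A / 2 ^+ n.+1 = A / 2 ^+ n - A / 2 ^+ n.+1.
  by rewrite e2; field; rewrite expf_neq0.
pose w n := u n - A / 2 ^+ n; pose v n := u n + A / 2 ^+ n.
have A0 n : 0 <= A / 2 ^+ n.
  rewrite (_ : A / 2 ^+ n = 2 * (A / 2 ^+ n.+1)); last by rewrite e2; field; rewrite expf_neq0.
  by rewrite mulr_ge0// (le_trans _ (hu n)).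
have wS n : w n <= w n.+1.
  by rewrite /w; move: (hu n); rewrite ler_norml => /andP[+ _]; rewrite [X in - X <= _]half; lra.
have vS n : v n.+1 <= v n.
  by rewrite /v; move: (hu n); rewrite ler_norml => /andP[_]; rewrite [X in _ <= X]half; lra.
have wh : {homo w : m n / (m <= n)%N >-> m <= n} by apply: homo_leq => //; exact: le_trans.
have vh : {homo v : m n / (m <= n)%N >-> n <= m}.
  by apply: (homo_leq (r := fun a b => b <= a)) => // a b c /[swap]; exact: le_trans.
have wv m n : w m <= v n.
  rewrite (le_trans (wh m (maxn m n) (leq_maxl _ _)))//.
  rewrite (le_trans _ (vh n (maxn m n) (leq_maxr _ _)))//.
  by have := A0 (maxn m n); rewrite /w /v; lra.
pose S := range w.
have ubS : has_ubound S by exists (v 0%N) => _ [n _ <-].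
exists (sup S) => n; rewrite ler_norml; apply/andP; split.
  rewrite lerBrDr addrC; apply: ub_le_sup => //; by exists n.
rewrite lerBlDr addrC; apply: ge_sup; first by exists (w 0%N), 0%N.
by move=> _ [m _ <-]; exact: wv.
Qed.

Lemma geometric_limitC (u : nat -> R[i]) (A : R) :
  (forall n, N (u n.+1 - u n) <= A / 2 ^+ n.+1) ->
  exists l, forall n, N (l - u n) <= 2 * A / 2 ^+ n.
Proof.
move=> hu.
have [n|a ha] := @geometric_limit (fun n => Re (u n)) A.
  by rewrite -ReN -ReD (le_trans (Re_leN _)).
have [n|b hb] := @geometric_limit (fun n => Im (u n)) A.
  by rewrite -ImN -ImD (le_trans (Im_leN _)).
exists (a +i* b) => n; rewrite (le_trans (N_leRI _))// ReD ImD ReN ImN /=.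
by rewrite -mulrA mulr_natl mulr2n lerD.
Qed.

Lemma bm_limit (u : nat -> R -> R[i]) (l : R -> R[i]) (A : R) :
  (forall n, bm (u n)) -> (forall n x, N (l x - u n x) <= A / 2 ^+ n) -> bm l.
Proof.
move=> bu hl.
have cvg (p : R[i] -> R) x : (forall a b, p (a - b) = p a - p b) ->
    (forall a, `|p a| <= N a) -> p (u n x) @[n --> \oo] --> p (l x).
  move=> pB pN; apply/cvgrPdist_le => e e0.
  have /cvgrPdist_le /(_ e e0) := half_cvg0 A.
  apply: filterS => n; rewrite sub0r normrN => h.
  by rewrite -pB (le_trans (pN _))// (le_trans (hl n x))// (le_trans (ler_norm _)).
split; last first.
  have [m0 [K hK]] := bu 0%N; exists (A + K) => x.
  rewrite -(subrK (u 0%N x) (l x)) (le_trans (leND _ _))// lerD//.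
  by have := hl 0%N x; rewrite expr0 divr1.
split.
  apply: (@measurable_fun_cvg _ _ _ _ (fun n x => Re (u n x))) => [n|x _].
    by have [[? ?] _] := bu n.
  by apply: cvg => *; [rewrite ReD ReN|exact: Re_leN].
apply: (@measurable_fun_cvg _ _ _ _ (fun n x => Im (u n x))) => [n|x _].
  by have [[? ?] _] := bu n.
by apply: cvg => *; [rewrite ImD ImN|exact: Im_leN].
Qed.

End GeometricLimits.

Section Picard.
Variable R : realType.
Implicit Types a b j r : R -> R[i].

Fixpoint picard a b (c : R[i] * R[i]) n : (R -> R[i]) * (R -> R[i]) :=
  if n is n'.+1 then
    (fun x => c.1 + P (fun t => a t * (picard a b c n').2 t) x,
     fun x => c.2 + P (fun t => b t * (picard a b c n').1 t) x)
  else (fun=> c.1, fun=> c.2).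

Lemma bm_picard a b c n : bm a -> bm b -> bm (picard a b c n).1 /\ bm (picard a b c n).2.
Proof.
move=> ba bb; elim: n => [|n [ih1 ih2]] /=; first by split; exact: bm_cst.
by split; apply: bmD; rewrite ?[bm (fun=> _)]bm_cst//; try exact: bm_cst;
  apply: bm_P; apply: bm_cint; exact: bmM.
Qed.

(** A system with zero diagonal, [j' = a r] and [r' = b j]. The eigenvalue equation has this form,
    and so has its version along the characteristics; one theory serves both. *)
Definition sol a b j r := [/\ bm a, bm b, prim j (fun x => a x * r x) & prim r (fun x => b x * j x)].

Lemma le_N_P_bd (f : R -> R[i]) K x : bm f -> (forall t, N (f t) <= K) ->
  N (P f x) <= 2 * pi * K.
Proof.
move=> bf fK; apply: le_N_cintegral_bd.
  by apply: cint_ind; exact: bm_cint.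
move=> t _; rewrite NM NC -[leRHS]mul1r; apply: ler_pM; rewrite ?N_ge0 ?norm_ind//.
Qed.

Lemma le_N_P_wexp (f : R -> R[i]) C K x : 0 < C -> bm f -> (forall t, N (f t) <= C * (K * wexp C t)) ->
  N (P f x) <= K * wexp C x / 2.
Proof.
move=> C0 bf hf; have cf := bm_cint bf.
have K0 : 0 <= K.
  have := le_trans (N_ge0 _) (hf 0); rewrite pmulr_rge0// pmulr_lge0//.
  by rewrite (lt_le_trans ltr01)// wexp_ge1.
have iw : rint (wexp C) by apply: rbm_rint; exact: rbm_wexp.
rewrite (le_trans (le_N_P x cf))//.
apply: (@le_trans _ _ (Pr (fun t => C * (K * wexp C t)) x)).
  by apply: le_Pr => //; [exact: cint_N|do 2 apply: rintZ].
rewrite Pr_scale; last exact: rintZ.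
by rewrite Pr_scale// mulrCA -mulrA ler_wpM2l// Pr_wexp.
Qed.

(** Each integration gains a factor 1/2 against the weight, so the increments decay geometrically
    whatever the size of [C]. *)
Lemma picard_diff a b c C n x : 0 < C -> bm a -> bm b ->
  (forall x, N (a x) <= C) -> (forall x, N (b x) <= C) ->
  let u := picard a b c in
  N ((u n.+1).1 x - (u n).1 x) <= (N c.1 + N c.2) * wexp C x / 2 ^+ n.+1 /\
  N ((u n.+1).2 x - (u n).2 x) <= (N c.1 + N c.2) * wexp C x / 2 ^+ n.+1.
Proof.
move=> C0 ba bb ha hb u.
set K := N c.1 + N c.2.
have K1 : N c.1 <= K by rewrite lerDl N_ge0.
have K2 : N c.2 <= K by rewrite lerDr N_ge0.
have wge t := wexp_ge1 t C0.
have w0 t : 0 <= wexp C t by rewrite (le_trans ler01).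
have K0 : 0 <= K by rewrite (le_trans _ K1)// N_ge0.
elim: n x => [|n ih] x.
  have base k d : bm k -> (forall y, N (k y) <= C) -> N d <= K ->
      N (P (fun t => k t * d) x) <= K * wexp C x / 2.
    move=> bk hk hd; apply: (le_N_P_wexp _ C0).
      by apply: bmM => //; exact: bm_cst.
    move=> t; rewrite NM; apply: ler_pM; [exact: N_ge0|exact: N_ge0|exact: hk|].
    by apply: (le_trans hd); rewrite ler_peMr.
  have -> : (u 1%N).1 x - (u 0%N).1 x = P (fun t => a t * c.2) x by rewrite /= addrC addKr.
  have -> : (u 1%N).2 x - (u 0%N).2 x = P (fun t => b t * c.1) x by rewrite /= addrC addKr.
  by rewrite expr1; split; apply: base.
have bu m : bm (u m).1 /\ bm (u m).2 by exact: bm_picard.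
have [[b1 b2] [b3 b4]] := (bu n, bu n.+1).
have E1 : (u n.+2).1 x - (u n.+1).1 x = P (fun t => a t * ((u n.+1).2 t - (u n).2 t)) x.
  rewrite [(u n.+2).1]/= [(u n.+1).1]/= opprD addrACA subrr add0r -PB.
  - by congr (P _ x); apply/funext => t; rewrite mulrBr.
  - by apply: bm_cint; exact: bmM.
  - by apply: bm_cint; exact: bmM.
have E2 : (u n.+2).2 x - (u n.+1).2 x = P (fun t => b t * ((u n.+1).1 t - (u n).1 t)) x.
  rewrite [(u n.+2).2]/= [(u n.+1).2]/= opprD addrACA subrr add0r -PB.
  - by congr (P _ x); apply/funext => t; rewrite mulrBr.
  - by apply: bm_cint; exact: bmM.
  - by apply: bm_cint; exact: bmM.
have EE y : K * wexp C y / 2 ^+ n.+2 = K / 2 ^+ n.+1 * wexp C y / 2.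
  by rewrite (exprS 2 n.+1); field; rewrite expf_neq0.
have last k f : bm k -> (forall y, N (k y) <= C) -> bm f ->
    (forall y, N (f y) <= K * wexp C y / 2 ^+ n.+1) ->
    N (P (fun t => k t * f t) x) <= K / 2 ^+ n.+1 * wexp C x / 2.
  move=> bk hk bf hf; apply: (le_N_P_wexp _ C0); first exact: bmM.
  move=> t; rewrite NM mulrAC; apply: ler_pM; [exact: N_ge0|exact: N_ge0|exact: hk|exact: hf].
split; [rewrite E1 EE|rewrite E2 EE].
  by apply: last => //; [exact: bmB|move=> y; case: (ih y)].
by apply: last => //; [exact: bmB|move=> y; case: (ih y)].
Qed.

(** The error depends on the coefficients only through their bound [C]. It is therefore uniform when
    [z] ranges over a disc, as the Hurwitz argument requires. *)
Lemma picard_sol a b c C : 0 < C -> bm a -> bm b ->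
  (forall x, N (a x) <= C) -> (forall x, N (b x) <= C) ->
  let A := (N c.1 + N c.2) * expR (4 * C * pi) in
  exists2 y : (R -> R[i]) * (R -> R[i]), sol a b y.1 y.2 /\ (y.1 0, y.2 0) = c &
    forall n x, N (y.1 x - (picard a b c n).1 x) <= 2 * A / 2 ^+ n /\
                N (y.2 x - (picard a b c n).2 x) <= 2 * A / 2 ^+ n.
Proof.
move=> C0 ba bb ha hb A.
pose u := picard a b c.
have K0 : 0 <= N c.1 + N c.2 by rewrite addr_ge0 ?N_ge0.
have du n x : N ((u n.+1).1 x - (u n).1 x) <= A / 2 ^+ n.+1 /\
              N ((u n.+1).2 x - (u n).2 x) <= A / 2 ^+ n.+1.
  have [h1 h2] := picard_diff c n x C0 ba bb ha hb.
  have h3 : (N c.1 + N c.2) * wexp C x / 2 ^+ n.+1 <= A / 2 ^+ n.+1.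
    by rewrite ler_pM2r ?invr_gt0 ?exprn_gt0// ler_wpM2l// wexp_le.
  by split; [exact: le_trans h3|exact: le_trans h3].
have /choice[j hj] : forall x, exists l, forall n, N (l - (u n).1 x) <= 2 * A / 2 ^+ n.
  by move=> x; apply: geometric_limitC => n; case: (du n x).
have /choice[r hr] : forall x, exists l, forall n, N (l - (u n).2 x) <= 2 * A / 2 ^+ n.
  by move=> x; apply: geometric_limitC => n; case: (du n x).
have bu m : bm (u m).1 /\ bm (u m).2 by exact: bm_picard.
have bj : bm j by apply: (bm_limit (u := fun n => (u n).1)) => [n|n x]; [case: (bu n)|exact: hj].
have br : bm r by apply: (bm_limit (u := fun n => (u n).2)) => [n|n x]; [case: (bu n)|exact: hr].
have key (f g : R -> R[i]) (uf ug : nat -> R -> R[i]) k c0 : bm f -> bm g -> bm k ->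
    (forall x, N (k x) <= C) -> (forall n, bm (ug n)) ->
    (forall n x, N (f x - uf n x) <= 2 * A / 2 ^+ n) ->
    (forall n x, N (g x - ug n x) <= 2 * A / 2 ^+ n) ->
    (forall n x, uf n.+1 x = c0 + P (fun t => k t * ug n t) x) ->
    forall x, f x = c0 + P (fun t => k t * g t) x.
  move=> bf bg bk hk bug hf hg E x; apply/eqP; rewrite -subr_eq0 -N_eq0 eq_le N_ge0 andbT.
  apply: (@le0_half _ _ (2 * A + 2 * pi * (C * (2 * A)))) => n.
  rewrite (_ : _ - _ = (f x - uf n.+1 x) - P (fun t => k t * (g t - ug n t)) x); last first.
    rewrite E (_ : (fun t => k t * (g t - ug n t)) = fun t => k t * g t - k t * ug n t); last first.
      by apply/funext => t; rewrite mulrBr.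
    rewrite PB; [ring|by apply: bm_cint; exact: bmM..].
  rewrite (le_trans (leNB _ _))// mulrDl lerD//.
    rewrite (le_trans (hf n.+1 x))// ler_wpM2l ?mulr_ge0 ?expR_ge0//.
    by rewrite lef_pV2 ?posrE ?exprn_gt0// ler_weXn2l ?ler1n.
  rewrite -mulrA; apply: le_N_P_bd.
    by apply: bmM => //; exact: bmB.
  move=> t; rewrite NM -mulrA; apply: ler_pM; [exact: N_ge0|exact: N_ge0|exact: hk|exact: hg].
have Ej := @key j r (fun n => (u n).1) (fun n => (u n).2) a c.1 bj br ba ha
  (fun n => (bu n).2) (fun n x => hj x n) (fun n x => hr x n) (fun n x => erefl).
have Er := @key r j (fun n => (u n).2) (fun n => (u n).1) b c.2 br bj bb hb
  (fun n => (bu n).1) (fun n x => hr x n) (fun n x => hj x n) (fun n x => erefl).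
have ca : cint (fun x => a x * r x) by apply: bm_cint; exact: bmM.
have cb : cint (fun x => b x * j x) by apply: bm_cint; exact: bmM.
have j0 : j 0 = c.1 by rewrite Ej P_0// addr0.
have r0 : r 0 = c.2 by rewrite Er P_0// addr0.
exists (j, r); last by move=> n x; split; [exact: hj|exact: hr].
split; last by rewrite /= j0 r0 -surjective_pairing.
by split => //; split => // x; [rewrite /= j0; exact: Ej|rewrite /= r0; exact: Er].
Qed.

End Picard.

(** * Zeros of polynomials and of their uniform limits *)

Section PolynomialMinimum.
Variable R : realType.
Implicit Types p : {poly R[i]}.

Lemma expr_unbounded (q K : R) : 1 < q -> exists n, K < q ^+ n.
Proof.
move=> q1; have d0 : 0 < q - 1 by rewrite subr_gt0.
have bern n : 1 + n%:R * (q - 1) <= q ^+ n.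
  elim: n => [|n ih]; first by rewrite mul0r addr0 expr0.
  rewrite exprS (@le_trans _ _ (q * (1 + n%:R * (q - 1))))//; last first.
    by rewrite ler_pM2l// (lt_trans ltr01).
  rewrite -subr_ge0 (_ : _ - _ = n%:R * (q - 1) ^+ 2); last by rewrite -natr1; ring.
  by rewrite mulr_ge0// sqr_ge0.
exists (Num.truncn `|K / (q - 1)|).+1.
rewrite (lt_le_trans _ (bern _))// ltr_pwDl// -ler_pdivrMr//.
by rewrite (le_trans (ler_norm _))// ltW// truncnS_gt.
Qed.

(** The list consists of the roots of [X^(n+1) - 1], which splits over [R[i]]; evaluating the
    factorisation at [a / r] gives the product. *)
Lemma prod_unity_roots n : exists2 ws : seq R[i], (forall w, w \in ws -> N w = 1) &
  size ws = n.+1 /\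
  forall (a : R[i]) (r : R), r != 0 -> \prod_(w <- ws) (a - r%:C * w) = a ^+ n.+1 - (r ^+ n.+1)%:C.
Proof.
have monU : ('X^(n.+1) - 1%:P : {poly R[i]}) \is monic by exact: monicXnsubC.
have [ws E] := closed_field_poly_normal ('X^(n.+1) - 1%:P : {poly R[i]}).
rewrite (monicP monU) scale1r in E.
exists ws.
  move=> w ww; have : root ('X^(n.+1) - 1%:P) w by rewrite E root_prod_XsubC.
  rewrite /root !hornerE subr_eq0 => /eqP w1.
  have /eqP : N w ^+ n.+1 = 1 by rewrite -NX w1 N1.
  by rewrite pexpr_eq1 ?N_ge0// => /eqP.
split.
  have := congr1 (fun q : {poly R[i]} => size q) E.
  by rewrite size_prod_XsubC size_XnsubC// => -[].
move=> a r r0.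
have rc : r%:C != 0 :> R[i] by rewrite -N_eq0 NC normr_eq0.
have := congr1 (fun q : {poly R[i]} => q.[a / r%:C]) E.
rewrite horner_prod !hornerE => E2.
have sz : size ws = n.+1.
  have := congr1 (fun q : {poly R[i]} => size q) E.
  by rewrite size_prod_XsubC size_XnsubC// => -[].
have scale us : \prod_(w <- us) (a - r%:C * w) =
    r%:C ^+ size us * \prod_(w <- us) ('X - w%:P).[a / r%:C].
  elim: us => [|w us ih]; first by rewrite !big_nil mulr1.
  by rewrite !big_cons ih !hornerE /= exprS; field.
rewrite scale sz -E2 mulrBr mulr1 -exprMn mulrCA divff// mulr1.
by rewrite rmorphXn.
Qed.

Lemma prod_const_seq (S : comPzRingType) (I : Type) (s : seq I) (c : S) :
  \prod_(i <- s) c = c ^+ size s.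
Proof. by elim: s => [|i s ih]; rewrite ?big_nil ?expr0// big_cons ih exprS. Qed.

(* A substitute for the minimum modulus principle: multiply [N p] over the
   [n]-th roots of unity of the circle and let [n] tend to infinity. *)
Lemma poly_root_disc p (z0 : R[i]) (r m : R) : 0 < r -> 0 < m ->
  (forall z, N (z - z0) = r -> m <= N p.[z]) -> N p.[z0] < m ->
  exists2 z, N (z - z0) <= r & p.[z] = 0.
Proof.
move=> r0 m0 hm h0; apply: contrapT => nroot.
have nz z : N (z - z0) <= r -> p.[z] != 0.
  by move=> hz; apply/eqP => pz; apply: nroot; exists z.
have p0 : 0 < N p.[z0] by rewrite N_gt0 nz// subrr N0 ltW.
have [zs E] := closed_field_poly_normal p.
set l := lead_coef p in E.
have pE z : p.[z] = l * \prod_(a <- zs) (z - a).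
  by rewrite {1}E hornerZ horner_prod; congr (_ * _); apply: eq_bigr => a _; rewrite !hornerE.
have far a : a \in zs -> r < N (z0 - a).
  move=> az; rewrite ltNge; apply/negP => ar.
  have : p.[a] != 0 by apply: nz; rewrite N_distC.
  by rewrite pE (big_rem a)//= subrr mul0r mulr0 eqxx.
have Nprod (I : eqType) (s : seq I) (F : I -> R[i]) :
    N (\prod_(i <- s) F i) = \prod_(i <- s) N (F i).
  by elim: s => [|i s ih]; rewrite ?big_nil ?N1// !big_cons NM ih.
(* Every root [a] has [r < |z0 - a|], hence [|(a - z0)^(n+1) - r^(n+1)| <= 2 |a - z0|^(n+1)]. The
   product of [N p] over [n + 1] points of the circle is thus at most [2^(size zs) |p(z0)|^(n+1)],
   while it is at least [m^(n+1)]. As [m / |p(z0)| > 1], this fails for large [n]. *)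
have key n : (m / N p.[z0]) ^+ n.+1 <= 2 ^+ size zs.
  have [ws w1 [sz wE]] := prod_unity_roots n.
  rewrite expr_div_n ler_pdivrMr ?exprn_gt0//.
  have lower : m ^+ n.+1 <= \prod_(w <- ws) N p.[z0 + r%:C * w].
    rewrite -sz -(prod_const_seq ws).
    rewrite !big_seq; apply: ler_prod => w ww; rewrite (ltW m0) hm//.
    by rewrite addrC addKr NM NC (w1 _ ww) mulr1 gtr0_norm.
  apply: (le_trans lower).
  rewrite -Nprod.
  have -> : \prod_(w <- ws) p.[z0 + r%:C * w] =
      l ^+ n.+1 * \prod_(a <- zs) ((-1) ^+ n.+1 * ((a - z0) ^+ n.+1 - (r ^+ n.+1)%:C)).
    under eq_bigr do rewrite pE.
    rewrite big_split /= -sz (prod_const_seq ws).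
    rewrite exchange_big /=; congr (_ * _); apply: eq_bigr => a _.
    rewrite sz -wE ?gt_eqF// -sz.
    elim: ws {w1 sz wE lower} => [|w ws ih]; first by rewrite !big_nil mulr1.
    by rewrite !big_cons ih /= exprS; ring.
  rewrite NM Nprod NX pE NM Nprod exprMn mulrCA ler_wpM2l ?exprn_ge0 ?N_ge0//.
  elim: zs far {E pE} => [|a zs ih] far; first by rewrite !big_nil expr1n mulr1.
  rewrite !big_cons /= (exprS (2 : R)) exprMn.
  rewrite [leRHS](_ : _ = (2 * N (z0 - a) ^+ n.+1) *
    (2 ^+ size zs * (\prod_(j <- zs) N (z0 - j)) ^+ n.+1)); last by ring.
  apply: ler_pM; [exact: N_ge0| |  |].
  - by apply: prodr_ge0 => *; exact: N_ge0.
  - rewrite NM NX NN N1 expr1n mul1r (le_trans (leNB _ _))// NX NC N_distC.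
    rewrite mulr2n mulrDl !mul1r lerD2l ger0_norm ?exprn_ge0 ?ltW//.
    by rewrite ltr_pXn2r ?nnegrE ?N_ge0 ?(ltW r0)// far// mem_head.
  - by apply: ih => b bz; apply: far; rewrite in_cons bz orbT.
have q1 : 1 < m / N p.[z0] by rewrite ltr_pdivlMr// mul1r.
have [n hn] := expr_unbounded (2 ^+ size zs) q1.
have := key n; rewrite leNgt => /negP; apply; rewrite (lt_le_trans hn)//.
by rewrite ler_weXn2l// ltW.
Qed.

End PolynomialMinimum.

Section NullSequences.
Variable R : realType.
Implicit Types u v : nat -> R.

Definition to0 u := u @ \oo --> (0 : R).

Lemma to0P u : to0 u <->
  forall e, 0 < e -> exists n0, forall n, (n0 <= n)%N -> `|u n| <= e.
Proof.
split=> [h e e0|h].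
  have /cvgrPdist_le /(_ e e0) [n0 _ hn] := h.
  by exists n0 => n nn; have := hn n nn; rewrite /= sub0r normrN.
apply/cvgrPdist_le => e /h [n0 hn]; exists n0 => // n nn /=.
by rewrite sub0r normrN hn.
Qed.

Lemma to0_le u v : (forall n, `|u n| <= v n) -> to0 v -> to0 u.
Proof.
move=> uv /to0P hv; apply/to0P => e /hv [n0 hn]; exists n0 => n /hn.
by apply: le_trans; rewrite (le_trans (uv n))// ler_norm.
Qed.
Lemma to0D u v : to0 u -> to0 v -> to0 (fun n => u n + v n).
Proof. move=> hu hv; rewrite /to0 -[X in _ --> X](addr0 (0 : R)).
exact: (@cvgD _ _ _ _ _ u v). Qed.
Lemma to0Z c u : to0 u -> to0 (fun n => c * u n).
Proof. move=> hu; rewrite /to0 -[X in _ --> X](mulr0 c).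
by apply: cvgM => //; exact: cvg_cst. Qed.
(** Subsequences are indexed throughout by maps with [k <= f k], a condition that is stable under
    composition and preserves null limits. *)
Lemma to0_sub u (f : nat -> nat) : (forall k, (k <= f k)%N) -> to0 u -> to0 (fun k => u (f k)).
Proof.
move=> hf /to0P hu; apply/to0P => e /hu [n0 hn]; exists n0 => n nn.
by apply: hn; rewrite (leq_trans nn).
Qed.
Lemma to0_le_cst u c : to0 u -> (forall n, c <= u n) -> c <= 0.
Proof.
move=> /to0P hu hc; apply/ler_addgt0Pr => e /hu [n0 hn]; rewrite add0r.
by rewrite (le_trans (hc n0))// (le_trans (ler_norm _))// hn.
Qed.
Lemma to0_half K : to0 (fun n => K / 2 ^+ n).
Proof. exact: half_cvg0. Qed.
Lemma to0_invS : to0 (fun n => n.+1%:R^-1).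
Proof. exact: cvg_harmonic. Qed.

Lemma bolzano_weierstrassC (z : nat -> R[i]) K : (forall n, N (z n) <= K) ->
  exists2 f : nat -> nat, (forall k, (k <= f k)%N) &
    exists l, to0 (fun k => N (z (f k) - l)).
Proof.
move=> zK.
have incr (f : nat -> nat) : increasing_seq f -> forall k, (k <= f k)%N.
  move=> fi; elim=> // k ih; rewrite (leq_ltn_trans ih)//.
  by have := leW_mono fi k k.+1; rewrite !ltEnat /= ltnS leqnn.
have bnd (p : R[i] -> R) (w : nat -> R[i]) : (forall a, `|p a| <= N a) ->
    (forall n, N (w n) <= K) -> bounded_fun (fun n => p (w n)).
  move=> hp hw; exists K; split; first exact: num_real.
  move=> M KM n _; apply: (le_trans (hp _)); apply: (le_trans (hw n)); exact: ltW.
have [f /incr fk cf] := bolzano_weierstrass (bnd (@complex.Re R) z (@Re_leN R) zK).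
have [g /incr gk cg] := bolzano_weierstrass
  (bnd (@complex.Im R) (z \o f) (@Im_leN R) (fun n => zK (f n))).
exists (f \o g) => [k|]; first by rewrite (leq_trans (gk k))//= fk.
set a := lim _ in cf; set b := lim _ in cg; exists (a +i* b).
have ha : to0 (fun k => `|Re (z (f k)) - a|).
  apply/to0P => e e0; have /cvgrPdist_le /(_ e e0) [n0 _ hn] := cf.
  by exists n0 => n /hn /=; rewrite normr_id distrC.
have hb : to0 (fun k => `|Im (z (f (g k))) - b|).
  apply/to0P => e e0; have /cvgrPdist_le /(_ e e0) [n0 _ hn] := cg.
  by exists n0 => n /hn /=; rewrite normr_id distrC.
apply: to0_le (to0D (to0_sub gk ha) hb) => k /=.
by rewrite ger0_norm ?N_ge0// (le_trans (N_leRI _))// ReD ImD ReN ImN.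
Qed.

(** Late approximants satisfy the hypotheses of [poly_root_disc] and so have roots in the disc.
    These roots accumulate, and the Lipschitz bound makes an accumulation point a zero of [F].
    Analyticity enters only through the polynomials. *)
Lemma hurwitz (F : R[i] -> R[i]) (p : nat -> {poly R[i]}) z0 (r m A L : R) :
  0 < r ->
  (forall n z, N (z - z0) <= r -> N (F z - (p n).[z]) <= A / 2 ^+ n) ->
  (forall z w, N (z - z0) <= r -> N (w - z0) <= r -> N (F z - F w) <= L * N (z - w)) ->
  (forall z, N (z - z0) = r -> m <= N (F z)) -> N (F z0) < m ->
  exists2 z, N (z - z0) <= r & F z = 0.
Proof.
move=> r0 hp hL hm h0.
have z0r : N (z0 - z0) <= r by rewrite subrr N0 ltW.
(* A third of the gap: with an error [e] at the centre and another [e] on the circle, a gap of [e]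
   remains for the polynomial. *)
pose e := (m - N (F z0)) / 3.
have e0 : 0 < e by rewrite divr_gt0// subr_gt0.
have NF0 := N_ge0 (F z0).
have m3 : m = 3 * e + N (F z0) by rewrite /e; field.
have /to0P /(_ e e0) [n0 hn0] := to0_half A.
have roots n : exists z, N (z - z0) <= r /\ (p (n + n0)%N).[z] = 0.
  have le_e z : N (z - z0) <= r -> N (F z - (p (n + n0)%N).[z]) <= e.
    move=> hz; rewrite (le_trans (hp _ _ hz))// (le_trans (ler_norm _))// hn0//.
    by rewrite leq_addl.
  have [|z hz||z hz pz] := @poly_root_disc R (p (n + n0)%N) z0 r (m - e) r0.
  - by rewrite m3; lra.
  - have := hm z hz; have := le_e z; rewrite hz => /(_ (lexx _)) h1 h2.
    have := leNB (F z) (F z - (p (n + n0)%N).[z]).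
    by rewrite subKr => h3; have := leND (F z - (p (n + n0)%N).[z]) (p (n + n0)%N).[z];
      rewrite subrK; lra.
  - have h1 := le_e z0 z0r; have := leNB (F z0) (F z0 - (p (n + n0)%N).[z0]).
    by rewrite subKr m3; lra.
  - by exists z.
have [zs hzs] := choice roots.
have [n|f fk [l hl]] := @bolzano_weierstrassC zs (r + N z0).
  rewrite -(subrK z0 (zs n)) (le_trans (leND _ _))// lerD2r.
  by case: (hzs n).
have lr : N (l - z0) <= r.
  rewrite -subr_le0; apply: (to0_le_cst hl) => k.
  have [h1 _] := hzs (f k).
  have := leND (l - zs (f k)) (zs (f k) - z0); rewrite addrA subrK N_distC.
  by rewrite [N (l - zs (f k))]N_distC; rewrite N_distC; lra.
exists l => //; apply/eqP; rewrite -N_eq0 eq_le N_ge0 andbT.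
have := to0D (to0Z L hl) (to0_sub (fun k => leq_trans (fk k) (leq_addr n0 (f k))) (to0_half A)).
move/to0_le_cst; apply => k.
have [h1 h2] := hzs (f k).
have := hp (f k + n0)%N _ h1; rewrite h2 subr0 => h3.
have := leND (F l - F (zs (f k))) (F (zs (f k))); rewrite subrK => /le_trans; apply.
by rewrite lerD// (le_trans (hL _ _ lr h1))// N_distC.
Qed.

End NullSequences.

(** * Continuous dependence of solutions on coefficients and initial values *)

Section Dependence.
Variable R : realType.
Implicit Types a b j r : R -> R[i].

Lemma sol_bm a b j r : sol a b j r -> bm j /\ bm r.
Proof. by move=> [_ _ h1 h2]; split; [exact: prim_bm h1|exact: prim_bm h2]. Qed.

(** Gronwall applied to the sum of the two differences. The mismatch of the coefficients acts as a
    source on the primed solution, of size [D * K]; the initial mismatch counts [d] in each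
    component. *)
Lemma sol_sub a b a' b' j r j' r' C d D K :
  sol a b j r -> sol a' b' j' r' -> 0 < C -> 0 <= d -> 0 <= D -> 0 <= K ->
  (forall x, N (a x) <= C) -> (forall x, N (b x) <= C) ->
  (forall x, N (a x - a' x) <= D) -> (forall x, N (b x - b' x) <= D) ->
  (forall x, N (j' x) <= K) -> (forall x, N (r' x) <= K) ->
  N (j 0 - j' 0) <= d -> N (r 0 - r' 0) <= d ->
  forall x, N (j x - j' x) + N (r x - r' x) <=
    2 * (2 * d + 4 * pi * (D * K)) * expR (4 * C * pi).
Proof.
move=> h h' C0 d0 D0 K0 ha hb haD hbD hj hr dj dr.
have [bj br] := sol_bm h; have [bj' br'] := sol_bm h'.
have [ba bb [_ Ej] [_ Er]] := h; have [ba' bb' [_ Ej'] [_ Er']] := h'.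
have bdj := bmB bj bj'; have bdr := bmB br br'.
have key k k' (f f' g g' : R -> R[i]) : bm k -> bm k' -> bm g -> bm g' ->
    (forall x, f x = f 0 + P (fun t => k t * g t) x) ->
    (forall x, f' x = f' 0 + P (fun t => k' t * g' t) x) ->
    (forall x, N (k x) <= C) -> (forall x, N (k x - k' x) <= D) ->
    (forall x, N (g' x) <= K) -> N (f 0 - f' 0) <= d ->
    forall x, N (f x - f' x) <= d + 2 * pi * (D * K) + C * Pr (fun t => N (g t - g' t)) x.
  move=> bk bk' bg bg' Ef Ef' hk hkD hg' d00 x.
  have bgg := bmB bg bg'; have bkk := bmB bk bk'.
  have c1 : cint (fun t => k t * (g t - g' t)) by apply: bm_cint; exact: bmM.
  have c2 : cint (fun t => (k t - k' t) * g' t) by apply: bm_cint; exact: bmM.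
  have -> : f x - f' x = (f 0 - f' 0) + P (fun t => (k t - k' t) * g' t) x +
      P (fun t => k t * (g t - g' t)) x.
    rewrite -[RHS]addrA -PD// (Ef x) (Ef' x) opprD addrACA -PB; [|by apply: bm_cint; exact: bmM..].
    by congr (_ + P _ x); apply/funext => t; ring.
  rewrite (le_trans (leND _ _))// lerD//.
    rewrite (le_trans (leND _ _))// lerD//; apply: le_N_P_bd; first exact: bmM.
    by move=> t; rewrite NM ler_pM ?N_ge0.
  rewrite (le_trans (le_N_P x c1))// -Pr_scale; last by apply: cint_N; exact: bm_cint.
  apply: le_Pr; [exact: cint_N| |].
    by apply: rintZ; apply: cint_N; exact: bm_cint.
  by move=> t _; rewrite NM ler_wpM2r ?N_ge0.
have rj : rint (fun t => N (j t - j' t)) by apply: cint_N; exact: bm_cint.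
have rr : rint (fun t => N (r t - r' t)) by apply: cint_N; exact: bm_cint.
apply: (@gronwall R (fun x => N (j x - j' x) + N (r x - r' x))) => //.
- by rewrite addr_ge0 ?mulr_ge0 ?pi_ge0.
- by apply: rbmD; exact: bm_rbmN.
- by move=> x; rewrite addr_ge0 ?N_ge0.
move=> x.
have h1 := key a a' j j' r r' ba ba' br br' Ej Ej' ha haD hr dj x.
have h2 := key b b' r r' j j' bb bb' bj bj' Er Er' hb hbD hj dr x.
have -> : Pr (fun t => N (j t - j' t) + N (r t - r' t)) x =
   Pr (fun t => N (j t - j' t)) x + Pr (fun t => N (r t - r' t)) x.
  rewrite /Pr -JD; [|exact: rint_ind..].
  by congr J; apply/funext => t; rewrite mulrDr.
apply: (le_trans (lerD h1 h2)); rewrite le_eqVlt; apply/orP; left.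
by apply/eqP; ring.
Qed.

Lemma sol0 a b : bm a -> bm b -> sol a b (fun=> 0) (fun=> 0).
Proof.
move=> ba bb; split => //; apply: prim_eq (prim_cst 0) _ => x; by rewrite mulr0.
Qed.

(** Comparison with the zero solution of the same system. *)
Lemma sol_bound a b j r C : sol a b j r -> 0 < C ->
  (forall x, N (a x) <= C) -> (forall x, N (b x) <= C) ->
  forall x, N (j x) + N (r x) <= 4 * (N (j 0) + N (r 0)) * expR (4 * C * pi).
Proof.
move=> h C0 ha hb x; have [ba bb _ _] := h.
have d0 : 0 <= N (j 0) + N (r 0) by rewrite addr_ge0 ?N_ge0.
have := @sol_sub a b a b j r (fun=> 0) (fun=> 0) C (N (j 0) + N (r 0)) 0 0 h (sol0 ba bb)
  C0 d0 (lexx _) (lexx _) ha hb.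
rewrite mulr0 mulr0 addr0 => /(_ _ _ _ _ _ _ x); rewrite !subr0 mulrA -natrM; apply.
- by move=> y; rewrite subrr N0.
- by move=> y; rewrite subrr N0.
- by move=> y; rewrite N0.
- by move=> y; rewrite N0.
- by rewrite lerDl N_ge0.
- by rewrite lerDr N_ge0.
Qed.

Lemma sol_lin a b j r j' r' c d : sol a b j r -> sol a b j' r' ->
  sol a b (fun x => c * j x + d * j' x) (fun x => c * r x + d * r' x).
Proof.
move=> [ba bb h1 h2] [_ _ h3 h4]; split => //.
  by apply: prim_eq (primD (primZ c h1) (primZ d h3)) _ => x; ring.
by apply: prim_eq (primD (primZ c h2) (primZ d h4)) _ => x; ring.
Qed.

Lemma sol_eq0 a b j r : sol a b j r -> j 0 = 0 -> r 0 = 0 ->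
  forall x, j x = 0 /\ r x = 0.
Proof.
move=> h j0 r0 x; have [[_ [K1 h1]] [_ [K2 h2]] _ _] := h.
pose C := `|K1| + `|K2| + 1.
have C0 : 0 < C by rewrite ltr_wpDl ?addr_ge0.
have hC1 y : N (a y) <= C.
  by rewrite (le_trans (h1 y))// (le_trans (ler_norm _))// /C -addrA lerDl addr_ge0.
have hC2 y : N (b y) <= C.
  by rewrite (le_trans (h2 y))// (le_trans (ler_norm _))// /C -addrA addrC -addrA lerDl addr_ge0.
have := sol_bound h C0 hC1 hC2 x.
rewrite j0 r0 N0 addr0 mulr0 mul0r => hle.
have := N_ge0 (j x); have := N_ge0 (r x) => n1 n2.
by split; apply/eqP; rewrite -N_eq0 eq_le N_ge0 andbT; lra.
Qed.

Lemma prim0 (f : R -> R[i]) : prim f (fun=> 0) -> forall x, f x = f 0.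
Proof.
move=> [_ E] x; have [_ /(_ x) E0] := prim_cst (0 : R[i]).
by rewrite E; move: E0; rewrite add0r => <-; rewrite addr0.
Qed.

(** The coefficient matrix has zero trace, so the wronskian is constant. *)
Lemma sol_wronskian a b j r j' r' : sol a b j r -> sol a b j' r' ->
  forall x, j x * r' x - j' x * r x = j 0 * r' 0 - j' 0 * r 0.
Proof.
move=> [ba bb h1 h2] [_ _ h3 h4] x.
apply: (@prim0 (fun x => j x * r' x - j' x * r x)).
by apply: prim_eq (primB (primM h1 h4) (primM h3 h2)) _ => t /=; ring.
Qed.

End Dependence.

(** * Picard iterates as polynomials in the spectral parameter *)

Section PicardPolynomial.
Variable R : realType.
Implicit Types s : R -> R.

(** The eigenvalue equation reads [j' = - z rho] and [rho' = - (z + sigma) j]. *)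
Definition ca (z : R[i]) : R -> R[i] := fun=> - z.
Definition cb (z : R[i]) s : R -> R[i] := fun x => - (z + (s x)%:C).
(* [(z - A_s) (r, j) = 0] in integral form, without boundary condition; [r]
   stands for rho. *)
Definition Sol z s := sol (ca z) (cb z s).

Lemma bm_ca z : bm (ca z). Proof. exact: bm_cst. Qed.
Lemma bm_cb z s : rbm s -> bm (cb z s).
Proof. by move=> hs; apply: bmN; apply: bmD; [exact: bm_cst|exact: bmC]. Qed.

Definition Ppoly n (p : R -> {poly R[i]}) x : {poly R[i]} :=
  \poly_(k < n) P (fun t => (p t)`_k) x.

Lemma bm_ext (f g : R -> R[i]) : f =1 g -> bm g -> bm f.
Proof. by move=> /funext ->. Qed.

Lemma Ppoly_horner n (p : R -> {poly R[i]}) x z : (forall t, (size (p t) <= n)%N) ->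
  (forall k, bm (fun t => (p t)`_k)) ->
  (Ppoly n p x).[z] = P (fun t => (p t).[z]) x.
Proof.
move=> sp bp; rewrite horner_poly.
have -> : (fun t => (p t).[z]) = fun t => \sum_(i < n) z ^+ i * (p t)`_i.
  by apply/funext => t; rewrite (horner_coef_wide z (sp t)); apply: eq_bigr => i _; rewrite mulrC.
rewrite /P.
have -> : (fun t => (ind x t)%:C * (\sum_(i < n) z ^+ i * (p t)`_i)) =
    fun t => \sum_(i <- index_enum 'I_n) (fun (i : 'I_n) t => z ^+ i * ((ind x t)%:C * (p t)`_i)) i t.
  by apply/funext => t; rewrite mulr_sumr; apply: eq_bigr => i _; rewrite mulrCA.
have ck (i : 'I_n) : cint (fun t => (ind x t)%:C * (p t)`_i).
  by apply: cint_ind; exact: bm_cint.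
have [_ ->] := @cintegral_sum R 'I_n (index_enum 'I_n)
  (fun i t => z ^+ i * ((ind x t)%:C * (p t)`_i)) (fun i => cintZ _ (ck i)).
by apply: eq_bigr => i _; rewrite cintegralZ// mulrC.
Qed.

Lemma bm_Ppoly n (p : R -> {poly R[i]}) k : (forall k, bm (fun t => (p t)`_k)) -> bm (fun x => (Ppoly n p x)`_k).
Proof.
move=> bp; apply: (bm_ext (fun x => coef_poly n (fun k => P (fun t => (p t)`_k) x) k)).
case: (k < n)%N; last exact: bm_cst.
by apply: bm_P; exact: bm_cint.
Qed.

Lemma bm_coefXM (p : R -> {poly R[i]}) k : (forall k, bm (fun t => (p t)`_k)) ->
  bm (fun t => ('X * p t)`_k).
Proof.
move=> bp; apply: (bm_ext (fun t => coefXM (p t) k)).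
by case: (k == 0)%N => //; exact: bm_cst.
Qed.

(** [ca] and [cb] are affine in [z], so each iteration raises the degree in [z] by at most one. The
    coefficients are carried along as bounded measurable functions of [x], because the next
    iteration integrates them. *)
Lemma picard_poly s c n : rbm s -> exists p q : R -> {poly R[i]},
  [/\ forall t, (size (p t) <= n.+1)%N, forall t, (size (q t) <= n.+1)%N,
      forall k, bm (fun t => (p t)`_k), forall k, bm (fun t => (q t)`_k) &
      forall z x, (picard (ca z) (cb z s) c n).1 x = (p x).[z] /\
                  (picard (ca z) (cb z s) c n).2 x = (q x).[z]].
Proof.
move=> hs; have bs : bm (fun x => (s x)%:C) by exact: bmC.
elim: n => [|n [p [q [sp sq bp bq E]]]].
  exists (fun=> c.1%:P), (fun=> c.2%:P); split => *; rewrite ?size_polyC ?leq_b1//.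
  - exact: bm_cst.
  - exact: bm_cst.
  - by rewrite !hornerC.
have bsp k : bm (fun t => ((s t)%:C *: p t)`_k).
  by apply: (bm_ext (fun t => coefZ _ (p t) k)); exact: bmM.
have ssp t : (size ((s t)%:C *: p t)%R <= n.+1)%N by rewrite (leq_trans (size_scale_leq _ _)).
have bC (d : R[i]) k : bm (fun _ : R => (d%:P : {poly R[i]})`_k) by exact: bm_cst.
exists (fun x => c.1%:P - 'X * Ppoly n.+1 q x).
exists (fun x => c.2%:P - 'X * Ppoly n.+1 p x - Ppoly n.+1 (fun t => (s t)%:C *: p t) x).
have szX (u : R -> {poly R[i]}) x : (size ('X * Ppoly n.+1 u x)%R <= n.+2)%N.
  rewrite mulrC (leq_trans (size_polyMleq _ _))// size_polyX addnC /= ltnS size_poly//.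
split.
- move=> t; rewrite (leq_trans (size_polyD _ _))// geq_max size_polyN szX.
  by rewrite (leq_trans (size_polyC_leq1 _)).
- move=> t; rewrite (leq_trans (size_polyD _ _))// geq_max size_polyN.
  rewrite (leq_trans (size_poly _ _))// andbT.
  rewrite (leq_trans (size_polyD _ _))// geq_max size_polyN szX.
  by rewrite (leq_trans (size_polyC_leq1 _)).
- move=> k; apply: (bm_ext (fun t => coefB _ _ k)); apply: bmB; first exact: bC.
  by apply: bm_coefXM => k'; exact: bm_Ppoly.
- move=> k; apply: (bm_ext (fun t => coefB _ _ k)); apply: bmB; last exact: bm_Ppoly.
  apply: (bm_ext (fun t => coefB _ _ k)).
  by apply: bmB; [exact: bC|apply: bm_coefXM => k'; exact: bm_Ppoly].
move=> z x; split.
  rewrite /= !hornerE Ppoly_horner//.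
  rewrite (_ : (fun t => _) = (fun t => (- z) * (q t).[z])); last first.
    by apply/funext => t; have [_ ->] := E z t.
  have cq : cint (fun t => (q t).[z]).
    rewrite (_ : (fun t => _) = fun t => (picard (ca z) (cb z s) c n).2 t).
      by apply: bm_cint; case: (@bm_picard R _ _ c n (bm_ca z) (bm_cb z hs)).
    by apply/funext => t; have [_ ->] := E z t.
  by rewrite PZ// mulNr.
have bcp : bm (fun t => (p t).[z]).
  rewrite (_ : (fun t => _) = fun t => (picard (ca z) (cb z s) c n).1 t).
    by case: (@bm_picard R _ _ c n (bm_ca z) (bm_cb z hs)).
  by apply/funext => t; have [-> _] := E z t.
rewrite /= !hornerE !Ppoly_horner//.
rewrite (_ : (fun t => _) = (fun t => (- z) * (p t).[z] - (s t)%:C * (p t).[z])); last first.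
  by apply/funext => t; have [-> _] := E z t; rewrite /cb; ring.
rewrite PB; [|by apply: cintZ; exact: bm_cint|by apply: bm_cint; exact: bmM].
rewrite PZ; last exact: bm_cint.
under [X in _ = _ - P X _]eq_fun do rewrite hornerZ.
by ring.
Qed.

End PicardPolynomial.

(** * Dominated convergence and the Riemann-Lebesgue lemma *)

Section DominatedConvergence.
Variable R : realType.
Local Notation mu := (torus R).

Lemma J_dct (f : nat -> R -> R) (l g : R -> R) : (forall n, rmeas (f n)) -> rmeas l ->
  rint g -> (forall n x, `|f n x| <= g x) ->
  (forall x, 0 < x < 2 * pi -> to0 (fun n => f n x - l x)) ->
  to0 (fun n => J (fun x => `|f n x - l x|)).
Proof.
move=> mf ml ig fg fl.
have [|||||_ + _] := @dominated_convergence _ _ _ mu setT measurableT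
  (fun n => EFin \o f n) (EFin \o l) (EFin \o g).
- by move=> n; apply/measurable_EFinP; exact: mf.
- exact/measurable_EFinP.
- apply: (aeS _ (ae_torus_oo fl)) => x hx _; apply: cvg_EFin; first exact: nearW.
  apply/cvgrPdist_le => e e0; have /to0P /(_ e e0) [n0 hn] := hx.
  by exists n0 => // n /= /hn; rewrite distrC.
- exact: ig.
- by apply: (aeS _ (ae_torus (fun x _ => I))) => x _ n _ /=; rewrite lee_fin.
move=> h; apply/to0P => e e0.
have /fine_cvgP [_ /cvgrPdist_le /(_ e e0) [n0 _ hn]] := h.
by exists n0 => n /hn /=; rewrite sub0r normrN.
Qed.

End DominatedConvergence.

Section RiemannLebesgue.
Variable R : realType.
Implicit Types f g h : R -> R.

Definition cis (x : R) : R[i] := cos x +i* sin x.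

Lemma N_cis x : N (cis x) = 1.
Proof.
by rewrite /cis /= cos2Dsin2 sqrtr1.
Qed.

Lemma continuous_cosM (w : R) : continuous (fun x : R => cos (w * x)).
Proof.
move=> x; apply: continuous_comp; last exact: continuous_cos.
by apply: continuousM; [exact: cvg_cst|exact: cvg_id].
Qed.
Lemma continuous_sinM (w : R) : continuous (fun x : R => sin (w * x)).
Proof.
move=> x; apply: continuous_comp; last exact: continuous_sin.
by apply: continuousM; [exact: cvg_cst|exact: cvg_id].
Qed.

Lemma bm_cisM (w : R) : bm (fun x => cis (w * x)).
Proof.
split; last by exists 1 => x; rewrite N_cis.
by split; apply: rmeas_continuous; [exact: continuous_cosM|exact: continuous_sinM].
Qed.

(** The conclusion of the Riemann-Lebesgue lemma as a property of [g]. It is linear and closed in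
    [L^1], so it passes from intervals to step functions, to continuous functions and to all
    integrable ones. *)
Definition vanishing g := forall e : R, 0 < e -> exists W : R, forall w, W <= `|w| ->
  N (cintegral (fun t => (g t)%:C * cis (w * t))) <= e.

Lemma cint_RL g w : rint g -> cint (fun t => (g t)%:C * cis (w * t)).
Proof.
move=> ig; apply: cint_Mbm; last exact: bm_cisM.
by split => //; apply: rint_cst.
Qed.

Lemma vanishingD f g : rint f -> rint g -> vanishing f -> vanishing g ->
  vanishing (fun t => f t + g t).
Proof.
move=> hf hg Vf Vg e e0.
have e2 : 0 < e / 2 by rewrite divr_gt0.
have [W1 H1] := Vf _ e2; have [W2 H2] := Vg _ e2.
exists (Num.max W1 W2) => w; rewrite ge_max => /andP[h1 h2].
have -> : (fun t => (f t + g t)%:C * cis (w * t)) =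
    fun t => (f t)%:C * cis (w * t) + (g t)%:C * cis (w * t).
  by apply/funext => t; rewrite rmorphD mulrDl.
rewrite cintegralD; [|exact: cint_RL..].
apply: (le_trans (leND _ _)); rewrite [e]splitr.
by apply: lerD; [exact: H1|exact: H2].
Qed.

Lemma vanishingZ c g : rint g -> vanishing g -> vanishing (fun t => c * g t).
Proof.
move=> hg Vg e e0.
have c0 : 0 < `|c| + 1 by rewrite ltr_wpDl.
have [W H] := Vg (e / (`|c| + 1)) (divr_gt0 e0 c0).
exists W => w /H hw.
have -> : (fun t => (c * g t)%:C * cis (w * t)) =
    fun t => c%:C * ((g t)%:C * cis (w * t)).
  by apply/funext => t; rewrite rmorphM mulrA.
rewrite cintegralZ; last exact: cint_RL.
rewrite NM NC; apply: (@le_trans _ _ (`|c| * (e / (`|c| + 1)))); first exact: ler_wpM2l.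
by rewrite mulrA ler_pdivrMr// mulrC ler_pM2l// lerDl.
Qed.

Lemma vanishing_closed g : rint g ->
  (forall e, 0 < e -> exists h, [/\ rint h, vanishing h & J (fun t => `|g t - h t|) <= e]) ->
  vanishing g.
Proof.
move=> ig H e e0; have e2 : 0 < e / 2 by rewrite divr_gt0.
have [h [ih Vh hgh]] := H _ e2; have [W hW] := Vh _ e2.
exists W => w /hW hw.
have -> : (fun t => (g t)%:C * cis (w * t)) =
    fun t => (g t - h t)%:C * cis (w * t) + (h t)%:C * cis (w * t).
  by apply/funext => t; rewrite rmorphB; ring.
have igh := rintB ig ih.
rewrite cintegralD; [|exact: cint_RL..].
apply: (le_trans (leND _ _)); rewrite [e]splitr; apply: lerD; last exact: hw.
apply: (le_trans (le_N_cintegral (cint_RL w igh))); apply: le_trans hgh; rewrite le_eqVlt.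
apply/orP; left; apply/eqP; congr J; apply/funext => t.
by rewrite NM NC N_cis mulr1.
Qed.

Lemma Pr_cosM (w x : R) : w != 0 -> 0 <= x <= 2 * pi -> Pr (fun t => cos (w * t)) x = sin (w * x) / w.
Proof.
move=> w0 hx.
have dF t : is_derive (t : R) (1 : R) (fun t => w^-1 * sin (w * t)) (cos (w * t)).
  apply: is_derive_eq (isdZ w^-1 (isd_comp (is_derive_sin _) (isdZ w (isd_id t)))) _.
  by rewrite mulr1 mulrCA mulVf ?mulr1.
have cc := @continuous_cosM w.
by rewrite (Pr_FTC dF)//; [rewrite mulr0 sin0 mulr0 subr0 mulrC|exact: rint_continuous].
Qed.
Lemma Pr_sinM (w x : R) : w != 0 -> 0 <= x <= 2 * pi ->
  Pr (fun t => sin (w * t)) x = (1 - cos (w * x)) / w.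
Proof.
move=> w0 hx.
have dF t : is_derive (t : R) (1 : R) (fun t => (- w^-1) * cos (w * t)) (sin (w * t)).
  apply: is_derive_eq (isdZ (- w^-1) (isd_comp (is_derive_cos _) (isdZ w (isd_id t)))) _.
  by rewrite mulr1; field.
have cc := @continuous_sinM w.
by rewrite (Pr_FTC dF)//; [rewrite mulr0 cos0; field|exact: rint_continuous].
Qed.

Lemma vanishing_ind x : 0 <= x <= 2 * pi -> vanishing (ind x).
Proof.
(* The primitives of [cos] and [sin] contribute at most 1 and 2 over [|w|], whence the 3; the 1
   keeps [w] away from 0. *)
move=> hx e e0; exists (Num.max 1 (3 / e)) => w; rewrite ge_max => /andP[w1 we].
have w0 : w != 0 by rewrite -normr_gt0 (lt_le_trans ltr01).
have wp : 0 < `|w| by rewrite normr_gt0.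
rewrite [cintegral _](_ : _ = P (fun t => cis (w * t)) x)//.
rewrite (le_trans (N_leRI _))// Re_P Im_P Pr_cosM// Pr_sinM// !normrM !normfV -mulrDl.
rewrite ler_pdivrMr//; have we' : 3 <= e * `|w| by rewrite mulrC -ler_pdivrMr.
have h1 := sin_le1 (w * x); have h2 := sin_geN1 (w * x).
have h3 := cos_le1 (w * x); have h4 := cos_geN1 (w * x).
have : `|sin (w * x)| <= 1 by rewrite ler_norml h1 h2.
have : `|1 - cos (w * x)| <= 2 by rewrite ler_norml; apply/andP; split; lra.
by lra.
Qed.

Lemma vanishing0 : vanishing (fun=> 0).
Proof.
move=> e e0; exists 0 => w _.
rewrite (_ : (fun t => _) = fun=> 0); last by apply/funext => t; rewrite mul0r.
by rewrite cintegral_cst mulr0 N0 ltW.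
Qed.

Definition gridpt (n i : nat) : R := 2 * pi * i%:R / n.+1%:R.

Lemma gridpt_itv n i : (i <= n.+1)%N -> 0 <= gridpt n i <= 2 * pi.
Proof.
move=> iN; have p0 : 0 <= 2 * pi :> R by rewrite ltW// twopi_gt0.
have n0 : 0 < n.+1%:R :> R by rewrite ltr0n.
apply/andP; split; rewrite /gridpt; first by rewrite divr_ge0 ?ler0n// mulr_ge0 ?ler0n.
by rewrite ler_pdivrMr// ler_wpM2l// ler_nat.
Qed.

Definition stepfun h n (t : R) :=
  \sum_(i < n.+1) h (gridpt n i) * (ind (gridpt n i.+1) t - ind (gridpt n i) t).

Lemma stepfun_vanishing h n : rint (stepfun h n) /\ vanishing (stepfun h n).
Proof.
rewrite /stepfun.
have key m : (m <= n.+1)%N ->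
    rint (fun t => \sum_(i < m) h (gridpt n i) * (ind (gridpt n i.+1) t - ind (gridpt n i) t)) /\
    vanishing (fun t => \sum_(i < m) h (gridpt n i) * (ind (gridpt n i.+1) t - ind (gridpt n i) t)).
  elim: m => [_|m ih mn].
    by under eq_fun do rewrite big_ord0; split; [exact: rint_cst|exact: vanishing0].
  have [i1 v1] := ih (ltnW mn).
  have i2 x : rint (ind x) by apply: rbm_rint; exact: rbm_ind.
  have i3 x y : rint (fun t => ind x t - ind y t) by exact: rintB.
  have v3 : vanishing (fun t => ind (gridpt n m.+1) t - ind (gridpt n m) t).
    rewrite (_ : (fun t => _) = fun t => ind (gridpt n m.+1) t + (-1) * ind (gridpt n m) t); last first.
      by apply/funext => t; rewrite mulN1r.
    apply: vanishingD => //; first exact: rintZ.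
      by apply: vanishing_ind; exact: gridpt_itv.
    by apply: vanishingZ => //; apply: vanishing_ind; apply: gridpt_itv; exact: ltnW.
  under eq_fun do rewrite big_ord_recr /=.
  split; first by apply: rintD => //; exact: rintZ.
  by apply: vanishingD => //; [exact: rintZ|exact: vanishingZ].
exact: key.
Qed.

Lemma stepfunE h n t : 0 < t < 2 * pi ->
  exists i, [/\ (i <= n)%N, stepfun h n t = h (gridpt n i) & `|t - gridpt n i| <= 2 * pi / n.+1%:R].
Proof.
move=> /andP[t0 t2].
have n0 : 0 < n.+1%:R :> R by rewrite ltr0n.
have ex : exists i, t <= gridpt n i.+1.
  by exists n; rewrite /gridpt mulfK ?gt_eqF// ltW.
have [k hk kmin] := ex_minnP ex.
have kn : (k <= n)%N by apply: kmin; rewrite /gridpt mulfK ?gt_eqF// ltW.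
have gk : gridpt n k < t.
  case: k hk kmin kn => [|k] hk kmin kn; first by rewrite /gridpt mulr0 mul0r.
  by rewrite ltNge; apply/negP => /kmin; rewrite ltnn.
have mono i i' : (i <= i')%N -> gridpt n i <= gridpt n i'.
  move=> ii; rewrite /gridpt ler_pM2r ?invr_gt0// ler_wpM2l ?ler_nat//.
  by rewrite ltW// twopi_gt0.
exists k; split => //.
  have kn1 : (k < n.+1)%N by [].
  rewrite /stepfun (bigD1 (Ordinal kn1))//= {1}/ind hk {1}/ind leNgt gk /= subr0 mulr1.
  rewrite big1 ?addr0// => i ik.
  have : (i < k)%N || (k < i)%N.
    by rewrite -neq_ltn; apply: contra ik => /eqP ik; apply/eqP/val_inj.
  move=> /orP[ik'|ik'].
    have h1 : gridpt n i.+1 < t by rewrite (le_lt_trans _ gk)// mono.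
    have h2 : gridpt n i < t by rewrite (le_lt_trans _ gk)// mono// ltnW.
    by rewrite /ind !leNgt h1 h2 /= subrr mulr0.
  have h1 : t <= gridpt n i.+1 by rewrite (le_trans hk)// mono// ltnW.
  have h2 : t <= gridpt n i by rewrite (le_trans hk)// mono.
  by rewrite /ind h1 h2 /= subrr mulr0.
rewrite ger0_norm ?subr_ge0 ?(ltW gk)//.
have -> : 2 * pi / n.+1%:R = gridpt n k.+1 - gridpt n k.
  rewrite /gridpt (_ : k.+1%:R = k%:R + 1 :> R); last by rewrite natr1.
  by set q := n.+1%:R in n0 *; field; rewrite gt_eqF.
by rewrite lerD2r.
Qed.

Lemma vanishing_continuous h : continuous h -> vanishing h.
Proof.
move=> ch; have ih := rint_continuous ch.
apply: vanishing_closed => // e e0.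
have [M [_ HM]] : bounded_set (h @` `[0, 2 * pi]).
  apply: compact_bounded; apply: continuous_compact; last exact: segment_compact.
  exact: continuous_subspaceT.
have hM x : 0 <= x <= 2 * pi -> `|h x| <= M + 1.
  by move=> hx; apply: HM; rewrite ?ltrDl//; exists x => //=; rewrite in_itv.
have M0 : 0 <= M + 1 by rewrite (le_trans _ (hM 0 _))// lexx ltW// twopi_gt0.
(* [J_dct] wants domination at every real point, while [h] is bounded only on the period; this
   factor cuts off the rest. *)
pose inn (t : R) : R := if (0 < t) && (t < 2 * pi) then 1 else 0.
have minn' : rmeas inn.
  apply: measurable_fun_ifT => //; apply: measurable_and => //.
  - by apply: measurable_fun_ltr => //; exact: rmeas_cst.
  - by apply: measurable_fun_ltr => //; exact: rmeas_cst.
have := @J_dct R (fun n t => inn t * stepfun h n t) (fun t => inn t * h t) (fun=> M + 1).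
have h1 n : rmeas (fun t => inn t * stepfun h n t).
  by apply: rmeasM => //; apply: rint_meas; case: (stepfun_vanishing h n).
have h2 : rmeas (fun t => inn t * h t).
  by apply: rmeasM => //; exact: rint_meas.
move=> /(_ h1 h2 (rint_cst _) _ _) /to0P -/(_ _ _ e e0) [||n0 hn0].
- move=> n x; rewrite /inn; case: ifPn => [hx|_]; last by rewrite mul0r normr0.
  have [i [i_n -> _]] := stepfunE h n hx; rewrite mul1r.
  by apply: hM; apply: gridpt_itv; rewrite leqW.
- move=> x hx; have inx : inn x = 1 by rewrite /inn hx.
  apply/to0P => d d0.
  have /cvgrPdist_le /(_ d d0) [r /= r0 hr] := ch x.
  have := iffLR (to0P (fun n => n.+1%:R^-1 : R)) (@to0_invS R) (r / (2 * (2 * pi))).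
  have p2 : 0 < 2 * (2 * pi) :> R by rewrite mulr_gt0// twopi_gt0.
  move=> /(_ (divr_gt0 r0 p2)) [m hm]; exists m => n /hm hn.
  rewrite inx !mul1r; have [i [_ -> hi]] := stepfunE h n hx.
  rewrite distrC; apply: hr => /=; apply: le_lt_trans hi _.
  have : 2 * pi * n.+1%:R^-1 <= r / 2.
    rewrite ger0_norm in hn; last by rewrite invr_ge0.
    have : 2 * pi * n.+1%:R^-1 <= 2 * pi * (r / (2 * (2 * pi))).
      by rewrite ler_pM2l// twopi_gt0.
    rewrite (_ : 2 * pi * (r / (2 * (2 * pi))) = r / 2)//.
    by move: (pi : R) (gt_eqF (pi_gt0 R)) => q /negbT q0; field.
  by move=> /le_lt_trans; apply; rewrite ltr_pdivrMr// ltr_pMr// ltr1n.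
exists (stepfun h n0); have [i1 v1] := stepfun_vanishing h n0; split => //.
have := hn0 n0 (leqnn _); rewrite ger0_norm; last by apply: J_ge0 => x.
apply: le_trans; rewrite le_eqVlt; apply/orP; left; apply/eqP; apply: J_ae.
- by apply: rmeas_norm; apply: rmeasB; exact: rint_meas.
- by apply: rmeas_norm; apply: rmeasB.
- apply/ae_eqP; apply: ae_torus_oo => x hx.
  by rewrite /inn hx !mul1r distrC.
Qed.

Lemma riemann_lebesgue g : rint g -> vanishing g.
Proof.
move=> ig; apply: vanishing_closed => // e e0.
pose D : set R := `[0, 2 * pi[%classic.
have mD : measurable (D : set (measurableTypeR R)) by exact: measurable_itv.
have Dfin : (@lebesgue_measure R D < +oo)%E.
  by rewrite lebesgue_measure_itv /= lte_fin twopi_gt0 -EFinD ltry.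
have [gs [cgs igs H]] := approximation_continuous_integrable mD Dfin (rint_lebesgue ig).
have /fine_cvgP [_ /cvgrPdist_le /(_ e e0) [n _ hn]] := H.
have ign := rint_continuous (cgs n).
exists (gs n); split => //; first exact: vanishing_continuous.
have := hn n (leqnn n); rewrite /= sub0r normrN.
rewrite J_lebesgue; last by apply: rint_norm; exact: rintB.
by apply: le_trans; rewrite ler_norm.
Qed.

End RiemannLebesgue.

(** * Exponentials of primitives *)

Section ExponentialPrimitive.
Variable R : realType.
Implicit Types f : R -> R.

Lemma PrD f g x : rint f -> rint g -> Pr (fun t => f t + g t) x = Pr f x + Pr g x.
Proof.
move=> hf hg; rewrite /Pr -JD; [|exact: rint_ind..].
by congr J; apply/funext => t; rewrite mulrDr.
Qed.

Lemma rbmX f n : rbm f -> rbm (fun x => f x ^+ n).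
Proof.
move=> bf; elim: n => [|n ih]; first by under eq_fun do rewrite expr0; exact: rbm_cst.
by under eq_fun do rewrite exprS; exact: rbmM.
Qed.

Lemma rint_Mrbm f g : rint f -> rbm g -> rint (fun x => f x * g x).
Proof. by move=> hf hg; under eq_fun do rewrite mulrC; exact: rint_rbmM. Qed.

Lemma Pr_exprS f n x : rint f ->
  Pr f x ^+ n.+1 = Pr (fun t => n.+1%:R * (f t * Pr f t ^+ n)) x.
Proof.
move=> hf; have bF := rbm_Pr hf.
elim: n x => [|n ih] x.
  by congr Pr; apply/funext => t; rewrite expr0 mulr1 mul1r.
have hn : rint (fun t => n.+1%:R * (f t * Pr f t ^+ n)).
  by apply: rintZ; apply: rint_Mrbm => //; exact: rbmX.
rewrite exprS ih Pr_mul//; congr Pr; apply/funext => t.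
by rewrite -ih -[in RHS]natr1 exprS; ring.
Qed.

Definition expS n (y : R) := \sum_(k < n) y ^+ k / k`!%:R.

Lemma expS_cvg y : to0 (fun n => expS n y - expR y).
Proof.
have h := @is_cvg_series_exp_coeff R y.
apply/to0P => e e0; have /cvgrPdist_le /(_ e e0) [n0 _ hn] := h.
exists n0 => n /hn; rewrite /= distrC; apply: le_trans.
by rewrite /expS -(big_mkord xpredT (fun k => y ^+ k / k`!%:R)).
Qed.

Lemma expS_le y n : `|expS n y| <= expR `|y|.
Proof.
have h1 : `|expS n y| <= expS n `|y|.
  rewrite (le_trans (ler_norm_sum _ _ _))//; apply: ler_sum => k _.
  by rewrite normrM normrX [X in _ * X]ger0_norm// invr_ge0 ler0n.
apply: (le_trans h1).
have mono m : expS m `|y| <= expS m.+1 `|y|.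
  by rewrite /expS big_ord_recr /= lerDl divr_ge0 ?exprn_ge0 ?ler0n.
have nd m : (n <= m)%N -> expS n `|y| <= expS m `|y|.
  move=> nm; rewrite -(subnK nm); elim: (m - n)%N => // k ih.
  by rewrite addSn (le_trans ih).
rewrite -subr_le0; have /to0P H := expS_cvg `|y|.
apply/ler_addgt0Pr => e /H [n0 hn]; rewrite add0r.
have := hn (maxn n n0) (leq_maxr _ _); rewrite ler_norml => /andP[_].
by apply: le_trans; rewrite lerD2r nd// leq_maxl.
Qed.

(** The chain rule for an [f] that is only integrable: it holds for the partial sums of the
    exponential series by repeated integration by parts, and passes to the limit by dominated
    convergence. *)
Lemma expR_Pr f x : rint f -> expR (Pr f x) = 1 + Pr (fun t => f t * expR (Pr f t)) x.
Proof.
move=> hf; have [mF [K hK]] := rbm_Pr hf.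
have bS n : rbm (fun t => expS n (Pr f t)).
  rewrite /expS; elim: n => [|n ih].
    by under eq_fun do rewrite big_ord0; exact: rbm_cst.
  under eq_fun do rewrite big_ord_recr /=.
  apply: rbmD => //; apply: rbmM; last exact: rbm_cst.
  by apply: rbmX; exact: rbm_Pr.
have mE : rmeas (fun t => expR (Pr f t)).
  by apply: (@measurableT_comp _ _ _ _ _ _ expR) => //; exact: measurable_expR.
have SE n : expS n.+1 (Pr f x) = 1 + Pr (fun t => f t * expS n (Pr f t)) x.
  elim: n => [|n ih].
    rewrite /expS big_ord_recr big_ord0 /= add0r expr0 divr1.
    rewrite (_ : (fun t => _) = fun=> 0); last by apply/funext => t; rewrite big_ord0 mulr0.
    by rewrite /Pr (_ : (fun t => _) = fun=> 0) ?J_cst ?mulr0 ?addr0//; apply/funext => t; rewrite mulr0.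
  rewrite /expS big_ord_recr -/(expS n.+1 (Pr f x)) ih /=.
  under [in RHS]eq_fun do rewrite big_ord_recr /= mulrDr.
  have hn : rint (fun t => f t * Pr f t ^+ n).
    by apply: rint_Mrbm => //; apply: rbmX; exact: rbm_Pr.
  rewrite PrD; [|exact: (rint_Mrbm hf (bS n))|]; last first.
    under eq_fun do rewrite mulrA mulrC; exact: rintZ.
  rewrite addrA; congr (_ + _).
  rewrite Pr_exprS// Pr_scale//.
  under [in RHS]eq_fun do rewrite mulrA mulrC.
  rewrite Pr_scale// factS natrM; field.
  by rewrite addrC natr1 !pnatr_eq0 /= andbT -lt0n fact_gt0.
have D := @J_dct R (fun n t => f t * expS n (Pr f t)) (fun t => f t * expR (Pr f t))
  (fun t => expR K * `|f t|).
have {}D : to0 (fun n => J (fun t => `|f t * expS n (Pr f t) - f t * expR (Pr f t)|)).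
  apply: D.
  - by move=> n; apply: rint_meas; exact: (rint_Mrbm hf (bS n)).
  - by apply: rmeasM => //; exact: rint_meas.
  - by apply: rintZ; exact: rint_norm.
  - move=> n t; rewrite normrM mulrC ler_wpM2r// (le_trans (expS_le _ _))//.
    by rewrite ler_expR.
  - move=> t _; apply: to0_le (to0Z `|f t| (_ : to0 (fun n => `|expS n (Pr f t) - expR (Pr f t)|))).
      by move=> n; rewrite -mulrBr normrM.
    by apply/to0P => e e0; have /to0P /(_ e e0) [n0 hn] := expS_cvg (Pr f t);
      exists n0 => n /hn; rewrite normr_id.
have ifE : rint (fun t => f t * expR (Pr f t)).
  apply: rint_Mrbm => //; split=> //; exists (expR K) => t.
  by rewrite ger0_norm ?expR_ge0// ler_expR (le_trans (ler_norm _)).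
apply/eqP; rewrite -subr_eq0 -normr_eq0 eq_le normr_ge0 andbT.
have D2 : to0 (fun n => `|expS n.+1 (Pr f x) - expR (Pr f x)|).
  apply/to0P => e e0; have /to0P /(_ e e0) [n0 hn] := expS_cvg (Pr f x).
  by exists n0 => n nn; rewrite normr_id hn// ltnW.
apply: (to0_le_cst (to0D D2 D)) => n.
have -> : expR (Pr f x) - (1 + Pr (fun t => f t * expR (Pr f t)) x) =
   - (expS n.+1 (Pr f x) - expR (Pr f x)) +
   Pr (fun t => f t * expS n (Pr f t) - f t * expR (Pr f t)) x.
  rewrite SE PrD; [|exact: (rint_Mrbm hf (bS n))|exact: rintN].
  rewrite [Pr (fun t => - _) x](_ : _ = - Pr (fun t => f t * expR (Pr f t)) x); last first.
    by rewrite -mulN1r -Pr_scale//; congr Pr; apply/funext => t; rewrite mulN1r.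
  ring.
have idf : rint (fun t => f t * expS n (Pr f t) - f t * expR (Pr f t)).
  by apply: rintB => //; exact: (rint_Mrbm hf (bS n)).
rewrite (le_trans (ler_normD _ _))// normrN lerD2l.
rewrite (le_trans (le_normr_Rintegral measurableT (rint_ind x idf)))//.
apply: le_J; [by apply: rint_norm; exact: rint_ind|exact: rint_norm|].
by move=> t _; rewrite normrM ler_piMl// norm_ind.
Qed.

Lemma prim_real f g : rint g -> (forall x, f x = f 0 + Pr g x) ->
  prim (fun x => (f x)%:C) (fun x => (g x)%:C).
Proof.
move=> ig E; split; first by split => //; exact: rint_cst.
move=> x; apply: ceqP; first by rewrite ReD Re_P /= E.
rewrite ImD Im_P /= add0r /Pr (_ : (fun t => _) = fun=> 0) ?J_cst ?mulr0//.
by apply/funext => t; rewrite mulr0.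
Qed.

Lemma prim_expR f : rint f ->
  prim (fun x => (expR (Pr f x))%:C) (fun x => (f x * expR (Pr f x))%:C).
Proof.
move=> hf; apply: prim_real.
  apply: rint_Mrbm => //; have [mF [K hK]] := rbm_Pr hf; split.
    by apply: (@measurableT_comp _ _ _ _ _ _ expR) => //; exact: measurable_expR.
  exists (expR K) => t.
  by rewrite ger0_norm ?expR_ge0// ler_expR (le_trans (ler_norm _)).
by move=> x; rewrite expR_Pr// [in RHS]Pr_0// expR0.
Qed.

Lemma prim_cis (w : R) :
  prim (fun x => cis (w * clamp x)) (fun x => 'i%C * w%:C * cis (w * clamp x)).
Proof.
have bcl : bm (fun x => cis (w * clamp x)).
  split; last by exists 1 => x; rewrite N_cis.
  split; apply: rmeas_continuous => x.
    by apply: (@continuous_comp _ _ _ (@clamp R) (fun y => cos (w * y)));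
      [exact: clamp_continuous|exact: continuous_cosM].
  by apply: (@continuous_comp _ _ _ (@clamp R) (fun y => sin (w * y)));
    [exact: clamp_continuous|exact: continuous_sinM].
have bg : bm (fun x => 'i%C * w%:C * cis (w * clamp x)) by exact: bmZ.
have c0 : clamp 0 = 0 :> R by rewrite clamp_id// lexx ltW// twopi_gt0.
split; first exact: bm_cint.
move=> x; have hx := clamp_itv x.
have dc t : is_derive (t : R) (1 : R) (fun t => cos (w * t)) (- w * sin (w * t)).
  apply: is_derive_eq (isd_comp (is_derive_cos _) (isdZ w (isd_id t))) _.
  by rewrite mulr1 mulrC mulrN mulNr.
have ds t : is_derive (t : R) (1 : R) (fun t => sin (w * t)) (w * cos (w * t)).
  apply: is_derive_eq (isd_comp (is_derive_sin _) (isdZ w (isd_id t))) _.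
  by rewrite mulr1 mulrC.
have cs : continuous (fun t : R => - w * sin (w * t)).
  by apply: (@isd_continuous _ _ (fun t => - w * (w * cos (w * t)))) => t; exact: isdZ.
have cc : continuous (fun t : R => w * cos (w * t)).
  by apply: (@isd_continuous _ _ (fun t => w * (- w * sin (w * t)))) => t; exact: isdZ.
have ae (u v : R -> R) : rmeas u -> rmeas v -> (forall t, 0 <= t <= 2 * pi -> u t = v t) ->
    Pr u x = Pr v x.
  move=> mu mv uv; have [mi _] := rbm_ind x; apply: J_ae; [exact: rmeasM..|].
  by apply/ae_eqP; apply: ae_torus => t /andP[t0 /ltW t2]; rewrite uv// t0.
have [[m1 m2] _] := bg.
apply: ceqP.
  rewrite ReD Re_P c0 mulr0 /= cos0.
  rewrite (ae _ (fun t => - w * sin (w * t)))//; last first.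
  - by move=> t ht; rewrite clamp_id//; ring.
  - exact: rmeas_continuous.
  rewrite -Pr_clamp; last exact: rint_continuous.
  by rewrite (Pr_FTC dc)//; [rewrite mulr0 cos0; ring|exact: rint_continuous].
rewrite ImD Im_P c0 mulr0 /= sin0.
rewrite (ae _ (fun t => w * cos (w * t)))//; last first.
- by move=> t ht; rewrite clamp_id//; ring.
- exact: rmeas_continuous.
rewrite -Pr_clamp; last exact: rint_continuous.
by rewrite (Pr_FTC ds)//; [rewrite mulr0 sin0; ring|exact: rint_continuous].
Qed.

End ExponentialPrimitive.

(** * Riemann invariants and oscillating coefficients *)

Section Characteristics.
Variable R : realType.
Implicit Types (s : R -> R) (z : R[i]) (j r : R -> R[i]).

Lemma CD (a b : R) : (a + b)%:C = a%:C + b%:C :> R[i].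
Proof. by apply: ceqP; rewrite !reimE ?addr0. Qed.
Lemma CN (a : R) : (- a)%:C = - a%:C :> R[i].
Proof. by apply: ceqP; rewrite !reimE ?oppr0. Qed.
Lemma CM (a b : R) : (a * b)%:C = a%:C * b%:C :> R[i].
Proof. by apply: ceqP; rewrite !reimE; ring. Qed.
Lemma CX (a : R) n : (a ^+ n)%:C = a%:C ^+ n :> R[i].
Proof. by elim: n => [|n ih]; rewrite ?expr0// !exprS CM ih. Qed.

Lemma PrB (f g : R -> R) x : rint f -> rint g ->
  Pr (fun t => f t - g t) x = Pr f x - Pr g x.
Proof.
move=> hf hg; rewrite /Pr -JB; [|exact: rint_ind..].
by congr J; apply/funext => t; rewrite mulrBr.
Qed.

Lemma norm_Pr_bd (f : R -> R) K x : rint f -> (forall t, `|f t| <= K) ->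
  `|Pr f x| <= 2 * pi * K.
Proof.
move=> hf fK; rewrite (le_trans (le_normr_Rintegral measurableT (rint_ind x hf)))// -J_cst.
apply: le_J; [by apply: rint_norm; exact: rint_ind|exact: rint_cst|].
by move=> t _; rewrite normrM -[leRHS]mul1r ler_pM// norm_ind.
Qed.

Lemma expR_lip (a b L : R) : `|a| <= L -> `|b| <= L -> `|expR a - expR b| <= expR L * `|a - b|.
Proof.
have key u v : u <= L -> expR u - expR v <= expR L * `|u - v|.
  move=> uL; have h : expR u * (1 + (v - u)) <= expR v.
    rewrite (_ : expR v = expR u * expR (v - u)); last by rewrite -expRD addrC subrK.
    by rewrite ler_wpM2l ?expR_ge0// expR_ge1Dx.
  apply: (@le_trans _ _ (expR u * (u - v))).
    by move: h; rewrite !mulrDr mulr1; lra.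
  apply: (@le_trans _ _ (expR u * `|u - v|)); first by rewrite ler_wpM2l ?expR_ge0// ler_norm.
  by rewrite ler_wpM2r// ler_expR.
move=> aL bL; rewrite ler_norml lerNl opprB; apply/andP; split.
  by rewrite distrC key// (le_trans (ler_norm _)).
by rewrite key// (le_trans (ler_norm _)).
Qed.

Lemma cis0 : cis 0 = 1 :> R[i].
Proof. by rewrite /cis cos0 sin0. Qed.
Lemma cisD (a b : R) : cis (a + b) = cis a * cis b.
Proof. by apply: ceqP; rewrite !reimE /= ?cosD ?sinD//; ring. Qed.

(** The exponent of [G] is split into a real part, which stays bounded, and a phase, which carries
    the high frequency. *)
Definition Tf z s (t : R) : R := Re z + s t / 2.
Definition T z s := Pr (Tf z s).

(* The exponential of [z x + (1/2) \int_0^x s] for [x] in the torus. *)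
Definition G z s x : R[i] := (expR (T z s x))%:C * cis (Im z * clamp x).

(** Passing from [(z, s)] to [(- z, - s)] inverts [G] and exchanges the two families of
    characteristics, so that every estimate is proved for one family only. *)
Definition opps s : R -> R := fun x => - s x.

Lemma rbm_opps s : rbm s -> rbm (opps s).
Proof.
move=> [ms [K hK]]; split; first exact: rmeasN.
by exists K => x; rewrite normrN.
Qed.

Lemma rbm_Tf z s : rbm s -> rbm (Tf z s).
Proof. by move=> hs; apply: rbmD; [exact: rbm_cst|apply: rbmM => //; exact: rbm_cst]. Qed.

Lemma rint_Tf z s : rbm s -> rint (Tf z s).
Proof. by move=> hs; apply: rbm_rint; exact: rbm_Tf. Qed.

Lemma T_2pi z s : rbm s -> T z s (2 * pi) = 2 * pi * Re z + J s / 2.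
Proof.
move=> hs; rewrite /T Pr_2pi; last exact: rint_Tf.
rewrite JD; [|exact: rint_cst|by apply: rbm_rint; apply: rbmM => //; exact: rbm_cst].
rewrite J_cst; congr (_ + _); rewrite mulrC -JZ; last exact: rbm_rint.
by congr J; apply/funext => t; rewrite mulrC.
Qed.

Lemma T_bd z s B M x : rbm s -> `|Re z| <= B -> (forall t, `|s t| <= M) ->
  `|T z s x| <= 2 * pi * (B + M).
Proof.
move=> hs hB hM; apply: norm_Pr_bd; first exact: rint_Tf.
move=> t; rewrite (le_trans (ler_normD _ _))// lerD// (le_trans _ (hM t))//.
by rewrite normrM ler_piMr// ger0_norm// invf_le1// ler1n.
Qed.

Lemma prim_G z s : rbm s -> prim (G z s) (fun x => (z + (s x / 2)%:C) * G z s x).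
Proof.
move=> hs; have h1 := prim_expR (rint_Tf z hs); have h2 := prim_cis (Im z).
apply: prim_eq (primM h1 h2) _ => x; rewrite /G /T /Tf.
set e := expR _; set c := cis _.
have -> : ((Re z + s x / 2) * e)%:C = ((Re z)%:C + (s x / 2)%:C) * e%:C.
  by rewrite -CD -CM.
have -> : z + (s x / 2)%:C = (Re z)%:C + 'i%C * (Im z)%:C + (s x / 2)%:C.
  by rewrite -complexE.
ring.
Qed.

Lemma G_0 z s : rbm s -> G z s 0 = 1.
Proof.
move=> hs; rewrite /G /T Pr_0; last exact: rint_Tf.
by rewrite clamp_id ?lexx ?ltW ?twopi_gt0// mulr0 cis0 expR0 mulr1.
Qed.

Lemma N_G z s x : N (G z s x) = expR (T z s x).
Proof. by rewrite NM NC N_cis mulr1 ger0_norm// expR_ge0. Qed.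

Lemma T_opp z s x : rbm s -> T (- z) (opps s) x = - T z s x.
Proof.
move=> hs; rewrite /T -[RHS]mulN1r -Pr_scale; last exact: rint_Tf.
by congr Pr; apply/funext => t; rewrite /Tf /opps ReN; ring.
Qed.

Lemma G_opp z s x : rbm s -> G z s x * G (- z) (opps s) x = 1.
Proof.
move=> hs; rewrite /G T_opp// ImN mulrACA -CM -expRD subrr expR0 mul1r.
by rewrite -cisD mulNr subrr cis0.
Qed.

(** The coupling of the two invariants. By [kpE] it is a bounded amplitude times an oscillation of
    frequency [2 Im z], hence nearly zero in the mean when [Im z] is large. *)
Definition kp z s x : R[i] := (s x / 2)%:C * G z s x ^+ 2.

Lemma kpE z s x : kp z s x = (s x / 2 * expR (2 * T z s x))%:C * cis (2 * Im z * clamp x).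
Proof.
rewrite /kp /G exprMn.
have -> : expR (2 * T z s x) = expR (T z s x) ^+ 2 by rewrite expr2 -expRD; congr expR; ring.
have -> : cis (2 * Im z * clamp x) = cis (Im z * clamp x) ^+ 2.
  by rewrite expr2 -cisD; congr cis; ring.
by rewrite [in RHS]CM CX mulrA.
Qed.

Lemma bm_G z s : rbm s -> bm (G z s).
Proof. by move=> hs; exact: prim_bm (prim_G z hs). Qed.

Lemma bm_kp z s : rbm s -> bm (kp z s).
Proof.
move=> hs; apply: bmM; first by apply: bmC; apply: rbmM => //; exact: rbm_cst.
by under eq_fun do rewrite expr2; apply: bmM; exact: bm_G.
Qed.

(** A bound of [kp] when [|Re z| <= B] and [|s| <= M]; the term [M + 1] keeps it positive even for
    [M = 0]. *)
Definition Ck (B M : R) := (M + 1) * expR (4 * pi * (B + M)).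

Lemma N_kp z s B M x : rbm s -> `|Re z| <= B -> (forall t, `|s t| <= M) ->
  N (kp z s x) <= Ck B M.
Proof.
move=> hs hB hM; rewrite /kp NM NX N_G NC.
have M0 : 0 <= M by rewrite (le_trans _ (hM 0)).
apply: ler_pM => //.
  rewrite normrM [X in _ * X]ger0_norm//; apply: (@le_trans _ _ M); last by rewrite lerDl.
  by apply: le_trans (hM x); rewrite ler_piMr// invf_le1// ler1n.
rewrite expr2 -expRD ler_expR.
have := T_bd x hs hB hM; rewrite ler_norml => /andP[_ h].
by rewrite (_ : 4 * pi * (B + M) = 2 * pi * (B + M) + 2 * pi * (B + M)) ?lerD//; ring.
Qed.

(* The Riemann invariants rho + j and rho - j, divided by their free evolution. *)
Definition ua z s j r x := G z s x * (r x + j x).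
Definition vb z s j r x := G (- z) (opps s) x * (r x - j x).

(* Along the characteristics the system becomes off-diagonal. *)
Lemma sol_characteristics z s j r : rbm s -> Sol z s j r ->
  sol (kp z s) (kp (- z) (opps s)) (ua z s j r) (vb z s j r).
Proof.
move=> hs [_ _ hj hr]; have hos := rbm_opps hs.
split; [exact: bm_kp|exact: bm_kp| |].
  apply: prim_eq (primM (prim_G z hs) (primD hr hj)) _ => x.
  rewrite /kp /vb /ca /cb; have g1 := G_opp z x hs.
  transitivity ((s x / 2)%:C * G z s x * (r x - j x)).
    have -> : (s x)%:C = (s x / 2)%:C + (s x / 2)%:C by rewrite -CD -splitr.
    ring.
  rewrite expr2 -[in LHS](mul1r (r x - j x)) -g1; ring.
apply: prim_eq (primM (prim_G (- z) hos) (primB hr hj)) _ => x.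
rewrite /kp /ua /ca /cb; have g1 := G_opp z x hs.
transitivity ((opps s x / 2)%:C * G (- z) (opps s) x * (r x + j x)).
  rewrite /opps mulNr CN.
  have -> : (s x)%:C = (s x / 2)%:C + (s x / 2)%:C by rewrite -CD -splitr.
  ring.
rewrite expr2 -[in LHS](mul1r (r x + j x)) -g1; ring.
Qed.

Lemma sol_swap (a b j r : R -> R[i]) : sol a b j r -> sol b a r j.
Proof. by move=> [ba bb hj hr]; split. Qed.

(** The two quantities left when [\int a r] is integrated by parts against the primitive of [a].
    Unlike the norm of [a], they are small when [a] oscillates fast. *)
Definition osc (a : R -> R[i]) := N (P a (2 * pi)) + J (fun x => N (P a x)).

Lemma osc_ge0 a : 0 <= osc a.
Proof. by rewrite addr_ge0 ?N_ge0// J_ge0// => x; exact: N_ge0. Qed.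

(** Integrate [j' = a r] by parts: [P a * r] at the endpoint gives the first term of [osc], and
    [r' = b j] the second. *)
Lemma sol_osc (a b j r : R -> R[i]) C : sol a b j r -> 0 < C ->
  (forall x, N (a x) <= C) -> (forall x, N (b x) <= C) ->
  N (j (2 * pi) - j 0) <= 4 * expR (4 * C * pi) * (1 + C) * osc a * (N (j 0) + N (r 0)).
Proof.
move=> h C0 ha hb; have [ba bb hj hr] := h.
have bd := sol_bound h C0 ha hb.
set D := 4 * (N (j 0) + N (r 0)) * expR (4 * C * pi) in bd.
have D0 : 0 <= D by rewrite !mulr_ge0 ?expR_ge0// addr_ge0 ?N_ge0.
have jD x : N (j x) <= D by rewrite (le_trans _ (bd x))// lerDl N_ge0.
have rD x : N (r x) <= D by rewrite (le_trans _ (bd x))// lerDr N_ge0.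
have ca := bm_cint ba; have bA := bm_P ca.
have hA : prim (P a) a by split => // x; rewrite P_0// add0r.
have hAr := primM hA hr.
have [bj br] := sol_bm h.
have c1 : cint (fun x => a x * r x) by apply: bm_cint; exact: bmM.
have c2 : cint (fun x => P a x * (b x * j x)).
  by apply: bm_cint; apply: bmM => //; exact: bmM.
have -> : j (2 * pi) - j 0 =
    P a (2 * pi) * r (2 * pi) - cintegral (fun x => P a x * (b x * j x)).
  rewrite (prim_2pi hj) (prim_2pi hAr) cintegralD// P_0// mul0r; ring.
apply: (le_trans (leNB _ _)).
have i1 : rint (fun x => N (P a x)) by apply: cint_N; exact: bm_cint.
have h2 : N (cintegral (fun x => P a x * (b x * j x))) <= C * D * J (fun x => N (P a x)).
  apply: (le_trans (le_N_cintegral c2)); rewrite -JZ//.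
  apply: le_J; [exact: cint_N|exact: rintZ|].
  move=> x _; rewrite NM mulrC NM ler_wpM2r ?N_ge0//.
  by apply: ler_pM; rewrite ?N_ge0.
have h1 : N (P a (2 * pi) * r (2 * pi)) <= D * N (P a (2 * pi)).
  by rewrite NM mulrC ler_wpM2r ?N_ge0.
apply: (le_trans (lerD h1 h2)).
rewrite [leRHS](_ : _ = (1 + C) * D * osc a); last by rewrite /D; ring.
have o1 : N (P a (2 * pi)) <= osc a by rewrite lerDl J_ge0// => x; exact: N_ge0.
have o2 : J (fun x => N (P a x)) <= osc a by rewrite lerDr N_ge0.
rewrite (_ : (1 + C) * D * osc a = D * osc a + C * D * osc a); last by ring.
by apply: lerD; apply: ler_wpM2l => //; apply: mulr_ge0 => //; exact: ltW.
Qed.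

(** Convergence of [Re (z n)] makes the amplitude of [kp] converge uniformly to a fixed integrable
    function. Riemann-Lebesgue handles that function, and the remainder is bounded in absolute
    value. *)
Lemma osc_kp_cvg (z : nat -> R[i]) (sn : nat -> R -> R) s xi B M (d : nat -> R) :
  rbm s -> (forall n, rbm (sn n)) -> (forall t, `|s t| <= M) -> (forall n t, `|sn n t| <= M) ->
  to0 d -> (forall n t, `|sn n t - s t| <= d n) ->
  (forall n, `|Re (z n)| <= B) -> to0 (fun n => `|Re (z n) - xi|) -> `|xi| <= B ->
  (forall n, n%:R <= `|Im (z n)|) ->
  to0 (fun n => osc (kp (z n) (sn n))).
Proof.
move=> hs hsn hM hMn d0 hd hB hxi xiB hIm.
have M0 : 0 <= M by rewrite (le_trans _ (hM 0)).
pose L := 2 * (2 * pi * (B + M)).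
have bL z' s' x : rbm s' -> `|Re z'| <= B -> (forall t, `|s' t| <= M) -> `|2 * T z' s' x| <= L.
  by move=> ? ? ?; rewrite normrM ger0_norm// ler_pM2l// T_bd.
(* A uniform bound on the change of amplitude: the first term comes from [sn n - s], the second from
   the Lipschitz bound of the exponential applied to [T]. *)
pose th n := expR L * d n + M * (expR L * (2 * (2 * pi * (`|Re (z n) - xi| + d n)))).
have th0 : to0 th.
  apply: to0D; first exact: to0Z.
  by do 4 apply: to0Z; exact: to0D.
have pw x : to0 (fun n => N (P (kp (z n) (sn n)) x)).
  pose g t := ind x t * (s t / 2 * expR (2 * T xi%:C s t)).
  pose gn n t := ind x t * (sn n t / 2 * expR (2 * T (z n) (sn n) t)).
  have rexp z' s' : rbm s' -> rbm (fun t => expR (2 * T z' s' t)).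
    move=> hs'; have [mT [K hK]] := rbm_Pr (rint_Tf z' hs'); split.
      apply: (@measurableT_comp _ _ _ _ _ _ expR); first exact: measurable_expR.
      by apply: rmeasM => //; exact: rmeas_cst.
    exists (expR (2 * K)) => t; rewrite ger0_norm ?expR_ge0// ler_expR ler_pM2l//.
    exact: le_trans (ler_norm _) (hK t).
  have rg z' s' : rbm s' -> rint (fun t => ind x t * (s' t / 2 * expR (2 * T z' s' t))).
    move=> hs'; apply: rint_ind; apply: rbm_rint; apply: rbmM; last exact: rexp.
    by apply: rbmM => //; exact: rbm_cst.
  have ig : rint g by exact: rg.
  have ign n : rint (gn n) by exact: rg.
  have gg n t : `|gn n t - g t| <= th n.
    rewrite -mulrBr normrM (@le_trans _ _ `|sn n t / 2 * expR (2 * T (z n) (sn n) t) -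
      s t / 2 * expR (2 * T xi%:C s t)|)//; first by rewrite ler_piMl ?norm_ind.
    have -> : sn n t / 2 * expR (2 * T (z n) (sn n) t) - s t / 2 * expR (2 * T xi%:C s t) =
       expR (2 * T (z n) (sn n) t) * ((sn n t - s t) / 2) +
       s t / 2 * (expR (2 * T (z n) (sn n) t) - expR (2 * T xi%:C s t)) by ring.
    have half (a : R) : `|a / 2| <= `|a|.
      by rewrite normrM ler_piMr// ger0_norm// invf_le1// ler1n.
    have b1 := bL (z n) (sn n) t (hsn n) (hB n) (hMn n).
    have b2 := bL xi%:C s t hs xiB hM.
    rewrite (le_trans (ler_normD _ _))// lerD//.
      rewrite normrM; apply: ler_pM => //; last exact: le_trans (half _) _.
      by rewrite ger0_norm ?expR_ge0// ler_expR (le_trans (ler_norm _)).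
    rewrite normrM; apply: ler_pM => //; first exact: le_trans (half _) _.
    rewrite (le_trans (expR_lip b1 b2))// ler_wpM2l ?expR_ge0//.
    rewrite -mulrBr normrM ger0_norm// ler_pM2l//.
    rewrite -[T _ _ t - _]PrB; [|exact: rint_Tf..].
    apply: norm_Pr_bd; first by apply: rintB; exact: rint_Tf.
    move=> y; rewrite /Tf opprD addrACA (le_trans (ler_normD _ _))// lerD//.
    by rewrite -mulrBl (le_trans (half _)).
  have PE n : P (kp (z n) (sn n)) x = cintegral (fun t => (gn n t)%:C * cis (2 * Im (z n) * t)).
    have c1 : cint (fun t => (gn n t)%:C * cis (2 * Im (z n) * t)).
      exact: (cint_RL (2 * Im (z n)) (ign n)).
    apply: eq_cintegral.
    - by apply: cint_meas; apply: cint_ind; apply: bm_cint; exact: bm_kp.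
    - exact: cint_meas.
    - move=> t /andP[t0 /ltW t2]; rewrite kpE clamp_id ?t0//.
      by rewrite mulrA -CM.
  have V := riemann_lebesgue ig.
  apply: (@to0_le _ _ (fun n => 2 * pi * th n + N (cintegral (fun t => (g t)%:C * cis (2 * Im (z n) * t))))).
    move=> n; rewrite ger0_norm ?N_ge0// PE.
    have eqn t : (gn n t)%:C * cis (2 * Im (z n) * t) =
        (gn n t - g t)%:C * cis (2 * Im (z n) * t) + (g t)%:C * cis (2 * Im (z n) * t).
      by rewrite -mulrDl -CD subrK.
    have igg := rintB (ign n) ig.
    have c1 := cint_RL (2 * Im (z n)) igg; have c2 := cint_RL (2 * Im (z n)) ig.
    rewrite (funext eqn) (cintegralD c1 c2).
    apply: (le_trans (leND _ _)); rewrite lerD2r.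
    apply: le_N_cintegral_bd; first exact: cint_RL.
    by move=> t _; rewrite NM NC N_cis mulr1.
  apply: to0D; first exact: to0Z.
  apply/to0P => e /V [W hW]; exists (Num.truncn `|W|).+1 => n nW.
  rewrite ger0_norm ?N_ge0//; apply: hW.
  rewrite (le_trans (ler_norm W))// (le_trans (ltW (truncnS_gt _)))//.
  rewrite (@le_trans _ _ n%:R)// ?ler_nat// (le_trans (hIm n))//.
  by rewrite normrM ler_peMl// ger0_norm// ler1n.
apply: to0D; first exact: pw.
have bP n : bm (P (kp (z n) (sn n))) by apply: bm_P; apply: bm_cint; exact: bm_kp.
have := @J_dct R (fun n x => N (P (kp (z n) (sn n)) x)) (fun=> 0) (fun=> 2 * pi * Ck B M).
have m1 n : rmeas (fun x => N (P (kp (z n) (sn n)) x)) by case: (bm_rbmN (bP n)).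
move=> /(_ m1 (rmeas_cst _) (rint_cst _)) D.
apply: (to0_le _ (D _ _)).
- move=> n; rewrite ger0_norm; last by apply: J_ge0 => x; exact: N_ge0.
  rewrite le_eqVlt; apply/orP; left; apply/eqP; congr J; apply/funext => x.
  by rewrite subr0 ger0_norm ?N_ge0.
- move=> n x; rewrite ger0_norm ?N_ge0//; apply: le_N_P_bd; first exact: bm_kp.
  by move=> t; exact: N_kp.
- by move=> x _; apply: to0_le (pw x) => n; rewrite subr0 ger0_norm ?N_ge0.
Qed.

End Characteristics.

(** * Eigenvalues and trace at high frequency *)

Section HighFrequency.
Variable R : realType.
Implicit Types (s : R -> R) (z : R[i]) (j r : R -> R[i]).

Definition osc2 z s := osc (kp z s) + osc (kp (- z) (opps s)).

Lemma osc2_ge0 z s : 0 <= osc2 z s.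
Proof. by rewrite addr_ge0 ?osc_ge0. Qed.

(** The real parts are merely bounded, so the limit [xi] asked by [osc_kp_cvg] exists along a
    subsequence. *)
Lemma osc2_subseq (z : nat -> R[i]) (sn : nat -> R -> R) s B M (d : nat -> R) :
  rbm s -> (forall n, rbm (sn n)) -> (forall t, `|s t| <= M) -> (forall n t, `|sn n t| <= M) ->
  to0 d -> (forall n t, `|sn n t - s t| <= d n) ->
  (forall n, `|Re (z n)| <= B) -> (forall n, n%:R <= `|Im (z n)|) ->
  exists2 f : nat -> nat, (forall k, (k <= f k)%N) &
    to0 (fun k => osc2 (z (f k)) (sn (f k))).
Proof.
move=> hs hsn hM hMn d0 hd hB hIm.
have [n|f fk [l hl]] := @bolzano_weierstrassC R (fun n => (Re (z n))%:C) B.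
  by rewrite NC.
exists f => //.
pose xi := Re l.
have hxi : to0 (fun k => `|Re (z (f k)) - xi|).
  apply: to0_le hl => k; rewrite normr_id.
  by have := Re_leN ((Re (z (f k)))%:C - l); rewrite ReD ReN ReC.
have xiB : `|xi| <= B.
  rewrite -subr_le0; apply: (to0_le_cst hxi) => k.
  have := hB (f k); have := ler_normD (xi - Re (z (f k))) (Re (z (f k))).
  by rewrite subrK distrC; lra.
have hIm' k : k%:R <= `|Im (z (f k))| by rewrite (le_trans _ (hIm (f k)))// ler_nat.
have d0' := to0_sub fk d0.
apply: to0D.
  exact: (@osc_kp_cvg R (fun k => z (f k)) (fun k => sn (f k)) s xi B M (fun k => d (f k))).
apply: (@osc_kp_cvg R (fun k => - z (f k)) (fun k => opps (sn (f k))) (opps s) (- xi) B M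
  (fun k => d (f k))) => //.
- exact: rbm_opps.
- by move=> k; exact: rbm_opps.
- by move=> t; rewrite normrN.
- by move=> k t; rewrite normrN.
- by move=> k t; rewrite /opps -opprD normrN; exact: hd.
- by move=> k; rewrite ReN normrN.
- by apply: to0_le hxi => k; rewrite ReN -opprD normrN normr_id.
- by rewrite normrN.
- by move=> k; rewrite ImN normrN.
Qed.

(** The constant of [sol_osc] for coefficients bounded by [Ck B M]. *)
Definition Qk (B M : R) : R := 4 * expR (4 * Ck B M * pi) * (1 + Ck B M).

Lemma Ck_gt0 (B M : R) : 0 <= M -> 0 < Ck B M.
Proof. by move=> M0; rewrite mulr_gt0 ?expR_gt0// ltr_wpDl. Qed.

Lemma Qk_gt0 (B M : R) : 0 <= M -> 0 < Qk B M.
Proof.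
by move=> M0; rewrite !mulr_gt0 ?expR_gt0// ltr_wpDr// ltW// Ck_gt0.
Qed.

Section Bounds.
Variables (z : R[i]) (s : R -> R) (j r : R -> R[i]) (B M : R).
Hypotheses (hs : rbm s) (hB : `|Re z| <= B) (hM : forall t, `|s t| <= M).
Hypothesis hsol : Sol z s j r.
Let a := ua z s j r.
Let b := vb z s j r.

Let M0 : 0 <= M. Proof. by rewrite (le_trans _ (hM 0)). Qed.
Let hk x : N (kp z s x) <= Ck B M. Proof. exact: N_kp. Qed.
Let hk' x : N (kp (- z) (opps s) x) <= Ck B M.
Proof.
apply: N_kp; [exact: rbm_opps|by rewrite ReN normrN|by move=> t; rewrite normrN].
Qed.

Lemma ua_osc : N (a (2 * pi) - a 0) <= Qk B M * osc2 z s * (N (a 0) + N (b 0)).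
Proof.
have := sol_osc (sol_characteristics hs hsol) (Ck_gt0 B M0) hk hk'.
move=> /le_trans; apply; rewrite ler_wpM2r ?addr_ge0 ?N_ge0//.
by rewrite ler_pM2l ?Qk_gt0// lerDl osc_ge0.
Qed.

Lemma vb_osc : N (b (2 * pi) - b 0) <= Qk B M * osc2 z s * (N (a 0) + N (b 0)).
Proof.
have := sol_osc (sol_swap (sol_characteristics hs hsol)) (Ck_gt0 B M0) hk' hk.
move=> /le_trans; apply; rewrite [N (a 0) + _]addrC ler_wpM2r ?addr_ge0 ?N_ge0//.
by rewrite ler_pM2l ?Qk_gt0// lerDr osc_ge0.
Qed.

End Bounds.

Lemma ua_0 z s j r : rbm s -> ua z s j r 0 = r 0 + j 0.
Proof. by move=> hs; rewrite /ua G_0// mul1r. Qed.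
Lemma vb_0 z s j r : rbm s -> vb z s j r 0 = r 0 - j 0.
Proof. by move=> hs; rewrite /vb G_0 ?mul1r//; exact: rbm_opps. Qed.

(** Periodicity makes the invariants at [2 pi] equal to [E u] and [E^-1 v], where [u] and [v] are
    their values at 0. Small oscillation would keep them close to [u] and [v], which
    [|E| >= exp (2 pi k)] forbids. So an eigenvalue at distance [k] to the right of the clustering
    line has [osc2] bounded below. *)
Lemma eig_highfreq z s j r B M k : rbm s -> `|Re z| <= B -> (forall t, `|s t| <= M) ->
  Sol z s j r -> j (2 * pi) = j 0 -> r (2 * pi) = r 0 -> 0 < N (j 0) + N (r 0) ->
  0 < k -> - (J s / (4 * pi)) + k <= Re z ->
  1 - expR (- (2 * pi * k)) <= 2 * (Qk B M * osc2 z s).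
Proof.
move=> hs hB hM hsol pj pr nz k0 hk.
have ha := ua_osc hs hB hM hsol; have hb := vb_osc hs hB hM hsol.
pose u := r 0 + j 0; pose v := r 0 - j 0.
pose E := G z s (2 * pi); pose E' := G (- z) (opps s) (2 * pi).
have p0 : 0 < pi :> R := pi_gt0 R.
have Tk : 2 * pi * k <= T z s (2 * pi).
  rewrite T_2pi//.
  have : 2 * pi * (- (J s / (4 * pi)) + k) <= 2 * pi * Re z by rewrite ler_pM2l// twopi_gt0.
  rewrite (_ : 2 * pi * (- (J s / (4 * pi)) + k) = 2 * pi * k - J s / 2); first by lra.
  by move: (pi : R) (gt_eqF p0) => q /negbT q0; field.
have NE : expR (2 * pi * k) <= N E by rewrite N_G ler_expR.
have NE' : N E' <= expR (- (2 * pi * k)) by rewrite N_G T_opp// ler_expR lerN2.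
have ua2 : ua z s j r (2 * pi) = E * u by rewrite /ua pj pr.
have vb2 : vb z s j r (2 * pi) = E' * v by rewrite /vb pj pr.
move: ha hb; rewrite ua2 vb2 !ua_0// !vb_0// -/u -/v.
rewrite (_ : E * u - u = (E - 1) * u); last by ring.
rewrite (_ : E' * v - v = (E' - 1) * v); last by ring.
rewrite !NM.
set m := 1 - expR _.
have m1 : m <= N (E - 1).
  have := leND (E - 1) 1; rewrite subrK N1 => h.
  (* The tangent bounds at [y] and [- y] give [exp y - 1 >= 1 - exp (- y)], so one [m] serves both
     invariants. *)
  have e1 := expR_ge1Dx (2 * pi * k); have e2 := expR_ge1Dx (- (2 * pi * k)).
  by rewrite /m; lra.
have m2 : m <= N (E' - 1).
  by have := leNB E' (E' - 1); rewrite subKr N1 /m; lra.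
have uv : 0 < N u + N v.
  rewrite lt0r addr_ge0 ?N_ge0// andbT paddr_eq0 ?N_ge0// !N_eq0.
  apply/negP => /andP[/eqP u0 /eqP v0].
  have j00 : j 0 = 0.
    have e2 : 2%:R * j 0 = (r 0 + j 0) - (r 0 - j 0) by ring.
    rewrite -/u -/v u0 v0 subr0 in e2.
    by move/eqP: e2; rewrite mulf_eq0 pnatr_eq0 /= => /eqP.
  have r00 : r 0 = 0 by move: u0; rewrite /u j00 addr0.
  by move: nz; rewrite j00 r00 N0 addr0 ltxx.
set q := Qk B M * osc2 z s => h1 h2.
rewrite -(ler_pM2r uv).
have h3 : m * N u <= N (E - 1) * N u by rewrite ler_wpM2r ?N_ge0.
have h4 : m * N v <= N (E' - 1) * N v by rewrite ler_wpM2r ?N_ge0.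
by rewrite mulrDr; lra.
Qed.

(** The trace is computed in the basis of Riemann invariants: half the sum and half the difference
    of the two fundamental solutions start from invariants [(1, 0)] and [(0, 1)], and each keeps its
    invariant up to the oscillation error. *)
Lemma trace_highfreq z s B M j1 r1 j2 r2 : rbm s -> `|Re z| <= B -> (forall t, `|s t| <= M) ->
  Sol z s j1 r1 -> Sol z s j2 r2 -> j1 0 = 1 -> r1 0 = 0 -> j2 0 = 0 -> r2 0 = 1 ->
  N ((j1 (2 * pi) + r2 (2 * pi)) - (G z s (2 * pi) + G (- z) (opps s) (2 * pi))) <=
  Qk B M * osc2 z s * (N (G z s (2 * pi)) + N (G (- z) (opps s) (2 * pi))).
Proof.
move=> hs hB hM h1 h2 j10 r10 j20 r20; set E := G z s _; set E' := G (- z) _ _.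
have EE : E * E' = 1 := G_opp z (2 * pi) hs.
pose h : R[i] := 2^-1.
have hh : h + h = 1 by rewrite /h; field.
have s1 := sol_lin h h h1 h2; have s2 := sol_lin (- h) h h1 h2.
have := ua_osc hs hB hM s1; have := vb_osc hs hB hM s2.
rewrite !ua_0// !vb_0// j10 r10 j20 r20 !(mulr0, mulr1, addr0, add0r).
rewrite opprK hh addrN !N0 N1 !(mulr1, addr0, add0r).
rewrite /ua /vb -/E -/E'.
set V := _ - (- h * j1 _ + _); set U := _ + (h * j1 _ + _) => hV hU.
have -> : j1 (2 * pi) + r2 (2 * pi) - (E + E') = E' * (E * U - 1) + E * (E' * V - 1).
  have UV : j1 (2 * pi) + r2 (2 * pi) = U + V.
    transitivity ((h + h) * (j1 (2 * pi) + r2 (2 * pi))); first by rewrite hh mul1r.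
    by rewrite /U /V; ring.
  rewrite UV (_ : E' * (E * U - 1) + E * (E' * V - 1) = (E * E') * (U + V) - (E + E')).
    by rewrite EE mul1r.
  ring.
clearbody E E' U V; apply: (le_trans (leND _ _)); rewrite (NM E') (NM E) mulrDr addrC.
by apply: lerD; rewrite mulrC; apply: ler_wpM2r => //; exact: N_ge0.
Qed.

End HighFrequency.

(** * The monodromy matrix and its trace *)

Section Trace.
Variable R : realType.
Implicit Types (s : R -> R) (z : R[i]) (j r : R -> R[i]).

Lemma sol_unique a b j r j' r' : sol a b j r -> sol a b j' r' ->
  j 0 = j' 0 -> r 0 = r' 0 -> forall x : R, j x = j' x /\ r x = r' x.
Proof.
move=> h h' ej er x.
have := sol_eq0 (sol_lin 1 (-1) h h').
rewrite ej er !mul1r !mulN1r !subrr => /(_ erefl erefl x) [h1 h2].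
by split; apply/eqP; rewrite -subr_eq0 -mulN1r -[X in X + _]mul1r ?h1 ?h2.
Qed.

Lemma sol_picard a b j r C : sol a b j r -> 0 < C ->
  (forall x, N (a x) <= C) -> (forall x, N (b x) <= C) ->
  forall n (x : R),
  let A := (N (j 0) + N (r 0)) * expR (4 * C * pi) in
  N (j x - (picard a b (j 0, r 0) n).1 x) <= 2 * A / 2 ^+ n /\
  N (r x - (picard a b (j 0, r 0) n).2 x) <= 2 * A / 2 ^+ n.
Proof.
move=> h C0 ha hb n x; have [ba bb _ _] := h.
have [y [hy [y1 y2]] H] := picard_sol (j 0, r 0) C0 ba bb ha hb.
have [-> ->] := sol_unique h hy (esym y1) (esym y2) x.
exact: H.
Qed.

Lemma N_ca z B x : N z <= B -> N (ca z x) <= B.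
Proof. by move=> h; rewrite NN. Qed.
Lemma N_cb z s B M x : N z <= B -> (forall t, `|s t| <= M) -> N (cb z s x) <= B + M.
Proof. by move=> h hM; rewrite NN (le_trans (leND _ _))// NC lerD. Qed.

Definition fundamental z s (Y : (R -> R[i]) * (R -> R[i]) * ((R -> R[i]) * (R -> R[i]))) :=
  [/\ Sol z s Y.1.1 Y.1.2, Sol z s Y.2.1 Y.2.2,
      (Y.1.1 0, Y.1.2 0) = (1, 0) & (Y.2.1 0, Y.2.2 0) = (0, 1)].

Lemma Sol_exists z s c : rbm s -> exists2 y, Sol z s y.1 y.2 & (y.1 0, y.2 0) = c.
Proof.
move=> hs; have [_ [M hM]] := hs.
have M0 : 0 <= M by rewrite (le_trans _ (hM 0)).
have C0 : 0 < N z + M + 1 by rewrite ltr_wpDl// addr_ge0 ?N_ge0.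
have h1 x : N (ca z x) <= N z + M + 1 by apply: N_ca; rewrite -addrA lerDl addr_ge0.
have h2 x : N (cb z s x) <= N z + M + 1.
  by rewrite (le_trans (N_cb x (lexx _) hM))// lerDl.
have [y [hy hc] _] := picard_sol c C0 (bm_ca z) (bm_cb z hs) h1 h2.
by exists y.
Qed.

Lemma fundamental_exists z s : rbm s -> exists Y, fundamental z s Y.
Proof.
move=> hs; have [y hy y0] := Sol_exists z (1, 0) hs; have [w hw w0] := Sol_exists z (0, 1) hs.
by exists (y, w).
Qed.

Lemma fundamental_det z s Y : fundamental z s Y ->
  forall x, Y.1.1 x * Y.2.2 x - Y.2.1 x * Y.1.2 x = 1.
Proof.
move=> [h1 h2 [e1 e2] [e3 e4]] x.
by rewrite (sol_wronskian h1 h2) e1 e2 e3 e4 !mulr1 mulr0 subr0.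
Qed.

Definition periodic_sol z s j r :=
  [/\ Sol z s j r, j (2 * pi) = j 0, r (2 * pi) = r 0 & 0 < N (j 0) + N (r 0)].

(** The concrete form of an eigenvalue. The mean condition follows from periodicity of [j] when
    [z != 0], as [j' = - z r]; at [z = 0] it is the constraint that defines the space. *)
Definition peig s z := exists j r, periodic_sol z s j r /\ cintegral r = 0.

Lemma pair_neq0 (a b : R[i]) : 0 < N a + N b <-> a != 0 \/ b != 0.
Proof.
rewrite lt0r addr_ge0 ?N_ge0// andbT paddr_eq0 ?N_ge0// !N_eq0 negb_and.
by split => [/orP//|/orP].
Qed.

(** The monodromy matrix has determinant 1, so trace 2 makes 1 an eigenvalue of it. *)
Lemma trace_eig z s Y : rbm s -> fundamental z s Y -> z != 0 ->
  Y.1.1 (2 * pi) + Y.2.2 (2 * pi) - 2 = 0 -> peig s z.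
Proof.
move=> hs hY z0 tr; have det := fundamental_det hY (2 * pi).
have [h1 h2 [e1 e2] [e3 e4]] := hY.
set p := Y.1.1 _ in tr det; set q := Y.2.1 (2 * pi) in det.
set p' := Y.1.2 _ in det; set q' := Y.2.2 _ in tr det.
have q'E : q' = 2 - p by apply/eqP; rewrite -subr_eq0 opprB addrA [q' + p]addrC tr.
have [al [be [ne H1 H2]]] : exists al be : R[i], [/\ al != 0 \/ be != 0,
    al * p + be * q = al & al * p' + be * q' = be].
  have [q0|q0] := eqVneq q 0; last first.
    exists q, (1 - p); split; first by left.
      ring.
    rewrite mulrC q'E; rewrite q'E in det.
    have -> : p' * q = p * (2 - p) - (p * (2 - p) - q * p') by ring.
    by rewrite det; ring.
  have p1 : p = 1.
    move: det; rewrite q0 mul0r subr0 q'E => det.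
    have : (p - 1) ^+ 2 = 1 - p * (2 - p) by ring.
    rewrite det subrr => /eqP.
    by rewrite sqrf_eq0 subr_eq0 => /eqP.
  exists 0, 1; split; first by right; exact: oner_neq0.
    by rewrite q0; ring.
  by rewrite q'E p1; ring.
exists (fun x => al * Y.1.1 x + be * Y.2.1 x), (fun x => al * Y.1.2 x + be * Y.2.2 x).
have hsol := sol_lin al be h1 h2.
have Ej : al * Y.1.1 (2 * pi) + be * Y.2.1 (2 * pi) = al * Y.1.1 0 + be * Y.2.1 0.
  by rewrite -/p -/q H1 e1 e3 mulr1 mulr0 addr0.
have Er : al * Y.1.2 (2 * pi) + be * Y.2.2 (2 * pi) = al * Y.1.2 0 + be * Y.2.2 0.
  by rewrite -/p' -/q' H2 e2 e4 mulr1 mulr0 add0r.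
split.
  split => //; rewrite e1 e2 e3 e4 !mulr1 !mulr0 addr0 add0r.
  exact/pair_neq0.
have [_ _ hj _] := hsol; have [bj br] := sol_bm hsol.
have := prim_2pi hj; rewrite Ej -[X in X = _]addr0 => /addrI/esym.
rewrite /ca cintegralZ; last exact: bm_cint.
by move/eqP; rewrite mulf_eq0 oppr_eq0 (negbTE z0) => /eqP.
Qed.

(** On the disc the coefficients share the bound [C], so the Picard error and the Lipschitz constant
    in [z] are uniform there. [K] bounds both fundamental solutions, whose initial values have total
    modulus 1. *)
Lemma trace_hurwitz s M (Y : R[i] -> _) z0 (rho m : R) : rbm s -> (forall t, `|s t| <= M) ->
  (forall z, fundamental z s (Y z)) -> 0 < rho ->
  let F z := (Y z).1.1 (2 * pi) + (Y z).2.2 (2 * pi) - 2 in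
  (forall z, N (z - z0) = rho -> m <= N (F z)) -> N (F z0) < m ->
  exists2 z, N (z - z0) <= rho & F z = 0.
Proof.
move=> hs hM hY rho0 F hm h0.
have M0 : 0 <= M by rewrite (le_trans _ (hM 0)).
pose B := N z0 + rho; pose C := B + M + 1.
have B0 : 0 <= B by rewrite addr_ge0 ?N_ge0 ?ltW.
have C0 : 0 < C by rewrite ltr_wpDl// addr_ge0.
have zB z : N (z - z0) <= rho -> N z <= B.
  by move=> h; have := leND (z - z0) z0; rewrite subrK /B; lra.
have hca z x : N (z - z0) <= rho -> N (ca z x) <= C.
  by move=> h; rewrite (le_trans (N_ca x (zB _ h)))// /C -addrA lerDl addr_ge0.
have hcb z x : N (z - z0) <= rho -> N (cb z s x) <= C.
  by move=> h; rewrite (le_trans (N_cb x (zB _ h) hM))// /C lerDl.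
have /choice[pq1 hpq1] n := picard_poly (1, 0) n hs.
have /choice[qq1 hqq1] := hpq1.
have /choice[pq2 hpq2] n := picard_poly (0, 1) n hs.
have /choice[qq2 hqq2] := hpq2.
pose A := 1 * expR (4 * C * pi).
pose pol n := pq1 n (2 * pi) + qq2 n (2 * pi) - 2%:R%:P.
pose K := 4 * expR (4 * C * pi).
have K0 : 0 <= K by rewrite mulr_ge0 ?expR_ge0.
pose L := 2 * (2 * (2 * 0 + 4 * pi * K) * expR (4 * C * pi)).
apply: (@hurwitz R F pol z0 rho m (4 * A) L) => //.
  move=> n z hz; have [h1 h2 [e1 e2] [e3 e4]] := hY z.
  have [_ _ _ _ /(_ z (2 * pi)) [p1 _]] := hqq1 n.
  have [_ _ _ _ /(_ z (2 * pi)) [_ p2]] := hqq2 n.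
  have [b1 _] := sol_picard h1 C0 (fun x => hca z x hz) (fun x => hcb z x hz) n (2 * pi).
  have [_ b2] := sol_picard h2 C0 (fun x => hca z x hz) (fun x => hcb z x hz) n (2 * pi).
  move: b1 b2; rewrite e1 e2 e3 e4 p1 p2 N0 N1 addr0 add0r -/A => b1 b2.
  rewrite /F /pol !(hornerD, hornerN, hornerC).
  rewrite (_ : _ - (_ - _) = ((Y z).1.1 (2 * pi) - (pq1 n (2 * pi)).[z]) +
     ((Y z).2.2 (2 * pi) - (qq2 n (2 * pi)).[z])); last by ring.
  apply: (le_trans (leND _ _)); apply: (le_trans (lerD b1 b2)).
  by move: (_^-1) => q; lra.
move=> z w hz hw; have [h1 h2 [e1 e2] [e3 e4]] := hY z.
have [h1' h2' [e1' e2'] [e3' e4']] := hY w.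
have D0 : 0 <= N (z - w) by exact: N_ge0.
have ka x : N (ca z x - ca w x) <= N (z - w).
  by rewrite /ca -opprD NN.
have kb x : N (cb z s x - cb w s x) <= N (z - w).
  by rewrite /cb -opprD NN opprD addrACA subrr addr0.
have B1 x := sol_bound h1' C0 (fun x => hca w x hw) (fun x => hcb w x hw) x.
have B2 x := sol_bound h2' C0 (fun x => hca w x hw) (fun x => hcb w x hw) x.
rewrite e1' e2' N0 N1 addr0 mulr1 -/K in B1.
rewrite e3' e4' N0 N1 add0r mulr1 -/K in B2.
have Kj1 x : N ((Y w).1.1 x) <= K by rewrite (le_trans _ (B1 x))// lerDl N_ge0.
have Kr1 x : N ((Y w).1.2 x) <= K by rewrite (le_trans _ (B1 x))// lerDr N_ge0.
have Kj2 x : N ((Y w).2.1 x) <= K by rewrite (le_trans _ (B2 x))// lerDl N_ge0.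
have Kr2 x : N ((Y w).2.2 x) <= K by rewrite (le_trans _ (B2 x))// lerDr N_ge0.
have d1 : N ((Y z).1.1 0 - (Y w).1.1 0) <= 0 by rewrite e1 e1' subrr N0.
have d2 : N ((Y z).1.2 0 - (Y w).1.2 0) <= 0 by rewrite e2 e2' subrr N0.
have d3 : N ((Y z).2.1 0 - (Y w).2.1 0) <= 0 by rewrite e3 e3' subrr N0.
have d4 : N ((Y z).2.2 0 - (Y w).2.2 0) <= 0 by rewrite e4 e4' subrr N0.
have S1 := sol_sub h1 h1' C0 (lexx _) D0 K0 (fun x => hca z x hz) (fun x => hcb z x hz)
  ka kb Kj1 Kr1 d1 d2 (2 * pi).
have S2 := sol_sub h2 h2' C0 (lexx _) D0 K0 (fun x => hca z x hz) (fun x => hcb z x hz)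
  ka kb Kj2 Kr2 d3 d4 (2 * pi).
rewrite /F (_ : _ - _ - (_ - _) = ((Y z).1.1 (2 * pi) - (Y w).1.1 (2 * pi)) +
   ((Y z).2.2 (2 * pi) - (Y w).2.2 (2 * pi))); last by ring.
apply: (le_trans (leND _ _)).
have T1 : N ((Y z).1.1 (2 * pi) - (Y w).1.1 (2 * pi)) <= L / 2 * N (z - w).
  apply: le_trans (le_trans _ S1) _; first by rewrite lerDl N_ge0.
  by rewrite le_eqVlt; apply/orP; left; apply/eqP; rewrite /L; field.
have T2 : N ((Y z).2.2 (2 * pi) - (Y w).2.2 (2 * pi)) <= L / 2 * N (z - w).
  apply: le_trans (le_trans _ S2) _; first by rewrite lerDr N_ge0.
  by rewrite le_eqVlt; apply/orP; left; apply/eqP; rewrite /L; field.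
apply: (le_trans (lerD T1 T2)); by rewrite -mulrDl -splitr.
Qed.

End Trace.

(** * Eigenvalues near the clustering line *)

Section EigExists.
Variable R : realType.
Implicit Types (s : R -> R) (z : R[i]) (j r : R -> R[i]).

Lemma ReB (a b : R[i]) : Re (a - b) = Re a - Re b.
Proof. by rewrite ReD ReN. Qed.
Lemma ImB (a b : R[i]) : Im (a - b) = Im a - Im b.
Proof. by rewrite ImD ImN. Qed.

Lemma expR_sub1 (p : R) : `|p| <= 1 -> `|p| / 2 <= `|expR p - 1|.
Proof.
move=> p1; have [p0|p0] := leP 0 p.
  have := expR_ge1Dx p; rewrite ger0_norm// => h.
  by rewrite ger0_norm; lra.
have q0 : 0 < - p by lra.
rewrite ltr0_norm// in p1 *.
have h : (1 - p) * expR p <= 1.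
  rewrite -[leRHS](expRxMexpNx_1 p) mulrC ler_wpM2l ?expR_ge0//.
  by have := expR_ge1Dx (- p); lra.
rewrite ler0_norm; last by rewrite subr_le0 -expR0 ler_expR ltW.
move: (expR p) h => e h.
rewrite leNgt; apply/negP => h2.
have h3 : 0 <= (- p) * (1 + p) by rewrite mulr_ge0; lra.
have h4 : 0 < (1 - p) * (e - (1 + p / 2)) by rewrite mulr_gt0; lra.
by nra.
Qed.

(** On the circle either [|p| >= r / 2], and the modulus of [exp (p + i q)] is away from 1, or
    [|q| >= r / 2], and its imaginary part is away from 0. *)
Lemma exp_circle (r : R) : 0 < r <= 1 -> exists2 m, 0 < m &
  forall p q, p ^+ 2 + q ^+ 2 = r ^+ 2 -> m <= N ((expR p)%:C * cis q - 1).
Proof.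
move=> /andP[r0 r1].
have pi2 : 1 <= pi / 2 :> R by have := pi_ge2 R; lra.
have sr : 0 < sin (r / 2).
  by apply: sin_gt0_pi; apply/andP; split; lra.
exists (Num.min (r / 4) (expR (-1) * sin (r / 2))).
  by rewrite lt_min; apply/andP; split; [lra|rewrite mulr_gt0 ?expR_gt0].
move=> p q pq.
have pr : `|p| <= r.
  rewrite -(@ler_pXn2r _ 2) ?nnegrE ?normr_ge0 ?(ltW r0)//.
  by rewrite -normrX ger0_norm ?sqr_ge0// -pq lerDl sqr_ge0.
have qr : `|q| <= r.
  rewrite -(@ler_pXn2r _ 2) ?nnegrE ?normr_ge0 ?(ltW r0)//.
  by rewrite -normrX ger0_norm ?sqr_ge0// -pq lerDr sqr_ge0.
rewrite ge_min.
have [p2|p2] := leP (r / 2) `|p|.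
  apply/orP; left.
  have h := expR_sub1 (le_trans pr r1).
  have := leND ((expR p)%:C * cis q - 1) 1; rewrite subrK NM N_cis NC N1 mulr1 => h1.
  have := leND (1 - (expR p)%:C * cis q) ((expR p)%:C * cis q).
  rewrite subrK [N (1 - (expR p)%:C * cis q)]N_distC NM N_cis NC N1 mulr1 => h2.
  rewrite (ger0_norm (expR_ge0 p)) in h1 h2.
  apply: (@le_trans _ _ (`|expR p - 1|)); first by lra.
  by rewrite ler_norml; apply/andP; split; lra.
apply/orP; right.
have q2 : r / 2 <= `|q|.
  have hp : p ^+ 2 <= (r / 2) ^+ 2.
    by rewrite -[p ^+ 2]ger0_norm ?sqr_ge0// normrX ler_pXn2r ?nnegrE ?normr_ge0//; lra.
  rewrite -(@ler_pXn2r _ 2) ?nnegrE ?normr_ge0//; last by lra.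
  rewrite -normrX ger0_norm ?sqr_ge0//.
  have : (r / 2) ^+ 2 = r ^+ 2 / 4 by field.
  by move: hp pq (sqr_ge0 r) => + + + e; rewrite e; lra.
apply: le_trans (Im_leN _).
rewrite ImD ImN ImM ImC ReC /cis /= oppr0 addr0 mul0r addr0 normrM ger0_norm ?expR_ge0//.
apply: ler_pM; rewrite ?expR_ge0 ?(ltW sr)//.
  by rewrite ler_expR; move: pr; rewrite ler_norml => /andP[h _]; lra.
have e : `|sin q| = sin `|q|.
  have [q0|q0] := leP 0 q.
    rewrite (ger0_norm q0) in qr *; rewrite ger0_norm//; apply: sin_ge0_pi; apply/andP; split; lra.
  rewrite (ltr0_norm q0) in qr *.
  rewrite (_ : `|sin q| = `|sin (- q)|); last by rewrite sinN normrN.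
  by rewrite ger0_norm//; apply: sin_ge0_pi; apply/andP; split; lra.
rewrite e; move: q2; rewrite le_eqVlt => /orP[/eqP->//|q2].
apply/ltW; rewrite ltr_sin// in_itv/=; apply/andP; split; lra.
Qed.

Lemma cis_2pik k : cis (2 * pi * k%:R) = 1 :> R[i].
Proof.
elim: k => [|k IH]; first by rewrite mulr0 cis0.
have -> : 2 * pi * k.+1%:R = 2 * pi * k%:R + pi *+ 2 :> R.
  by rewrite -natr1 mulr2n; move: (pi : R) => q; ring.
by rewrite cisD IH mul1r /cis cos2pi sin2pi.
Qed.

Lemma cis_N2pik k : cis (- (2 * pi * k%:R)) = 1 :> R[i].
Proof. by have := cis_2pik k; rewrite /cis cosN sinN => -[-> ->]; rewrite oppr0. Qed.

Lemma osc2_small s (c rho d : R) (K : nat) : rbm s -> 0 < d -> exists2 k : nat, (K <= k)%N &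
  forall z, N (z - (c +i* k%:R)) <= rho -> osc2 z s <= d.
Proof.
move=> hs d0; apply: contrapT => H.
have [_ [M hM]] := hs.
have [n0 hn0] : exists n0 : nat, `|rho| <= n0%:R.
  by exists (Num.bound `|rho|); rewrite ltW// archi_boundP.
have H' n : exists z, N (z - (c +i* (n + n0 + K)%:R)) <= rho /\ d < osc2 z s.
  apply: contrapT => h; apply: H; exists (n + n0 + K)%N; first by rewrite leq_addl.
  by move=> z hz; rewrite leNgt; apply/negP => h2; apply: h; exists z.
have [z hz] := choice H'.
have hRe n : `|Re (z n)| <= `|c| + `|rho|.
  have [h _] := hz n; have := le_trans (Re_leN _) h; rewrite ReB /= => h1.
  have := ler_normD (Re (z n) - c) c; rewrite subrK; have := ler_norm rho; lra.
have hIm n : n%:R <= `|Im (z n)|.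
  have [h _] := hz n; have := le_trans (Im_leN _) h; rewrite ImB /= => h1.
  apply: le_trans (ler_norm _); move: h1; rewrite ler_norml => /andP[h1 _].
  move: h1; rewrite !natrD; have := ler_norm rho; have := ler0n R K; lra.
have d00 (n : nat) t : `|s t - s t| <= (fun=> 0 : R) n by rewrite subrr normr0.
have [f _ hf] := osc2_subseq hs (fun=> hs) hM (fun=> hM) (cvg_cst _) d00 hRe hIm.
have := to0_le_cst hf (fun k => ltW (hz (f k)).2); lra.
Qed.

(** The centre [c + i k] lies on the clustering line with [k] an integer, so that [E = 1] there and
    [E + 1 / E - 2] vanishes. The condition [2 pi rho <= 1] keeps the exponent of [E] in the unit
    disc, up to the period of [cis]. *)
Lemma eig_exists s (rho : R) (K : nat) : rbm s -> 0 < rho -> 2 * pi * rho <= 1 ->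
  exists z, [/\ peig s z, - (J s / (4 * pi)) - rho <= Re z & K%:R <= Im z].
Proof.
move=> hs rho0 rho1.
have pi0 := pi_gt0 R; have tp := twopi_gt0 R.
have [m m0 hm] : exists2 m : R, 0 < m & forall p q, p ^+ 2 + q ^+ 2 = (2 * pi * rho) ^+ 2 ->
    m <= N ((expR p)%:C * cis q - 1).
  by apply: exp_circle; rewrite rho1 mulr_gt0.
pose c := - (J s / (4 * pi)).
have [_ [M hM]] := hs; have M0 : 0 <= M by rewrite (le_trans _ (hM 0)).
pose B := `|c| + rho.
(* [E + 1 / E - 2 = (E - 1)^2 / E], with [|E - 1| >= m] and [|1 / E| >= exp (- 1)] on the circle. *)
pose m1 := m ^+ 2 * expR (- 1).
have m10 : 0 < m1 by rewrite mulr_gt0 ?exprn_gt0 ?expR_gt0.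
have Q0 : 0 < Qk B M := Qk_gt0 B M0.
(* Chosen so that the trace differs from [E + 1 / E] by at most [Qk B M * d * 2 * exp 1 = m1 / 4],
   which leaves room for the level [m1 / 2] between centre and circle. *)
pose d := m1 / (8 * expR 1 * Qk B M).
have d0 : 0 < d by apply: divr_gt0 => //; apply: mulr_gt0 => //; rewrite pmulr_rgt0// expR_gt0.
(* The extra 1 absorbs [rho <= 1 / 4]: the zero found has imaginary part above [K], and is therefore
   not 0. *)
have [k kK hk] := @osc2_small s c rho d (K + 1) hs d0.
pose z0 : R[i] := c +i* k%:R.
have /choice[Y hY] z := fundamental_exists z hs.
have hz z : N (z - z0) <= rho -> exists p q, [/\ G z s (2 * pi) = (expR p)%:C * cis q,
    G (- z) (opps s) (2 * pi) = (expR (- p))%:C * cis (- q), `|p| <= 1 &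
    p ^+ 2 + q ^+ 2 = (2 * pi * N (z - z0)) ^+ 2].
  move=> h; exists (2 * pi * (Re z - c)), (2 * pi * (Im z - k%:R)).
  have eT : T z s (2 * pi) = 2 * pi * (Re z - c).
    rewrite T_2pi// /c; move: (pi : R) (gt_eqF pi0) => q /negbT q0; by field.
  have eq : 2 * pi * Im z = 2 * pi * (Im z - k%:R) + 2 * pi * k%:R by rewrite -mulrDr subrK.
  have cl : clamp (2 * pi) = 2 * pi :> R by rewrite clamp_id// lexx ltW.
  split.
  - by rewrite /G cl eT [Im z * _]mulrC eq cisD cis_2pik mulr1.
  - rewrite /G cl T_opp// eT ImN mulNr [Im z * _]mulrC eq opprD cisD.
    by rewrite cis_N2pik mulr1.
  - rewrite normrM gtr0_norm//; apply: le_trans rho1; rewrite ler_pM2l//.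
    by apply: le_trans h; have := Re_leN (z - z0); rewrite ReB.
  - rewrite !exprMn -mulrDr; congr (_ * _).
    by rewrite N_sqr ReB ImB.
have NeE (p q : R) : `|p| <= 1 -> N ((expR p)%:C * cis q) <= expR 1.
  move=> h; rewrite NM N_cis mulr1 NC ger0_norm ?expR_ge0// ler_expR.
  exact: le_trans (ler_norm _) h.
have close z : N (z - z0) <= rho -> N ((Y z).1.1 (2 * pi) + (Y z).2.2 (2 * pi) -
    (G z s (2 * pi) + G (- z) (opps s) (2 * pi))) <= m1 / 4.
  move=> h; have [h1 h2 [e1 e2] [e3 e4]] := hY z.
  have ReB' : `|Re z| <= B.
    have := le_trans (Re_leN _) h; rewrite ReB /= => h3.
    have := ler_normD (Re z - c) c; rewrite subrK /B; lra.
  apply: le_trans (trace_highfreq hs ReB' hM h1 h2 e1 e2 e3 e4) _.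
  have [p [q [-> -> p1 _]]] := hz z h.
  have n1 := NeE _ q p1; have n2 : N ((expR (- p))%:C * cis (- q)) <= expR 1.
    by apply: NeE; rewrite normrN.
  apply: (@le_trans _ _ (Qk B M * d * (expR 1 + expR 1))).
    apply: ler_pM.
    - by apply: mulr_ge0; [exact: ltW|exact: osc2_ge0].
    - by rewrite addr_ge0 ?N_ge0.
    - by rewrite ler_pM2l// hk.
    - exact: lerD.
  rewrite /d le_eqVlt; apply/orP; left; apply/eqP.
  have := gt_eqF (expR_gt0 (1 : R)); have := gt_eqF Q0.
  by move: (expR 1) (Qk B M) => e Q /negbT ? /negbT ?; field; apply/andP.
have [z zr Fz] : exists2 z, N (z - z0) <= rho & (Y z).1.1 (2 * pi) + (Y z).2.2 (2 * pi) - 2 = 0.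
  apply: (@trace_hurwitz _ s M Y z0 rho (m1 / 2) hs hM hY rho0).
    move=> z zr; have zr' : N (z - z0) <= rho by rewrite zr.
    have [p [q [e1 e2 p1 pq]]] := hz z zr'; rewrite zr in pq.
    have := close z zr'; rewrite e1 e2; set E := _ * cis q; set E' := _ * cis _ => h.
    have EE : E * E' = 1.
      by rewrite /E /E' mulrACA -CM -cisD expRxMexpNx_1 addrN cis0 mulr1.
    have h2 : E + E' - 2 = (E - 1) ^+ 2 * E'.
      transitivity ((E * E') * E - 2 * (E * E') + E'); last by ring.
      rewrite EE; ring.
    have h3 : m1 <= N (E + E' - 2).
      rewrite h2 NM NX; apply: ler_pM; rewrite ?exprn_ge0 ?expR_ge0 ?(ltW m0)//.
        by rewrite ler_pXn2r ?nnegrE ?N_ge0 ?(ltW m0)//; exact: hm.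
      rewrite NM N_cis mulr1 NC ger0_norm ?expR_ge0// ler_expR.
      by move: p1; rewrite ler_norml => /andP[_]; lra.
    set A := (Y z).1.1 _ + _ in h *.
    have := leND (A - 2) (- (A - (E + E'))).
    rewrite NN (_ : A - 2 - (A - (E + E')) = E + E' - 2); last by ring.
    by lra.
  have z00 : N (z0 - z0) <= rho by rewrite subrr N0 ltW.
  have [p [q [e1 e2 _ pq]]] := hz z0 z00; move: pq; rewrite subrr N0 mulr0 expr0n /= => pq.
  have p0 : p = 0 by apply/eqP; rewrite -sqrf_eq0 eq_le sqr_ge0 andbT; have := sqr_ge0 q; lra.
  have q0 : q = 0 by apply/eqP; rewrite -sqrf_eq0 eq_le sqr_ge0 andbT; have := sqr_ge0 p; lra.
  have := close z0 z00; rewrite e1 e2 p0 q0 oppr0 expR0 cis0 mulr1.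
  by rewrite (_ : (1 + 1 : R[i]) = 2)//; lra.
exists z; have h1 := le_trans (Re_leN _) zr; have h2 := le_trans (Im_leN _) zr.
move: h1 h2; rewrite ReB ImB /= !ler_norml => /andP[h1 _] /andP[h2 _].
have kK' : K%:R + 1 <= k%:R :> R by rewrite -[1]/(1%:R) -natrD ler_nat.
have r1 : 4 * rho <= 1.
  by apply: le_trans rho1; rewrite ler_pM2r//; have := pi_ge2 R; lra.
have K0 := ler0n R K.
split; [|by rewrite -/c; lra|by lra].
apply: (trace_eig hs (hY z)) => //; apply/negP => /eqP z00.
by move: h2; rewrite z00 /=; lra.
Qed.

End EigExists.

(** * Completeness of the trigonometric system *)

Section TrigDense.
Variable R : realType.
Implicit Types (h psi : R -> R).

Lemma norm_J (f : R -> R) : rint f -> `|J f| <= J (fun x => `|f x|).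
Proof.
move=> hf; have hn := rint_norm hf; rewrite ler_norml -JN//.
apply/andP; split; apply: le_J => //; first exact: rintN.
  by move=> x _; rewrite lerNl -normrN ler_norm.
by move=> x _; exact: ler_norm.
Qed.

Lemma bernoulli_ge (x : R) n : -1 <= x -> 1 + n%:R * x <= (1 + x) ^+ n.
Proof.
move=> x1; have x0 : 0 <= 1 + x by lra.
elim: n => [|n IH]; first by rewrite mul0r addr0 expr0.
rewrite exprS; apply: le_trans (ler_wpM2l x0 IH).
by rewrite -natr1; have := ler0n R n; have := sqr_ge0 x; nra.
Qed.

(** Pair [1 - t^n] with [1 + t^n] and use Bernoulli's inequality. The exponent [2 ^ n] turns [t^n]
    into [(2 t)^n], which places the threshold at 1/2. *)
Lemma step_le (t : R) n : 0 <= t <= 1 -> (1 - t ^+ n) ^+ (2 ^ n) * (1 + (2 * t) ^+ n) <= 1.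
Proof.
move=> /andP[t0 t1]; have tn0 : 0 <= t ^+ n by rewrite exprn_ge0.
have tn1 : t ^+ n <= 1 by rewrite exprn_ile1.
have h : 1 + (2 * t) ^+ n <= (1 + t ^+ n) ^+ (2 ^ n).
  by apply: le_trans (bernoulli_ge _ _); [rewrite exprMn natrX|lra].
have h0 : 0 <= (1 - t ^+ n) ^+ (2 ^ n) by rewrite exprn_ge0// subr_ge0.
apply: (le_trans (ler_wpM2l h0 h)).
rewrite -exprMn; apply: exprn_ile1; have := sqr_ge0 (t ^+ n); nra.
Qed.

Lemma step_ge (t : R) n : 0 <= t <= 1 -> 1 - (1 - t ^+ n) ^+ (2 ^ n) <= (2 * t) ^+ n.
Proof.
move=> /andP[t0 t1]; have tn1 : t ^+ n <= 1 by rewrite exprn_ile1.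
have := @bernoulli_ge (- t ^+ n) (2 ^ n); rewrite exprMn natrX.
by move=> /(_ _)/le_trans h; rewrite lerBlDr -lerBlDl; apply: le_trans (h _ _ _) => //; lra.
Qed.

(* Tends to the indicator of [t > 1/2] on [0, 1], as in Brosowski and Deutsch's
   proof of the Stone-Weierstrass theorem. *)
Definition step (t : R) n := 1 - (1 - t ^+ n) ^+ (2 ^ n).

Lemma step_itv t n : 0 <= t <= 1 -> 0 <= step t n <= 1.
Proof.
move=> /andP[t0 t1]; have tn0 : 0 <= t ^+ n by rewrite exprn_ge0.
have tn1 : t ^+ n <= 1 by rewrite exprn_ile1.
rewrite /step subr_ge0 gerBl exprn_ge0 ?subr_ge0// andbT.
by rewrite exprn_ile1 ?subr_ge0// gerBl.
Qed.

Lemma step_gt t : 1 / 2 < t <= 1 -> to0 (fun n => step t n - 1).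
Proof.
move=> /andP[t0 t1]; pose d := 2 * t - 1.
have d0 : 0 < d by rewrite /d; lra.
apply: (to0_le _ (to0Z d^-1 (@to0_invS R))) => n.
have tI : 0 <= t <= 1 by apply/andP; split; lra.
have /andP[s0 s1] := step_itv n tI; rewrite ler0_norm ?subr_le0// opprB.
have := step_le n tI; rewrite /step opprB addrCA subrr addr0; set a := _ ^+ (2 ^ n) => h.
have a0 : 0 <= a by move: s1; rewrite /step -/a gerBl.
have h2 : 1 + n%:R * d <= (2 * t) ^+ n.
  by rewrite (_ : 2 * t = 1 + d) ?bernoulli_ge//; rewrite /d; lra.
rewrite -invfM -[leRHS]mul1r ler_pdivlMr ?mulr_gt0//.
apply: le_trans h; rewrite ler_wpM2l//.
have d1 : d <= 1 by rewrite /d; lra.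
by rewrite -natr1 mulrDr mulr1 mulrC; lra.
Qed.

Lemma step_lt t : 0 <= t < 1 / 2 -> to0 (fun n => step t n - 0).
Proof.
move=> /andP[t0 t1]; have tI : 0 <= t <= 1 by apply/andP; split; lra.
apply: (@to0_le _ _ (fun n => (2 * t) ^+ n)).
  by move=> n; rewrite subr0 ger0_norm; [exact: step_ge|case/andP: (step_itv n tI)].
apply: cvg_expr; rewrite ger0_norm; lra.
Qed.

Lemma rbm_cos (k c : R) : rbm (fun x => cos (k * x + c)).
Proof.
split; last by exists 1 => x; exact: cos_max.
apply: rmeas_continuous => x; apply: continuous_comp; last exact: continuous_cos.
by apply: cvgD; [apply: cvgM; [exact: cvg_cst|exact: cvg_id]|exact: cvg_cst].
Qed.

Section Annihilate.
Variable h : R -> R.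
Hypothesis hi : rint h.
Hypothesis H : forall (k : int) c, J (fun x => h x * cos (k%:~R * x + c)) = 0.

(** Asking for orthogonality to all frequencies at once makes this class stable under multiplication
    by [a + b cos (x - m)], which shifts frequencies by one; it thus contains all polynomials in
    such functions. *)
Let V psi := rbm psi /\ forall (k : int) c, J (fun x => h x * (psi x * cos (k%:~R * x + c))) = 0.

Let rint_h psi : rbm psi -> rint (fun x => h x * psi x).
Proof. by move=> hp; have := rint_rbmM hp hi; congr rint; apply/funext => x; rewrite mulrC. Qed.

Let V1 : V (fun=> 1).
Proof. by split; [exact: rbm_cst|move=> k c; rewrite -(H k c); congr J; apply/funext => x; rewrite mul1r]. Qed.

Let V_affine a b m psi : V psi -> V (fun x => (a + b * cos (x - m)) * psi x).
Proof.
move=> [bp Vp]; have bc : rbm (fun x => cos (x - m)).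
  by have := rbm_cos 1 (- m); congr rbm; apply/funext => x; rewrite mul1r.
split.
  by apply: rbmM => //; apply: rbmD; [exact: rbm_cst|apply: rbmM => //; exact: rbm_cst].
move=> k c; pose F (k : int) c x := h x * (psi x * cos (k%:~R * x + c)).
have iF k' c' : rint (F k' c') by apply: rint_h; apply: rbmM => //; exact: rbm_cos.
have -> : (fun x => h x * ((a + b * cos (x - m)) * psi x * cos (k%:~R * x + c))) =
   (fun x => a * F k c x + (b / 2 * F (k + 1) (c - m) x + b / 2 * F (k - 1) (c + m) x)).
  apply/funext => x; rewrite /F intrD intrB.
  rewrite (_ : (k%:~R + 1%:~R) * x + (c - m) = (k%:~R * x + c) + (x - m)); last by ring.
  rewrite (_ : (k%:~R - 1%:~R) * x + (c + m) = (k%:~R * x + c) - (x - m)); last by ring.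
  by move: (_ + c) (x - m) => u v; rewrite cosB cosD; field.
rewrite JD; [|exact: rintZ|by apply: rintD; exact: rintZ].
by rewrite JD ?JZ ?(Vp : forall k c, J (F k c) = 0) ?mulr0 ?addr0//; exact: rintZ.
Qed.

Let V_sub psi psi' : V psi -> V psi' -> V (fun x => psi x - psi' x).
Proof.
move=> [b1 V1'] [b2 V2]; split.
  by apply: rbmD => //; case: b2 => m2 [K hK]; split; [exact: rmeasN|exists K => x; rewrite normrN].
move=> k c.
rewrite (_ : (fun x => _) = (fun x => h x * (psi x * cos (k%:~R * x + c)) -
   h x * (psi' x * cos (k%:~R * x + c)))); last by apply/funext => x; ring.
by rewrite JB ?V1' ?V2 ?subrr//; apply: rint_h; apply: rbmM => //; exact: rbm_cos.
Qed.

(** The argument of [step] equals [1 / 2 + (cos (x - r) - cos r) / 4]. It stays in [[0, 1]] and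
    crosses 1/2 exactly at 0 and [2 r] modulo the period. *)
Let V_step r n : V (fun x => step ((2 - cos r) / 4 + 1 / 4 * cos (x - r)) n).
Proof.
pose t x := (2 - cos r) / 4 + 1 / 4 * cos (x - r).
have Vt m psi : V psi -> V (fun x => t x ^+ m * psi x).
  move=> Vp; elim: m => [|m IH].
    by rewrite (_ : (fun x => _) = psi)//; apply/funext => x; rewrite expr0 mul1r.
  rewrite (_ : (fun x => _) = (fun x => t x * (t x ^+ m * psi x))); first exact: V_affine.
  by apply/funext => x; rewrite exprS mulrA.
have Vs m : V (fun x => (1 - t x ^+ n) ^+ m).
  elim: m => [|m IH].
    by rewrite (_ : (fun x => _) = (fun=> 1))//; apply/funext => x; rewrite expr0.
  rewrite (_ : (fun x => _) = (fun x => (1 - t x ^+ n) ^+ m - t x ^+ n * (1 - t x ^+ n) ^+ m)).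
    by apply: V_sub => //; exact: Vt.
  by apply/funext => x; rewrite exprS mulrBl mul1r.
exact: V_sub.
Qed.

(** At [x = X] the argument of [step] is exactly 1/2, where the limit is neither 0 nor 1, while
    [J_dct] asks for convergence at every interior point; this factor removes that point. *)
Let e (X x : R) : R := 1 - \1_([set X]) x.

(** With [r = X / 2] the steps converge to the indicator of [[0, X]], so the primitive of [h]
    vanishes at every [X]. *)
Lemma trig_dense : {ae torus R, forall x, h x = 0}.
Proof.
apply: Pr_eq0 => // X /andP[X0 X2].
have [->|X0'] := eqVneq X 0; first exact: Pr_0.
have {X0'}{}X0 : 0 < X by rewrite lt_def X0'.
have be : rbm (e X).
  split; last first.
    by exists 1 => x; rewrite /e indicE; case: (_ \in _); rewrite /= ?subrr ?subr0 ?normr0 ?normr1.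
  apply: rmeasB; first exact: rmeas_cst.
  by apply: measurable_indic; exact: measurable_set1.
have eae (g : R -> R) : {ae torus R, forall x, e X x * g x = g x}.
  exists [set X]; split; [exact: measurable_set1|exact: torus_set1|].
  by move=> x /=; apply: contra_notP => xX; rewrite /e indicE memNset// subr0 mul1r.
pose r := X / 2.
pose t x := (2 - cos r) / 4 + 1 / 4 * cos (x - r).
have tI x : 0 <= t x <= 1.
  have := cos_max r; have := cos_max (x - r); rewrite !ler_norml => /andP[? ?] /andP[? ?].
  by rewrite /t; apply/andP; split; lra.
pose f n x := h x * (e X x * step (t x) n).
have bst n : rbm (fun x => step (t x) n) by case: (V_step r n).
have f0 n : J (f n) = 0.
  have [_ /(_ 0 0) <-] := V_step r n.
  apply: J_ae; [exact: rint_meas (rint_h (rbmM be (bst n)))| |].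
    by apply: rint_meas; apply: rint_h; apply: rbmM; [exact: bst|exact: rbm_cos].
  apply/ae_eqP; move: (eae (fun x => h x * step (t x) n)); apply: aeS => x.
  by rewrite /f mulrCA => ->; rewrite mul0r addr0 cos0 mulr1.
have pi0 := pi_gt0 R.
have cl x : 0 < x < 2 * pi -> x != X -> to0 (fun n => step (t x) n - ind X x).
  move=> /andP[x0 x2] xX; rewrite /ind.
  have cosxr : cos (x - r) = cos `|x - r| by have [?|?] := ger0P (x - r); rewrite ?cosN.
  have rpi : 0 <= r <= pi by rewrite /r; apply/andP; split; lra.
  have [xltX|Xltx|] := ltgtP x X; last by move/eqP: xX.
    apply: step_gt; rewrite (andP (tI x)).2 andbT.
    have : cos r < cos (x - r).
      have a : `|x - r| < r by rewrite ltr_norml /r; apply/andP; split; lra.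
      have api : 0 <= `|x - r| <= pi by rewrite normr_ge0 (le_trans (ltW a))//; case/andP: rpi.
      by rewrite cosxr ltr_cos// in_itv.
    by rewrite /t; lra.
  apply: step_lt; rewrite (andP (tI x)).1 /=.
  have : cos (x - r) < cos r.
    have a : 0 <= x - r by rewrite /r; lra.
    have [xr|xr] := leP (x - r) pi.
      have xrI : 0 <= x - r <= pi by rewrite a.
      by rewrite ltr_cos ?in_itv//; rewrite /r; lra.
    rewrite -[cos (x - r)]cosN -cosD2pi mulr2n.
    have yI : 0 <= - (x - r) + (pi + pi) <= pi by rewrite /r in xr *; apply/andP; split; lra.
    by rewrite ltr_cos ?in_itv//; rewrite /r in xr *; lra.
  by rewrite /t; lra.
have D := @J_dct R f (fun x => h x * (e X x * ind X x)) (fun x => `|h x|).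
have : to0 (fun n => J (fun x => `|f n x - h x * (e X x * ind X x)|)).
  apply: D.
  - by move=> n; apply: rint_meas; apply: rint_h; exact: rbmM.
  - by apply: rint_meas; apply: rint_h; apply: rbmM => //; exact: rbm_ind.
  - exact: rint_norm.
  - move=> n x; rewrite /f normrM ler_piMr// /e indicE.
    have /andP[s0 s1] := step_itv n (tI x).
    by case: (_ \in _); rewrite /= ?subrr ?mul0r ?normr0// subr0 mul1r ger0_norm.
  - move=> x hx; have [->|xX] := eqVneq x X.
      rewrite (_ : (fun n => _) = fun=> 0); first exact: cvg_cst.
      by apply/funext => n; rewrite /f /e indicE mem_set// subrr !mul0r !mulr0 subr0.
    have := to0Z (h x) (cl x hx xX); congr to0; apply/funext => n.
    by rewrite /f /e indicE memNset ?subr0 ?mul1r ?mulrBr//; exact/eqP.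
move=> L.
have L0 : J (fun x => h x * (e X x * ind X x)) = 0.
  apply/eqP; rewrite -normr_le0; apply: (to0_le_cst L) => n.
  have i1 : rint (f n) by apply: rint_h; exact: rbmM.
  have i2 : rint (fun x => h x * (e X x * ind X x)).
    by apply: rint_h; apply: rbmM => //; exact: rbm_ind.
  rewrite -normrN -[X in `|X|]add0r -(f0 n) -JB//; apply: norm_J; exact: rintB.
rewrite -L0; apply: J_ae.
- by apply: rint_meas; exact: rint_ind.
- by apply: rint_meas; apply: rint_h; apply: rbmM => //; exact: rbm_ind.
- apply/ae_eqP; move: (eae (fun x => h x * ind X x)); apply: aeS => x.
  by rewrite mulrCA => ->; rewrite mulrC.
Qed.

End Annihilate.
End TrigDense.

(** * Square-integrable functions and weak derivatives *)

Section L2facts.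
Variable R : realType.
Let mu := torus R.
Implicit Types (f g : R -> R[i]).

Lemma torus_gt0 : (0 < mu setT)%E.
Proof. by rewrite torus_setT lte_fin twopi_gt0. Qed.

Lemma Lnorm_oo_le (h : R -> R) K : 0 <= K -> {ae mu, forall x, `|h x| <= K} ->
  ('N[mu]_(+oo)[EFin \o h] <= K%:E)%E.
Proof.
move=> K0 hK; rewrite unlock /=; case: ifP => // _.
by apply/ess_supP; apply: aeS hK => x /= h1; rewrite lee_fin.
Qed.

Lemma rbm_Lfun_oo h : rbm h -> h \in Lfun mu +oo%E.
Proof.
move=> [mh [K hK]]; have K0 : 0 <= K := le_trans (normr_ge0 _) (hK 0).
rewrite inE; apply/andP; split; rewrite inE//=.
rewrite /finite_norm (le_lt_trans (@Lnorm_oo_le _ K K0 _)) ?ltry//.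
by apply: ae_torus => x _.
Qed.

Lemma Lfun_oo_bounded h : h \in Lfun mu +oo%E ->
  rmeas h /\ exists2 K, 0 <= K & {ae mu, forall x, `|h x| <= K}.
Proof.
rewrite inE => /andP[]; rewrite !inE /= /finite_norm unlock torus_gt0 => mh hfin; split => //.
have [M hM] := @ess_supr_bounded _ _ _ mu (fun x => `|h x|) hfin.
exists (Num.max 0 M); first by rewrite le_max lexx.
by apply: aeS hM => x h1; rewrite le_max h1 orbT.
Qed.

Lemma Lfun2P h : h \in Lfun mu 2%:E <-> rmeas h /\ rint (fun x => h x ^+ 2).
Proof.
split=> [h2|[mh ih]].
  split; last exact: Lfun2_integrable_sqr.
  by move: h2; rewrite inE => /andP[]; rewrite inE.
rewrite inE; apply/andP; split; rewrite inE//= /finite_norm unlock poweR_lty//.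
have /integrableP[_] := ih; apply: le_lt_trans; rewrite le_eqVlt; apply/orP; left; apply/eqP.
by apply: eq_integral => x _ /=; rewrite normrX powR_mulrn.
Qed.

Lemma L2P f : L2 f <-> cmeas f /\ rint (fun x => N (f x) ^+ 2).
Proof.
have E x : N (f x) ^+ 2 = Re (f x) ^+ 2 + Im (f x) ^+ 2 by exact: N_sqr.
split=> [[/Lfun2P[m1 i1] /Lfun2P[m2 i2]]|[[m1 m2] i]].
  by split => //; under eq_fun do rewrite E; exact: rintD.
have le1 x : `|Re (f x) ^+ 2| <= N (f x) ^+ 2 by rewrite E ger0_norm ?sqr_ge0// lerDl sqr_ge0.
have le2 x : `|Im (f x) ^+ 2| <= N (f x) ^+ 2 by rewrite E ger0_norm ?sqr_ge0// lerDr sqr_ge0.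
split; apply/Lfun2P; split => //; [apply: rint_le le1 i|apply: rint_le le2 i];
  by under eq_fun do rewrite expr2; exact: rmeasM.
Qed.

Lemma L2_cint f : L2 f -> cint f.
Proof.
move=> /L2P[mf i]; apply: (cint_le mf (rintD (rint_cst 1) i)) => x.
by have := sqr_ge0 (N (f x) - 1); have := N_ge0 (f x); move: (N (f x)) => a; nra.
Qed.

Lemma L2D f g : L2 f -> L2 g -> L2 (fun x => f x + g x).
Proof.
move=> /L2P[mf hf] /L2P[mg hg]; apply/L2P; split; first exact: cmeasD.
have h := rintD (rintZ 2 hf) (rintZ 2 hg); apply: rint_le h.
  by under eq_fun do rewrite expr2; apply: rmeasM; apply: cmeas_N; exact: cmeasD.
move=> x; rewrite ger0_norm ?sqr_ge0//.
have := leND (f x) (g x); have := N_ge0 (f x + g x).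
move: (N (f x)) (N (g x)) (N (f x + g x)) => a b c c0 h1.
have : c ^+ 2 <= (a + b) ^+ 2 by rewrite ler_pXn2r ?nnegrE//; exact: le_trans c0 h1.
by have := sqr_ge0 (a - b); nra.
Qed.

Lemma L2M f g : bm f -> L2 g -> L2 (fun x => f x * g x).
Proof.
move=> bf /L2P[mg hg]; apply/L2P; split; first by apply: cmeasM => //; case: bf.
have bN := bm_rbmN bf; have := rint_rbmM (rbmM bN bN) hg; congr rint.
by apply/funext => x; rewrite NM exprMn expr2.
Qed.

Lemma bm_L2 f : bm f -> L2 f.
Proof.
move=> bf; apply/L2P; split; first by case: bf.
by have bN := bm_rbmN bf; apply: rbm_rint; exact: rbmM.
Qed.

Lemma L2N f : L2 f -> L2 (fun x => - f x).
Proof. by move=> /(L2M (bm_cst (-1))); congr L2; apply/funext => x; rewrite mulN1r. Qed.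
Lemma L2B f g : L2 f -> L2 g -> L2 (fun x => f x - g x).
Proof. by move=> hf hg; exact: L2D (L2N hg). Qed.
Lemma L2Z c f : L2 f -> L2 (fun x => c * f x).
Proof. by apply: L2M; exact: bm_cst. Qed.

Lemma L2_mul f g : L2 f -> L2 g -> cint (fun x => f x * g x).
Proof.
move=> /L2P[mf hf] /L2P[mg hg]; apply: (cint_le _ (rintD hf hg)); first exact: cmeasM.
move=> x; rewrite NM; have := sqr_ge0 (N (f x) - N (g x)); have := N_ge0 (f x); have := N_ge0 (g x).
by move: (N (f x)) (N (g x)) => a b; nra.
Qed.

End L2facts.

Section Weak.
Variable R : realType.
Let mu := torus R.
Implicit Types (f g F : R -> R[i]).

(** Differentiation as a phase shift: the family [cos (k x + c)] is then closed under derivatives,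
    and it contains the sines. *)
Lemma isd_cos (k c x : R) :
  is_derive x 1 (fun x => cos (k * x + c)) (k * cos (k * x + c + pi / 2)).
Proof.
have h := isdD (isdZ k (isd_id x)) (isd_cst c x).
apply: is_derive_eq (isd_comp (is_derive_cos _) h) _.
by rewrite mulr1 addr0 cosDpihalf mulrC.
Qed.

Lemma derive1_cos (k c : R) :
  derive1 (fun x => cos (k * x + c)) = fun x => k * cos (k * x + c + pi / 2).
Proof. by apply/funext => x; rewrite derive1E; have h := isd_cos k c x; exact: derive_val. Qed.

Lemma derive1n_cos (k c : R) n :
  derive1n n (fun x => cos (k * x + c)) = fun x => k ^+ n * cos (k * x + (c + n%:R * (pi / 2))).
Proof.
elim: n => [|n IH]; first by apply/funext => x; rewrite expr0 mul1r mul0r addr0.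
rewrite derive1nS IH; apply/funext => x; rewrite derive1E.
have h := isdZ (k ^+ n) (isd_cos k (c + n%:R * (pi / 2)) x).
rewrite (@derive_val _ _ _ _ _ _ _ h) mulrA -exprSr -natr1.
by move: (pi / 2) => q; congr (_ * cos _); ring.
Qed.

Lemma smooth_periodic_cos (k : int) (c : R) : smooth_periodic (fun x => cos (k%:~R * x + c)).
Proof.
split.
  move=> n x; rewrite derive1n_cos.
  by have h := isdZ (k%:~R ^+ n) (isd_cos k%:~R (c + n%:R * (pi / 2)) x); exact: ex_derive.
move=> x.
have E n (y : R) : cos (y + 2 * pi * n%:R) = cos y.
  have /(congr1 (@complex.Re R)) := cisD y (2 * pi * n%:R); rewrite cis_2pik mulr1.
  by [].
case: k => n.
  by rewrite -[RHS](E n) -pmulrn; congr cos; move: (pi : R) => q; ring.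
rewrite NegzE -[LHS](E n.+1); congr cos; rewrite mulrNz -pmulrn.
by move: (pi : R) => q; ring.
Qed.

Lemma prim_smooth (phi dphi : R -> R) : (forall x : R, is_derive x 1 phi (dphi x)) ->
  continuous dphi -> prim (fun x => (phi (clamp x))%:C) (fun x => (dphi x)%:C).
Proof.
move=> h c; have i := rint_continuous c.
apply: (@prim_real R (fun x => phi (clamp x))) => // x.
rewrite -(Pr_clamp x i) (Pr_FTC h c i (clamp_itv x)) [clamp 0]clamp_id ?lexx ?ltW ?twopi_gt0//.
by rewrite addrC subrK.
Qed.

Lemma smooth_derivative (phi : R -> R) : smooth_periodic phi ->
  (forall x : R, is_derive x 1 phi (derive1 phi x)) /\ continuous (derive1 phi).
Proof.
move=> [h _]; split => x.
  by apply: DeriveDef; [exact: (h 0)|rewrite derive1E].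
by apply: differentiable_continuous; apply/derivable1_diffP; exact: (h 1).
Qed.

Lemma prim_weak F g : prim F g -> F (2 * pi) = F 0 -> weak_derivative F g.
Proof.
move=> hF pF phi hphi; have [d c] := smooth_derivative hphi.
have hp := prim_smooth d c; have /prim_2pi := primM hF hp.
have cl0 : clamp 0 = 0 :> R by rewrite clamp_id// lexx ltW// twopi_gt0.
have cl2 : clamp (2 * pi) = 2 * pi :> R by rewrite clamp_id// lexx ltW// twopi_gt0.
have per : phi (2 * pi) = phi 0 by have [_ /(_ 0)] := hphi; rewrite add0r.
rewrite pF cl0 cl2 per -[X in X = _]addr0 => /addrI/esym.
have [cg _] := hF; have bF := prim_bm hF; have bp := prim_bm hp.
have [cd _] := hp.
have i1 := cint_Mbm cg bp; have i2 := cint_bmM bF cd.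
rewrite cintegralD// addrC => /eqP; rewrite addr_eq0 => /eqP ->; congr (- _).
apply: eq_cintegral; first exact: cint_meas.
  apply: cmeasM; first exact: cint_meas.
  apply: cmeasC; apply: rmeas_continuous.
  exact: isd_continuous d.
by move=> x /andP[x0 x1]; rewrite clamp_id// x0 ltW.
Qed.

Lemma ctrig_dense h : cint h ->
  (forall (k : int) c, cintegral (fun x => h x * (cos (k%:~R * x + c))%:C) = 0) ->
  {ae mu, forall x, h x = 0}.
Proof.
move=> [ch1 ch2] H.
have reH : {ae mu, forall x, Re (h x) = 0}.
  apply: trig_dense => // k c; have := H k c; rewrite cintegralE => -[+ _].
  by congr (_ = _); congr J; apply/funext => x; rewrite ReM ImC mulr0 subr0.
have imH : {ae mu, forall x, Im (h x) = 0}.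
  apply: trig_dense => // k c; have := H k c; rewrite cintegralE => -[_ +].
  by congr (_ = _); congr J; apply/funext => x; rewrite ImM ImC mulr0 add0r.
by apply: aeS (aeI reH imH) => x [e1 e2]; exact: ceqP.
Qed.

(** [state_eq] only sees classes modulo null sets, while the arguments on initial values need [F] at
    points such as 0; this lemma passes from one to the other. *)
Lemma prim_ae0 F g : prim F g -> F (2 * pi) = F 0 -> {ae mu, forall x, F x = 0} ->
  (forall x, F x = 0) /\ {ae mu, forall x, g x = 0}.
Proof.
move=> hF pF F0; have [cg E] := hF; have bF := prim_bm hF.
have g0 : {ae mu, forall x, g x = 0}.
  apply: ctrig_dense => // k c.
  have := prim_weak hF pF (smooth_periodic_cos k c); rewrite derive1_cos.
  rewrite (@cintegral_ae _ _ (fun=> 0)).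
  - by rewrite cintegral_cst mulr0 => /esym/eqP; rewrite oppr_eq0 => /eqP.
  - apply: cmeasM; first by case: bF.
    by apply: cmeasC; apply: rmeasM; [exact: rmeas_cst|case: (rbm_cos k%:~R (c + pi / 2)) => + _;
      congr rmeas; apply/funext => x; rewrite addrA].
  - exact: cmeas_cst.
  - by apply/ae_eqP; apply: aeS F0 => x ->; rewrite mul0r.
have Fc x : F x = F 0.
  apply: (@prim0 R); split; first exact: bm_cint (bm_cst 0).
  by move=> y; rewrite E; congr (_ + _); apply: P_ae; [exact: cint_meas|exact: cmeas_cst|exact/ae_eqP].
split => // x; rewrite Fc; apply: (mulfI (_ : (2 * pi)%:C != 0 :> R[i])).
  by rewrite -N_eq0 NC normr_eq0 gt_eqF// twopi_gt0.
rewrite mulr0 -[RHS](mulr0 ((2 * pi)%:C : R[i])) -!cintegral_cst; apply: cintegral_ae; try exact: cmeas_cst.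
by apply/ae_eqP; apply: aeS F0 => y; rewrite Fc.
Qed.

Lemma prim_ae F g g' : prim F g -> cint g' -> {ae mu, forall x, g x = g' x} -> prim F g'.
Proof.
move=> [cg E] cg' gg'; split => // x; rewrite E; congr (_ + _).
by apply: P_ae; [exact: cint_meas|exact: cint_meas|exact/ae_eqP].
Qed.

(** [P g] has the same weak derivative as [f], so their difference is orthogonal to all nonzero
    frequencies. Removing its mean [c0] makes it orthogonal to all of them. *)
Lemma weak_prim f g : cint f -> cint g -> weak_derivative f g ->
  exists F, [/\ prim F g, F (2 * pi) = F 0 & f = F %[ae mu]].
Proof.
move=> cf cg w.
have tst f' g' (k : int) (c : R) : weak_derivative f' g' -> cint f' ->
    k%:~R%:C * cintegral (fun x => f' x * (cos (k%:~R * x + c))%:C) =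
    - cintegral (fun x => g' x * (cos (k%:~R * x + (c - pi / 2)))%:C).
  move=> w' cf'; rewrite -(w' _ (smooth_periodic_cos k (c - pi / 2))) derive1_cos -cintegralZ.
    by congr cintegral; apply/funext => x; rewrite -addrA subrK [in RHS]CM mulrCA.
  by apply: cint_Mbm => //; apply: bmC; exact: rbm_cos.
have bc (k c : R) : bm (fun x => (cos (k * x + c))%:C) by apply: bmC; exact: rbm_cos.
(* Frequency zero tests against the constant 1; the mean of [g] vanishes, and [P g] is periodic. *)
have g0 : cintegral g = 0.
  have := tst f g 0 (pi / 2) w cf; rewrite mul0r => /esym/eqP; rewrite oppr_eq0 => /eqP <-.
  by congr cintegral; apply/funext => x; rewrite mul0r subrr addr0 cos0 mulr1.
have hP : prim (P g) g by split => // x; rewrite P_0// add0r.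
have wP : weak_derivative (P g) g by apply: prim_weak => //; rewrite P_2pi// g0 P_0.
have w1 : weak_derivative (fun=> 1 : R[i]) (fun=> 0) by apply: prim_weak => //; exact: prim_cst.
have bP := prim_bm hP; pose c0 := cintegral (fun x => f x - P g x) / (2 * pi)%:C.
pose h x := f x - P g x - c0.
have ch : cint h by apply: cintB; [apply: cintB => //; exact: bm_cint|exact: bm_cint (bm_cst c0)].
have H (k : int) c : cintegral (fun x => h x * (cos (k%:~R * x + c))%:C) = 0.
  have [->|k0] := eqVneq k 0.
    rewrite (_ : (fun x => _) = fun x => (cos c)%:C * h x); last first.
      by apply/funext => x; rewrite mul0r add0r mulrC.
    rewrite cintegralZ// cintegralB ?cintegral_cst//; last 2 first.
    - by apply: cintB => //; exact: bm_cint.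
    - exact: bm_cint (bm_cst c0).
    rewrite /c0 [(2 * pi)%:C * _]mulrC divfK ?subrr ?mulr0//.
    by rewrite -N_eq0 NC normr_eq0 gt_eqF// twopi_gt0.
  have kk : (k%:~R)%:C != 0 :> R[i] by rewrite -N_eq0 NC normr_eq0 intr_eq0.
  have e1 := tst _ _ k c w cf; have e2 := tst _ _ k c wP (bm_cint bP).
  have e3 := tst _ _ k c w1 (bm_cint (bm_cst 1)).
  have i1 := cint_Mbm cf (bc k%:~R c); have i2 := cint_Mbm (bm_cint bP) (bc k%:~R c).
  have i3 := cint_Mbm (bm_cint (bm_cst 1)) (bc k%:~R c).
  apply: (mulfI kk); rewrite mulr0.
  rewrite (_ : (fun x => _) = fun x => (f x * (cos (k%:~R * x + c))%:C -
     P g x * (cos (k%:~R * x + c))%:C) - c0 * (1 * (cos (k%:~R * x + c))%:C)); last first.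
    by apply/funext => x; rewrite /h; ring.
  rewrite cintegralB ?(cintegralZ c0) ?cintegralB ?mulrBr ?e1 ?e2 ?subrr ?sub0r//; last 2 first.
  - exact: cintB.
  - exact: cintZ.
  rewrite mulrCA e3 (_ : (fun x => _) = fun=> 0); last by apply/funext => x; rewrite mul0r.
  by rewrite cintegral_cst mulr0 oppr0 mulr0 oppr0.
have h0 := ctrig_dense ch H.
exists (fun x => c0 + P g x); split; [exact: prim_P|by rewrite P_2pi// P_0// g0|].
apply/ae_eqP; apply: aeS h0 => x /eqP.
by rewrite /h subr_eq0 subr_eq addrC => /eqP; rewrite addrC.
Qed.

End Weak.

(** * The resolvent, and the spectrum as a set of eigenvalues *)

Section Resolvent.
Variable R : realType.
Let mu := torus R.
Implicit Types (s : R -> R) (z : R[i]) (j r f g : R -> R[i]).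

(* [(z - A_s) (r, j) = (f1, f2)] on the torus. *)
Definition psol z s f1 f2 j r :=
  [/\ prim j (fun x => ca z x * r x + f1 x), prim r (fun x => cb z s x * j x + f2 x),
      j (2 * pi) = j 0, r (2 * pi) = r 0 & cintegral r = 0].

Lemma resolvent_psol s z (u f : state R) : rbm s -> resolvent_eq s z u f -> L2p f /\
  exists j r, psol z s f.1 f.2 j r /\ state_eq u (r, j).
Proof.
move=> hs [[u1 u2 ui] [h1 h2 hi] [dr [dj [ldr ldj w1 w2 [e1 e2]]]]].
rewrite /= in h1 h2 hi e1 e2.
have lf1 : L2 f.1.
  have := L2B (L2Z z u1) h1; congr L2; apply/funext => x; ring.
have lf2 : L2 f.2.
  have := L2B (L2Z z u2) h2; congr L2; apply/funext => x; ring.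
have cf1 := L2_cint lf1; have cf2 := L2_cint lf2.
have cu1 := L2_cint u1; have cu2 := L2_cint u2.
split.
  split => //; move: hi; rewrite cintegralB ?cintegralZ ?ui ?mulr0 ?sub0r//; last exact: cintZ.
  by move/eqP; rewrite oppr_eq0 => /eqP.
have [r [hr pr er]] := weak_prim cu1 (L2_cint ldr) w1.
have [j [hj pj ej]] := weak_prim cu2 (L2_cint ldj) w2.
have bj := prim_bm hj; have br := prim_bm hr.
move/ae_eqP: er => er; move/ae_eqP: ej => ej; move/ae_eqP: e1 => e1; move/ae_eqP: e2 => e2.
exists j, r; split; last by split; apply/ae_eqP.
split => //.
- apply: (prim_ae hj).
    by apply: cintD => //; apply: bm_cint; apply: bmM => //; exact: bm_ca.
  apply: aeS (aeI e1 er) => x [a b]; rewrite -[dj x]opprK -a b /ca; ring.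
- apply: (prim_ae hr).
    by apply: cintD => //; apply: bm_cint; apply: bmM => //; exact: bm_cb.
  apply: aeS (aeI e2 ej) => x [a b]; rewrite b in a.
  have -> : dr x = - (- dr x - (s x)%:C * j x) - (s x)%:C * j x by ring.
  rewrite -a /cb; ring.
- rewrite -ui; apply: cintegral_ae; [by case: br|exact: cint_meas|].
  by apply/ae_eqP; apply: aeS er => x ->.
Qed.

Lemma psol_resolvent s z (f : state R) j r : rbm s -> L2p f -> psol z s f.1 f.2 j r ->
  resolvent_eq s z (r, j) f.
Proof.
move=> hs [lf1 lf2 fi] [hj hr pj pr ri].
have bj := prim_bm hj; have br := prim_bm hr.
have lj := bm_L2 bj; have lr := bm_L2 br.
split; [by split|split => /=|].
- by apply: L2B => //; exact: L2Z.
- by apply: L2B => //; exact: L2Z.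
- by rewrite cintegralB ?cintegralZ ?ri ?fi ?mulr0 ?subr0//; try apply: cintZ; exact: L2_cint.
exists (fun x => cb z s x * j x + f.2 x), (fun x => ca z x * r x + f.1 x); split.
- by apply: L2D => //; apply: L2M => //; exact: bm_cb.
- by apply: L2D => //; apply: L2M => //; exact: bm_ca.
- exact: prim_weak.
- exact: prim_weak.
- by split; apply/ae_eqP; apply: ae_torus => x _ /=; rewrite /ca /cb; ring.
Qed.

Lemma psol0 z s j r : rbm s -> psol z s (fun=> 0) (fun=> 0) j r <->
  [/\ Sol z s j r, j (2 * pi) = j 0, r (2 * pi) = r 0 & cintegral r = 0].
Proof.
move=> hs; split=> [[hj hr pj pr ri]|[[_ _ hj hr] pj pr ri]]; split => //.
- split; [exact: bm_ca|exact: bm_cb| |].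
    by apply: prim_eq hj _ => x; rewrite addr0.
  by apply: prim_eq hr _ => x; rewrite addr0.
- by apply: prim_eq hj _ => x; rewrite addr0.
- by apply: prim_eq hr _ => x; rewrite addr0.
Qed.

Lemma psol_lin z s f1 f2 j r g1 g2 j' r' c d :
  psol z s f1 f2 j r -> psol z s g1 g2 j' r' ->
  psol z s (fun x => c * f1 x + d * g1 x) (fun x => c * f2 x + d * g2 x)
    (fun x => c * j x + d * j' x) (fun x => c * r x + d * r' x).
Proof.
move=> [hj hr pj pr ri] [hj' hr' pj' pr' ri'].
split; rewrite ?pj ?pj' ?pr ?pr'//.
- by apply: prim_eq (primD (primZ c hj) (primZ d hj')) _ => x; ring.
- by apply: prim_eq (primD (primZ c hr) (primZ d hr')) _ => x; ring.
have br := bm_cint (prim_bm hr); have br' := bm_cint (prim_bm hr').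
by rewrite cintegralD ?cintegralZ ?ri ?ri' ?mulr0 ?addr0//; exact: cintZ.
Qed.

Lemma npeig0 s z j r : ~ peig s z -> Sol z s j r -> j (2 * pi) = j 0 -> r (2 * pi) = r 0 ->
  cintegral r = 0 -> j 0 = 0 /\ r 0 = 0.
Proof.
move=> np hS pj pr ri; apply: contrapT => H; apply: np; exists j, r; split => //; split => //.
apply/pair_neq0; have [j0|?] := eqVneq (j 0) 0; last by left.
by right; apply/negP => /eqP r0; apply: H.
Qed.

Lemma psol_unique s z f1 f2 j r j' r' : rbm s -> ~ peig s z ->
  psol z s f1 f2 j r -> psol z s f1 f2 j' r' -> forall x, j x = j' x /\ r x = r' x.
Proof.
move=> hs np h h'; have := psol_lin 1 (-1) h h'.
rewrite (_ : (fun x => 1 * f1 x + _) = fun=> 0); last by apply/funext => x; ring.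
rewrite (_ : (fun x => 1 * f2 x + _) = fun=> 0); last by apply/funext => x; ring.
move=> /(psol0 _ _ _ hs) [hS pj pr ri] x.
have [j0 r0] := npeig0 np hS pj pr ri.
have [h1 h2] := sol_eq0 hS j0 r0 x.
by split; apply/eqP; rewrite -subr_eq0 -mulN1r -[X in X + _]mul1r ?h1 ?h2.
Qed.

Lemma psol_nontrivial s z j r : rbm s -> Sol z s j r -> state_eq (r, j) (state0 R) ->
  j (2 * pi) = j 0 -> r (2 * pi) = r 0 -> N (j 0) + N (r 0) = 0.
Proof.
move=> hs [_ _ hj hr] [/ae_eqP e1 /ae_eqP e2] pj pr.
by have [-> _] := prim_ae0 hj pj e2; have [-> _] := prim_ae0 hr pr e1; rewrite N0 addr0.
Qed.

Lemma L2p0 : L2p (state0 R).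
Proof. by split; [exact: bm_L2 (bm_cst 0)|exact: bm_L2 (bm_cst 0)|rewrite cintegral_cst mulr0]. Qed.

Lemma generator_eig s z (f : state R) :
  generator s f (state_scale z f) <-> resolvent_eq s z f (state0 R).
Proof.
rewrite /resolvent_eq (_ : state_sub _ _ = state_scale z f)//.
by congr pair; apply/funext => x /=; rewrite subr0.
Qed.

Lemma eigenvalue_peig s z : rbm s -> Defs.eigenvalue s z <-> peig s z.
Proof.
move=> hs; split=> [[f /generator_eig hf nf]|[j [r [[hS pj pr nz] ri]]]].
  have [_ [j [r [/(psol0 _ _ _ hs) [hS pj pr ri] [e1 e2]]]]] := resolvent_psol hs hf.
  exists j, r; split => //; split => //; apply/pair_neq0.
  have [j0|?] := eqVneq (j 0) 0; last by left.
  right; apply/negP => /eqP r0; apply: nf; have h := sol_eq0 hS j0 r0.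
  split; apply/ae_eqP.
    by move/ae_eqP: e1; apply: aeS => x ->; case: (h x).
  by move/ae_eqP: e2; apply: aeS => x ->; case: (h x).
exists (r, j).
  apply/generator_eig; apply: psol_resolvent => //; first exact: L2p0.
  exact/psol0.
by move=> h; move: nz; rewrite (psol_nontrivial hs hS h pj pr) ltxx.
Qed.

Lemma peig_spectrum s z : rbm s -> peig s z -> spectrum s z.
Proof.
move=> hs [j [r [[hS pj pr nz] ri]]] [H _].
have h0 : resolvent_eq s z (r, j) (state0 R).
  by apply: psol_resolvent => //; [exact: L2p0|exact/psol0].
have h1 : resolvent_eq s z (state0 R) (state0 R).
  apply: psol_resolvent => //; first exact: L2p0.
  apply/psol0 => //; split; rewrite ?cintegral_cst ?mulr0//.
  by split; [exact: bm_ca|exact: bm_cb| |];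
    apply: prim_eq (prim_cst 0) _ => x; rewrite mulr0.
have [u _ U] := H _ L2p0.
have [a1 a2] := U _ h0; have [b1 b2] := U _ h1.
have : state_eq (r, j) (state0 R).
  split; apply/ae_eqP.
    by move/ae_eqP: a1 => a1; move/ae_eqP: b1 => b1; apply: aeS (aeI a1 b1) => x [-> <-].
  by move/ae_eqP: a2 => a2; move/ae_eqP: b2 => b2; apply: aeS (aeI a2 b2) => x [-> <-].
by move=> h; move: nz; rewrite (psol_nontrivial hs hS h pj pr) ltxx.
Qed.

Lemma lin2_kernel (K : fieldType) (a b c d : K) : a * d - b * c = 0 ->
  exists x y, [/\ x != 0 \/ y != 0, x * a + y * b = 0 & x * c + y * d = 0].
Proof.
move=> D; have [a0|a0] := eqVneq a 0; last first.
  exists b, (- a); split; [by right; rewrite oppr_eq0|ring|].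
  by rewrite -[RHS]oppr0 -D; ring.
have [b0|b0] := eqVneq b 0; last first.
  exists b, (- a); split; [by left|ring|].
  by rewrite -[RHS]oppr0 -D; ring.
rewrite a0 b0; have [c0|c0] := eqVneq c 0.
  by exists 1, 0; split; [left; exact: oner_neq0|ring|rewrite c0; ring].
by exists d, (- c); split; [right; rewrite oppr_eq0|ring|ring].
Qed.

(** The determinant of the map sending a combination of the fundamental solutions to the jump and
    the integral of its [r]. Zero integral of [r] already makes [j] periodic, as [j' = - z r], so
    two conditions suffice, at [z = 0] as elsewhere. *)
Lemma npeig_det s z Y : rbm s -> ~ peig s z -> fundamental z s Y ->
  Y.1.2 (2 * pi) * cintegral Y.2.2 - (Y.2.2 (2 * pi) - 1) * cintegral Y.1.2 != 0.
Proof.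
move=> hs np hY; apply/negP => /eqP /lin2_kernel [a [b [ab e1 e2]]].
have [h1 h2 [j1 r1] [j2 r2]] := hY.
have hS := sol_lin a b h1 h2; have [b1 c1] := sol_bm h1; have [b2 c2] := sol_bm h2.
have ri : cintegral (fun x => a * Y.1.2 x + b * Y.2.2 x) = 0.
  by rewrite cintegralD ?cintegralZ//; try apply: cintZ; exact: bm_cint.
have [_ _ hj hr] := hS; have [_ br] := sol_bm hS.
have pj : a * Y.1.1 (2 * pi) + b * Y.2.1 (2 * pi) = a * Y.1.1 0 + b * Y.2.1 0.
  rewrite (prim_2pi hj) /ca cintegralZ ?ri ?mulr0 ?addr0//; exact: bm_cint.
have pr : a * Y.1.2 (2 * pi) + b * Y.2.2 (2 * pi) = a * Y.1.2 0 + b * Y.2.2 0.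
  rewrite r1 r2 mulr0 mulr1 add0r -[RHS]addr0 -e1; ring.
have [] := npeig0 np hS pj pr ri; rewrite j1 j2 r1 r2 !mulr1 !mulr0 addr0 add0r => a0 b0.
by case: ab => /eqP.
Qed.

Lemma le_N_PJ f x : cint f -> N (P f x) <= J (fun t => N (f t)).
Proof.
move=> cf; apply: (le_trans (le_N_P x cf)); have i := cint_N cf.
apply: le_J => //; first exact: rint_ind.
move=> t _; rewrite /ind; case: ifP => _; rewrite ?mul1r ?mul0r//; exact: N_ge0.
Qed.

(** Variation of constants gives a particular solution, and a combination of the fundamental ones
    corrects its jump and its mean. The mean of [f1] must vanish for [j] to be periodic. *)
Lemma npeig_solve s z : rbm s -> ~ peig s z -> exists2 C, 0 <= C & forall f1 f2,
  cint f1 -> cint f2 -> cintegral f1 = 0 -> exists j r, psol z s f1 f2 j r /\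
  forall x, N (j x) <= C * (J (fun t => N (f1 t)) + J (fun t => N (f2 t))) /\
            N (r x) <= C * (J (fun t => N (f1 t)) + J (fun t => N (f2 t))).
Proof.
move=> hs np; have [Y hY] := fundamental_exists z hs.
have D0 := npeig_det hs np hY; have det := fundamental_det hY.
have [h1 h2 [j1 r1] [j2 r2]] := hY.
have [b1 c1] := sol_bm h1; have [b2 c2] := sol_bm h2.
have [_ _ hp hp'] := h1; have [_ _ hq hq'] := h2.
set p := Y.1.1 in D0 det h1 j1 b1 hp; set p' := Y.1.2 in D0 det h1 r1 c1 hp hp'.
set q := Y.2.1 in D0 det h2 j2 b2 hq; set q' := Y.2.2 in D0 det h2 r2 c2 hq hq'.
set D := _ - _ in D0.
have [K K0 hK] : exists2 K, 0 <= K & forall x,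
    [/\ N (p x) <= K, N (p' x) <= K, N (q x) <= K & N (q' x) <= K].
  have [[_ [K1 k1]] [_ [K2 k2]]] := (b1, c1); have [[_ [K3 k3]] [_ [K4 k4]]] := (b2, c2).
  have [g1 g2] := (le_trans (N_ge0 _) (k1 0), le_trans (N_ge0 _) (k2 0)).
  have [g3 g4] := (le_trans (N_ge0 _) (k3 0), le_trans (N_ge0 _) (k4 0)).
  exists (K1 + K2 + K3 + K4); first by rewrite !addr_ge0.
  by move=> x; have := (k1 x, k2 x, k3 x, k4 x) => -[[[? ?] ?] ?]; split; lra.
(* Variation of constants; no denominator appears because the wronskian is 1. *)
pose al f1 f2 := P (fun x => q' x * f1 x - q x * f2 x).
pose be f1 f2 := P (fun x => p x * f2 x - p' x * f1 x).
(* Cramer's rule for the equations [E1] and [E2] below, with determinant [D]. *)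
pose A (rp ri : R[i]) := (q' (2 * pi) - 1) / D * ri - cintegral q' / D * rp.
pose B (rp ri : R[i]) := - (p' (2 * pi) / D * ri - cintegral p' / D * rp).
pose L := N ((q' (2 * pi) - 1) / D) + N (cintegral q' / D) + N (cintegral p' / D) + N (p' (2 * pi) / D).
pose W := 2 * K * K.
pose W1 := L * (W * (1 + 2 * pi)).
have W0 : 0 <= W by rewrite !mulr_ge0.
have L0 : 0 <= L by rewrite /L !addr_ge0 ?N_ge0.
have W10 : 0 <= W1.
  by rewrite mulr_ge0// mulr_ge0// addr_ge0// ltW// twopi_gt0.
exists (2 * K * W1 + W); first by apply: addr_ge0 => //; apply: mulr_ge0 => //; exact: mulr_ge0.
move=> f1 f2 cf1 cf2 f10; set m := _ + J _.
have i1 := cint_N cf1; have i2 := cint_N cf2.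
have J1 : 0 <= J (fun t => N (f1 t)) by apply: J_ge0 => x; exact: N_ge0.
have J2 : 0 <= J (fun t => N (f2 t)) by apply: J_ge0 => x; exact: N_ge0.
have m0 : 0 <= m by exact: addr_ge0.
have ca1 : cint (fun x => q' x * f1 x - q x * f2 x) by apply: cintB; exact: cint_bmM.
have cb1 : cint (fun x => p x * f2 x - p' x * f1 x) by apply: cintB; exact: cint_bmM.
have ba x : N (al f1 f2 x) <= K * m.
  apply: (le_trans (le_N_PJ x ca1)); rewrite /m -JD// -JZ; last exact: rintD.
  apply: le_J; [exact: cint_N|by apply: rintZ; exact: rintD|move=> t _].
  have [_ _ k3 k4] := hK t; apply: (le_trans (leNB _ _)); rewrite !NM mulrDr.
  by apply: lerD; rewrite ler_wpM2r ?N_ge0.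
have bb x : N (be f1 f2 x) <= K * m.
  apply: (le_trans (le_N_PJ x cb1)); rewrite /m -JD// -JZ; last exact: rintD.
  apply: le_J; [exact: cint_N|by apply: rintZ; exact: rintD|move=> t _].
  have [k1 k2 _ _] := hK t; apply: (le_trans (leNB _ _)); rewrite !NM mulrDr addrC.
  by apply: lerD; rewrite ler_wpM2r ?N_ge0.
have ha : prim (al f1 f2) (fun x => q' x * f1 x - q x * f2 x).
  by split => // x; rewrite /al P_0// add0r.
have hb : prim (be f1 f2) (fun x => p x * f2 x - p' x * f1 x).
  by split => // x; rewrite /be P_0// add0r.
pose jp x := p x * al f1 f2 x + q x * be f1 f2 x.
pose rp x := p' x * al f1 f2 x + q' x * be f1 f2 x.
have hjp : prim jp (fun x => ca z x * rp x + f1 x).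
  apply: prim_eq (primD (primM hp ha) (primM hq hb)) _ => x.
  rewrite -[in RHS](mulr1 (f1 x)) -(det x) /rp; ring.
have hrp : prim rp (fun x => cb z s x * jp x + f2 x).
  apply: prim_eq (primD (primM hp' ha) (primM hq' hb)) _ => x.
  rewrite /jp -/p -/q -[in RHS](mulr1 (f2 x)) -(det x); ring.
have Wm x : N (jp x) <= W * m /\ N (rp x) <= W * m.
  have [k1 k2 k3 k4] := hK x.
  have -> : W * m = K * (K * m) + K * (K * m) by rewrite /W; ring.
  by split; apply: (le_trans (leND _ _)); apply: lerD; rewrite NM; apply: ler_pM; rewrite ?N_ge0.
have brp := prim_bm hrp; have bjp := prim_bm hjp.
pose ri := cintegral rp.
have riW : N ri <= 2 * pi * (W * m).
  by apply: le_N_cintegral_bd; [exact: bm_cint|move=> x _; case: (Wm x)].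
pose a := A (rp (2 * pi)) ri; pose b := B (rp (2 * pi)) ri.
have [_ rpW] := Wm (2 * pi).
have Wm0 : 0 <= W * m by rewrite !mulr_ge0.
have abW : N a <= W1 * m /\ N b <= W1 * m.
  have W1E : W1 * m = L * (W * m + 2 * pi * (W * m)) by rewrite /W1; ring.
  have t0 : 0 <= 2 * pi * (W * m) by exact: le_trans (N_ge0 _) riW.
  have bd (k1 k2 : R[i]) : N k1 + N k2 <= L -> N (k1 * ri - k2 * rp (2 * pi)) <= W1 * m.
    move=> hc; rewrite W1E; apply: (le_trans (leNB _ _)).
    have h3 : N (k1 * ri) <= N k1 * (W * m + 2 * pi * (W * m)).
      by rewrite NM ler_wpM2l ?N_ge0//; apply: (le_trans riW); rewrite lerDr.
    have h4 : N (k2 * rp (2 * pi)) <= N k2 * (W * m + 2 * pi * (W * m)).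
      by rewrite NM ler_wpM2l ?N_ge0//; apply: (le_trans rpW); rewrite lerDl.
    by apply: (le_trans (lerD h3 h4)); rewrite -mulrDl ler_wpM2r// addr_ge0.
  have n1 := N_ge0 ((q' (2 * pi) - 1) / D); have n2 := N_ge0 (cintegral q' / D).
  have n3 := N_ge0 (cintegral p' / D); have n4 := N_ge0 (p' (2 * pi) / D).
  by split; [|rewrite /b /B NN]; apply: bd; rewrite /L; lra.
exists (fun x => a * p x + b * q x + jp x), (fun x => a * p' x + b * q' x + rp x).
have E1 : a * p' (2 * pi) + b * (q' (2 * pi) - 1) + rp (2 * pi) = 0.
  by rewrite /a /b /A /B; move: D0; rewrite /D => D0; field.
have E2 : a * cintegral p' + b * cintegral q' + ri = 0.
  by rewrite /a /b /A /B; move: D0; rewrite /D => D0; field.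
have hj : prim (fun x => a * p x + b * q x + jp x)
    (fun x => ca z x * (a * p' x + b * q' x + rp x) + f1 x).
  by apply: prim_eq (primD (primD (primZ a hp) (primZ b hq)) hjp) _ => x; ring.
have hr : prim (fun x => a * p' x + b * q' x + rp x)
    (fun x => cb z s x * (a * p x + b * q x + jp x) + f2 x).
  by apply: prim_eq (primD (primD (primZ a hp') (primZ b hq')) hrp) _ => x; rewrite -/p -/q; ring.
have rint0 : cintegral (fun x => a * p' x + b * q' x + rp x) = 0.
  have k1 := bm_cint (bmZ a c1); have k2 := bm_cint (bmZ b c2).
  rewrite -E2 (cintegralD (cintD k1 k2) (bm_cint brp)) (cintegralD k1 k2).
  by rewrite !cintegralZ//; exact: bm_cint.
have al0 : al f1 f2 0 = 0 by rewrite /al P_0. have be0 : be f1 f2 0 = 0 by rewrite /be P_0.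
split.
  split; [exact: hj|exact: hr| | |exact: rint0].
    rewrite (prim_2pi hj) /ca cintegralD//; last first.
      by apply: cintZ; apply: bm_cint; exact: prim_bm hr.
    rewrite cintegralZ; last by apply: bm_cint; exact: prim_bm hr.
    by rewrite rint0 f10 mulr0 !addr0.
  rewrite /rp al0 be0 r1 r2 -/(rp _) !mulr0 mulr1 !addr0 add0r.
  by rewrite -[RHS]addr0 -E1; ring.
move=> x; have [k1 k2 k3 k4] := hK x; have [w1 w2] := Wm x; have [a1 a2] := abW.
have -> : (2 * K * W1 + W) * m = W1 * m * K + W1 * m * K + W * m by ring.
by split; apply: (le_trans (leND _ _)); apply: lerD => //; apply: (le_trans (leND _ _));
  apply: lerD; rewrite NM; apply: ler_pM; rewrite ?N_ge0.
Qed.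

Lemma state_normE (f : state R) : L2 f.1 -> L2 f.2 ->
  state_norm f = Num.sqrt (J (fun x => N (f.1 x) ^+ 2 + N (f.2 x) ^+ 2)).
Proof.
move=> h1 h2; rewrite /state_norm /state_dot Re_cintegral; congr (Num.sqrt (J _)).
by apply/funext => x; rewrite ReD !N_mulJ !ReC.
Qed.

Lemma L1_le_norm (f : state R) : L2 f.1 -> L2 f.2 ->
  J (fun x => N (f.1 x)) + J (fun x => N (f.2 x)) <= (2 * pi + 1) * state_norm f.
Proof.
move=> h1 h2; rewrite state_normE//.
have i1 := cint_N (L2_cint h1); have i2 := cint_N (L2_cint h2).
have [_ q1] := (L2P _).1 h1; have [_ q2] := (L2P _).1 h2.
have q := rintD q1 q2; set S := J (fun x => _ + _).
have S0 : 0 <= S by apply: J_ge0 => x; rewrite addr_ge0 ?sqr_ge0.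
set n := Num.sqrt S; have n0 : 0 <= n := sqrtr_ge0 _.
have nS : S = n ^+ 2 by rewrite sqr_sqrtr.
have p0 := twopi_gt0 R.
(* The bound [a + b <= t + (a^2 + b^2) / (2 t)] is integrated with [t] close to the norm [n]; the
   excess keeps [t] positive when [n = 0]. *)
apply/ler_addgt0Pr => e e0; pose t := n + e / (2 * pi).
have t0 : 0 < t by rewrite ltr_wpDl// divr_gt0.
have h : J (fun x => N (f.1 x)) + J (fun x => N (f.2 x)) <= 2 * pi * t + (2 * t)^-1 * S.
  rewrite -JD// -J_cst -JZ// -JD; [|exact: rint_cst|exact: rintZ].
  apply: le_J; [exact: rintD|by apply: rintD; [exact: rint_cst|exact: rintZ]|move=> x _].
  move: (N (f.1 x)) (N (f.2 x)) => a b.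
  rewrite -subr_ge0.
  have -> : t + (2 * t)^-1 * (a ^+ 2 + b ^+ 2) - (a + b) = ((t - a) ^+ 2 + (t - b) ^+ 2) / (2 * t).
    by field; exact: lt0r_neq0.
  by rewrite divr_ge0 ?addr_ge0 ?sqr_ge0 ?mulr_ge0// ltW.
apply: (le_trans h).
have h3 : (2 * t)^-1 * S <= n.
  rewrite mulrC ler_pdivrMr ?mulr_gt0// nS expr2 ler_wpM2l//.
  by have := divr_gt0 e0 p0; rewrite /t; lra.
have h4 : 2 * pi * t = 2 * pi * n + e.
  by rewrite /t; move: (2 * pi : R) (lt0r_neq0 p0) => y y0; field.
by rewrite h4; lra.
Qed.

Lemma npeig_resolvent s z : rbm s -> ~ peig s z -> resolvent_set s z.
Proof.
move=> hs np; have [C C0 hC] := npeig_solve hs np.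
have sol_f (f : state R) : L2p f -> exists j r, psol z s f.1 f.2 j r /\
    forall x, N (j x) <= C * ((2 * pi + 1) * state_norm f) /\
              N (r x) <= C * ((2 * pi + 1) * state_norm f).
  move=> [l1 l2 fi]; have [j [r [h b]]] := hC f.1 f.2 (L2_cint l1) (L2_cint l2) fi.
  exists j, r; split => // x; have [b1 b2] := b x.
  by split; [apply: (le_trans b1)|apply: (le_trans b2)]; apply: ler_wpM2l => //; exact: L1_le_norm.
have ueq (f u : state R) j r : psol z s f.1 f.2 j r -> resolvent_eq s z u f -> state_eq u (r, j).
  move=> h hu; have [_ [j' [r' [h' [e1 e2]]]]] := resolvent_psol hs hu.
  have E := psol_unique hs np h' h.
  split; apply/ae_eqP.
    by move/ae_eqP: e1; apply: aeS => x ->; case: (E x).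
  by move/ae_eqP: e2; apply: aeS => x ->; case: (E x).
split.
  move=> f lf; have [j [r [h _]]] := sol_f f lf.
  exists (r, j); first exact: psol_resolvent.
  by move=> v hv; exact: ueq h hv.
exists (Num.sqrt (2 * pi * 2) * (C * (2 * pi + 1))) => f u hu.
have [lf _] := resolvent_psol hs hu; have [j [r [h b]]] := sol_f f lf.
have [e1 e2] := ueq f u j r h hu.
have [[lu1 lu2 _] _ _] := hu.
have [hj hr _ _ _] := h; have bj := prim_bm hj; have br := prim_bm hr.
set K := C * _ in b; have K0 : 0 <= K by have [b0 _] := b 0; exact: le_trans (N_ge0 _) b0.
rewrite -[_ * _ * state_norm f]mulrA -[C * _ * state_norm f]mulrA -/K.
have -> : Num.sqrt (2 * pi * 2) * K = Num.sqrt (2 * pi * (2 * K ^+ 2)).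
  have c0 : 0 <= 2 * pi * 2 :> R by rewrite mulr_ge0// ltW// twopi_gt0.
  by rewrite [2 * pi * (2 * K ^+ 2)]mulrA (sqrtrM _ c0) sqrtr_sqr ger0_norm.
rewrite state_normE//; apply: ler_wsqrtr.
have rb : rbm (fun x => N (r x) ^+ 2 + N (j x) ^+ 2).
  by have := (bm_rbmN br, bm_rbmN bj) => -[a1 a2]; apply: rbmD; under eq_fun do rewrite expr2; exact: rbmM.
have mu2 : rmeas (fun x => N (u.1 x) ^+ 2 + N (u.2 x) ^+ 2).
  have [_ q1] := (L2P _).1 lu1; have [_ q2] := (L2P _).1 lu2.
  exact: rint_meas (rintD q1 q2).
rewrite (@J_ae _ _ (fun x => N (r x) ^+ 2 + N (j x) ^+ 2))//.
- rewrite -J_cst; apply: le_J; [exact: rbm_rint|exact: rint_cst|move=> x _].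
  have [b1 b2] := b x.
  by rewrite mulr2n mulrDl mul1r; apply: lerD; rewrite ler_pXn2r ?nnegrE ?N_ge0.
- by case: rb.
- apply/ae_eqP; move/ae_eqP: e1 => e1; move/ae_eqP: e2 => e2.
  by apply: aeS (aeI e1 e2) => x [-> ->].
Qed.

Lemma spectrumP s z : rbm s -> spectrum s z <-> peig s z.
Proof.
move=> hs; split=> [h|]; last exact: peig_spectrum.
by apply: contrapT => np; apply: h; exact: npeig_resolvent.
Qed.

End Resolvent.

(** * Spectral projections and simple eigenvalues *)

Section Simple.
Variable R : realType.
Let mu := torus R.
Implicit Types (s : R -> R) (z l : R[i]) (j r : R -> R[i]) (f g e : state R).

Lemma L2J (f : R -> R[i]) : L2 f -> L2 (fun x => conjc (f x)).
Proof.
move=> /L2P[mf hf]; apply/L2P; split; first exact: cmeasJ.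
by move: hf; congr rint; apply/funext => x; rewrite NJ.
Qed.

Lemma state_dot_lin c d f e g : L2p f -> L2p e -> L2p g ->
  state_dot (fun x => c * f.1 x + d * e.1 x, fun x => c * f.2 x + d * e.2 x) g =
  c * state_dot f g + d * state_dot e g.
Proof.
move=> [f1 f2 _] [e1 e2 _] [g1 g2 _]; rewrite /state_dot /=.
have a1 := cintD (L2_mul f1 (L2J g1)) (L2_mul f2 (L2J g2)).
have a2 := cintD (L2_mul e1 (L2J g1)) (L2_mul e2 (L2J g2)).
rewrite -!cintegralZ// -cintegralD; [|exact: cintZ|exact: cintZ].
by congr cintegral; apply/funext => x; ring.
Qed.

Lemma cintegral_cos (c : R) : cintegral (fun x => (cos (x + c))%:C) = 0 :> R[i].
Proof.
have := prim_weak (prim_cst (1 : R[i])) erefl (smooth_periodic_cos 1 (c - pi / 2)).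
rewrite derive1_cos (_ : (fun x => 0 * _) = fun=> 0); last by apply/funext => x; rewrite mul0r.
rewrite cintegral_cst mulr0 oppr0 => <-; congr cintegral; apply/funext => x.
by rewrite mul1r mulr1z !mul1r -addrA subrK.
Qed.

Lemma cintegral_cisJ : cintegral (fun x => conjc (cis x)) = 0 :> R[i].
Proof.
have h1 := cintegral_cos 0; have h2 := cintegral_cos (- (pi / 2)).
have b (c : R) : cint (fun x => (cos (x + c))%:C : R[i]).
  apply: bm_cint; apply: bmC; have := rbm_cos 1 c; congr rbm.
  by apply/funext => x; rewrite mul1r.
have [k [k1 k2]] : exists k : R[i], Re k = 0 /\ Im k = -1 by exists (Complex 0 (-1)).
have -> : (fun x => conjc (cis x)) =
    (fun x => (cos (x + 0))%:C + k * (cos (x + - (pi / 2)))%:C).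
  by apply/funext => x; rewrite addr0 cosBpihalf; apply: ceqP; rewrite !reimE k1 k2 /cis /=; ring.
by rewrite cintegralD ?cintegralZ ?h1 ?h2 ?mulr0 ?addr0//; exact: cintZ.
Qed.

Lemma psol_L2p s z (f1 f2 : R -> R[i]) j r : psol z s f1 f2 j r -> L2p (r, j).
Proof.
by move=> [hj hr _ _ ri]; split => //=; apply: bm_L2; [exact: prim_bm hr|exact: prim_bm hj].
Qed.

(* The resolvent acts on a Jordan chain by
   [(z - A)^-1 f = f / (z - l) + e / (z - l) ^ 2], where [(A - l) f = e]. *)
Lemma projection_chain s l (d : R) j r j' r' : rbm s -> 0 < d ->
  psol l s (fun=> 0) (fun=> 0) j r -> psol l s (fun x => - r x) (fun x => - j x) j' r' ->
  spectral_projection s l d (r', j') (r', j').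
Proof.
move=> hs d0 h h'; have lf := psol_L2p h'; have le := psol_L2p h.
split => //.
pose u z : state R := let c := (z - l)^-1 in
  (fun x => c * r' x + c ^+ 2 * r x, fun x => c * j' x + c ^+ 2 * j x).
have cN th : N (circle l d th - l) = d.
  by rewrite /circle addrC addKr NM NC (N_cis th) mulr1 gtr0_norm.
exists u.
  move=> th; set z := circle l d th; have zl : z - l != 0 by rewrite -N_eq0 cN gt_eqF.
  apply: psol_resolvent => //=; set c := (z - l)^-1.
  have [hj hr pj pr ri] := psol_lin c (c ^+ 2) h' h.
  have zc : z * c = 1 + l * c.
    by apply/eqP; rewrite -subr_eq -mulrBl divff.
  split => //.
  - apply: prim_eq hj _ => x; rewrite /ca.
    rewrite (_ : - z * (c * r' x + c ^+ 2 * r x) = - (z * c) * r' x - (z * c) * c * r x); last by ring.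
    rewrite zc; ring.
  - apply: prim_eq hr _ => x; rewrite /cb.
    rewrite (_ : - (z + (s x)%:C) * (c * j' x + c ^+ 2 * j x) =
       - (z * c) * j' x - (z * c) * c * j x - (s x)%:C * (c * j' x + c ^+ 2 * j x)); last by ring.
    rewrite zc; ring.
move=> g lg; rewrite /circle_integral.
set D1 := state_dot _ g; pose D2 := state_dot (r, j) g.
(* The simple pole gives a constant integrand. The double pole leaves a multiple of the conjugate of
   [cis], whose integral is zero. *)
have -> : (fun th => state_dot (u (circle l d th)) g * ('i%C * (circle l d th - l))) =
   (fun th => 'i%C * D1 + 'i%C * D2 * (d^-1)%:C * conjc (cis th)).
  apply/funext => th; have := cN th; set w := circle l d th - l => Nw.
  have w0 : w != 0 by rewrite -N_eq0 Nw gt_eqF.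
  rewrite /u -/w (state_dot_lin w^-1 (w^-1 ^+ 2) lf le lg) -/D1 -/D2.
  have -> : (w^-1 * D1 + w^-1 ^+ 2 * D2) * ('i%C * w) = 'i%C * D1 + 'i%C * D2 * w^-1 by field.
  congr (_ + _); rewrite -[RHS]mulrA; congr (_ * _).
  have wE : w = d%:C * cis th by rewrite /w /circle addrC addKr.
  apply: (mulfI w0); rewrite divff// {1}wE.
  rewrite (_ : _ * _ * _ = (d%:C * (d^-1)%:C) * (cis th * conjc (cis th))); last by ring.
  by rewrite N_mulJ N_cis expr1n -CM divff ?gt_eqF// mulr1.
have bc : cint (fun th => conjc (cis th) : R[i]).
  apply: bm_cint; apply: bmJ; split; last by exists 1 => x; rewrite N_cis.
  by split; apply: rmeas_continuous; [exact: continuous_cos|exact: continuous_sin].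
rewrite cintegralD; [|exact: bm_cint (bm_cst _)|exact: cintZ].
rewrite cintegral_cst cintegralZ// cintegral_cisJ mulr0 addr0 [X in _ * X]mulrA mulKf//.
rewrite mulf_neq0//; first by rewrite -N_eq0 NC normr_eq0 gt_eqF// twopi_gt0.
by rewrite -N_eq0 /= expr0n expr1n add0r sqrtr1 oner_eq0.
Qed.

Lemma psol00 s z : psol z s (fun=> 0) (fun=> 0) (fun=> 0) (fun=> 0 : R[i]).
Proof.
by split; rewrite ?cintegral_cst ?mulr0//; apply: prim_eq (prim_cst 0) _ => x; rewrite mulr0 addr0.
Qed.

Lemma psol_ae0 s z (f1 f2 : R -> R[i]) j r : psol z s f1 f2 j r -> {ae mu, forall x, j x = 0} ->
  {ae mu, forall x, r x = 0} -> (forall x, j x = 0 /\ r x = 0) /\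
  {ae mu, forall x, f1 x = 0 /\ f2 x = 0}.
Proof.
move=> [hj hr pj pr _] j0 r0.
have [J0 g1] := prim_ae0 hj pj j0; have [R0 g2] := prim_ae0 hr pr r0.
split => [x|]; first by split; rewrite ?J0 ?R0.
by apply: aeS (aeI g1 g2) => x; rewrite J0 R0 !mulr0 !add0r.
Qed.

(** Both vectors are fixed by the spectral projection, whose range is a line. Taking [(j1, r1) = 0]
    gives uniqueness of the eigenvector, and [(j1, r1) = (j, r)] excludes a Jordan chain. *)
Lemma simple_collinear s l j r j1 r1 j' r' : rbm s -> simple_eigenvalue s l ->
  psol l s (fun=> 0) (fun=> 0) j r -> 0 < N (j 0) + N (r 0) ->
  psol l s (fun=> 0) (fun=> 0) j1 r1 -> psol l s (fun x => - r1 x) (fun x => - j1 x) j' r' ->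
  exists c, {ae mu, forall x, j' x = c * j x /\ r' x = c * r x}.
Proof.
move=> hs [_ [d [d0 _ [e0 _ He]]]] h nz h1 h'.
have h0 : psol l s (fun x => - (fun=> 0 : R[i]) x) (fun x => - (fun=> 0 : R[i]) x) j r.
  by have := h; rewrite (_ : (fun x => - _) = fun=> 0)//; apply/funext => x; rewrite oppr0.
have V1 := projection_chain hs d0 (psol00 s l) h0.
have V2 := projection_chain hs d0 h1 h'.
have [|c1 [/ae_eqP /= a1 /ae_eqP /= b1]] := He (r, j).
  by exists (r, j) => //; exact: psol_L2p h.
have [|c2 [/ae_eqP /= a2 /ae_eqP /= b2]] := He (r', j').
  by exists (r', j') => //; exact: psol_L2p h'.
have c10 : c1 != 0.
  apply/negP => /eqP c0; move: nz.
  have j0 : {ae mu, forall x, j x = 0} by apply: aeS b1 => x ->; rewrite c0 mul0r.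
  have r0 : {ae mu, forall x, r x = 0} by apply: aeS a1 => x ->; rewrite c0 mul0r.
  have [E _] := psol_ae0 h j0 r0.
  by have [-> ->] := E 0; rewrite N0 addr0 ltxx.
exists (c2 / c1); apply: aeS (aeI (aeI a1 b1) (aeI a2 b2)) => x [[-> ->] [-> ->]].
by split; field.
Qed.

Lemma simple_unique s l j r j' r' : rbm s -> simple_eigenvalue s l ->
  psol l s (fun=> 0) (fun=> 0) j r -> 0 < N (j 0) + N (r 0) ->
  psol l s (fun=> 0) (fun=> 0) j' r' -> exists c, forall x, j' x = c * j x /\ r' x = c * r x.
Proof.
move=> hs sl h nz h'.
have h0 : psol l s (fun x => - (fun=> 0 : R[i]) x) (fun x => - (fun=> 0 : R[i]) x) j' r'.
  by have := h'; rewrite (_ : (fun x => - _) = fun=> 0)//; apply/funext => x; rewrite oppr0.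
have [c hc] := simple_collinear hs sl h nz (psol00 s l) h0.
exists c => x; have h2 := psol_lin 1 (- c) h' h.
have j0 : {ae mu, forall x, 1 * j' x + - c * j x = 0} by apply: aeS hc => y [-> _]; ring.
have r0 : {ae mu, forall x, 1 * r' x + - c * r x = 0} by apply: aeS hc => y [_ ->]; ring.
have [E _] := psol_ae0 h2 j0 r0; have [a b] := E x.
by split; apply/eqP; rewrite -subr_eq0 -mulNr -[X in X + _]mul1r ?a ?b.
Qed.

Lemma inhom_exists s z (f1 f2 : R -> R[i]) : rbm s -> cint f1 -> cint f2 -> exists j r,
  prim j (fun x => ca z x * r x + f1 x) /\ prim r (fun x => cb z s x * j x + f2 x).
Proof.
move=> hs cf1 cf2; have [Y hY] := fundamental_exists z hs.
have det := fundamental_det hY; have [h1 h2 _ _] := hY.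
have [b1 c1] := sol_bm h1; have [b2 c2] := sol_bm h2.
have [_ _ hp hp'] := h1; have [_ _ hq hq'] := h2.
have ca1 : cint (fun x => Y.2.2 x * f1 x - Y.2.1 x * f2 x) by apply: cintB; exact: cint_bmM.
have cb1 : cint (fun x => Y.1.1 x * f2 x - Y.1.2 x * f1 x) by apply: cintB; exact: cint_bmM.
have ha := prim_P 0 ca1; have hb := prim_P 0 cb1.
set a := fun x => 0 + P _ x in ha; set b := fun x => 0 + P _ x in hb.
exists (fun x => Y.1.1 x * a x + Y.2.1 x * b x), (fun x => Y.1.2 x * a x + Y.2.2 x * b x).
split.
- apply: prim_eq (primD (primM hp ha) (primM hq hb)) _ => x.
  rewrite -[in RHS](mulr1 (f1 x)) -(det x); ring.
- apply: prim_eq (primD (primM hp' ha) (primM hq' hb)) _ => x.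
  rewrite -[in RHS](mulr1 (f2 x)) -(det x); ring.
Qed.

(** At [z = 0] the current [j] is constant, and integrating [r' = - s j] over the period gives
    [j 0 * J s = 0]; were [j 0] zero, [r] would be constant of mean zero. *)
Lemma psol_zero s j r : rbm s -> {ae mu, forall x, 0 <= s x} ->
  psol 0 s (fun=> 0) (fun=> 0) j r -> 0 < N (j 0) + N (r 0) ->
  [/\ {ae mu, forall x, s x = 0}, forall x, j x = j 0, forall x, r x = 0 & j 0 != 0].
Proof.
move=> hs s0 [hj hr pj pr ri] nz.
have jc : forall x, j x = j 0.
  by apply: prim0; apply: prim_eq hj _ => x; rewrite /ca oppr0 mul0r addr0.
have rc0 : (forall x, r x = r 0) -> forall x, r x = 0.
  move=> rc x; apply: (mulfI (_ : (2 * pi)%:C != 0 :> R[i])).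
    by rewrite -N_eq0 NC normr_eq0 gt_eqF// twopi_gt0.
  rewrite mulr0 -ri -cintegral_cst rc; congr cintegral; apply/funext => y; by rewrite rc.
have j0 : j 0 != 0.
  apply/negP => /eqP j00.
  have r0 : forall x, r x = 0.
    apply: rc0; apply: prim0; apply: prim_eq hr _ => x.
    by rewrite jc j00 mulr0 addr0.
  by move: nz; rewrite j00 r0 N0 addr0 ltxx.
have sj : cintegral (fun x => (s x)%:C * j 0) = 0.
  have := prim_2pi hr; rewrite pr -[X in X = _]addr0 => /addrI/esym.
  rewrite (_ : (fun x => _) = fun x => - ((s x)%:C * j 0)).
    rewrite cintegralN; first by move/eqP; rewrite oppr_eq0 => /eqP.
    by apply: bm_cint; apply: bmM; [exact: bmC|exact: bm_cst].
  by apply/funext => x; rewrite /cb jc add0r addr0 mulNr.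
have Js : J s = 0.
  move: sj; rewrite (_ : (fun x => _) = fun x => j 0 * (s x)%:C); last first.
    by apply/funext => x; rewrite mulrC.
  rewrite cintegralZ; last by apply: bm_cint; exact: bmC.
  by move/eqP; rewrite mulf_eq0 (negbTE j0) cintegralE => /eqP [+ _].
have ss := J_eq0 (rbm_rint hs) s0 Js.
split => //; apply: rc0; apply: prim0; apply: (prim_ae hr); first exact: bm_cint (bm_cst 0).
by apply: aeS ss => x e; rewrite /cb e addr0 addr0 oppr0 mul0r.
Qed.

(* If the form vanished, the wronskian of [(j, r)] with any solution of
   [(A - l) f = (r, j)] would take equal values at [0] and [2 pi], so that the
   solution could be made periodic: a Jordan chain. *)
Lemma simple_form_neq0 s l j r : rbm s -> {ae mu, forall x, 0 <= s x} -> simple_eigenvalue s l ->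
  psol l s (fun=> 0) (fun=> 0) j r -> 0 < N (j 0) + N (r 0) ->
  cintegral (fun x => r x ^+ 2 - j x ^+ 2) != 0.
Proof.
move=> hs s0 sl h nz; have [l0|l0] := eqVneq l 0.
  rewrite l0 in h; have [_ jc r0 j0] := psol_zero hs s0 h nz.
  rewrite (_ : (fun x => _) = fun=> - j 0 ^+ 2).
    rewrite cintegral_cst mulf_neq0//; last by rewrite oppr_eq0 expf_neq0.
    by rewrite -N_eq0 NC normr_eq0 gt_eqF// twopi_gt0.
  by apply/funext => x; rewrite r0 jc expr0n sub0r.
apply/negP => /eqP B0.
have [hj hr pj pr ri] := h; have bj := prim_bm hj; have br := prim_bm hr.
have [jf [rf [hjf hrf]]] := @inhom_exists s l (fun x => - r x) (fun x => - j x) hs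
  (bm_cint (bmN br)) (bm_cint (bmN bj)).
have cross (a b c d : R[i]) : (a != 0 \/ b != 0) -> a * d - b * c = 0 ->
    exists k, c = k * a /\ d = k * b.
  move=> ab D; have e : a * d = b * c by apply/eqP; rewrite -subr_eq0 D.
  have [a0|a0] := eqVneq a 0.
    have b0 : b != 0 by case: ab; rewrite ?a0 ?eqxx.
    exists (d / b); split; last by rewrite divfK.
    apply: (mulfI b0); rewrite -e a0; ring.
  exists (c / a); split; first by rewrite divfK.
  by apply: (mulfI a0); rewrite e; field.
have nz' := (pair_neq0 _ _).1 nz.
(* Since the form is zero, the jump of [(jf, rf)] over the period is parallel to [(j 0, r 0)]. *)
have Wf : j 0 * (rf (2 * pi) - rf 0) - r 0 * (jf (2 * pi) - jf 0) = 0.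
  have := prim_2pi (primB (primM hj hrf) (primM hr hjf)).
  rewrite (_ : cintegral _ = 0).
    by rewrite addr0 pj pr => /eqP; rewrite -subr_eq0 => /eqP <-; ring.
  by rewrite -[RHS]B0; congr cintegral; apply/funext => x; rewrite /ca /cb; ring.
have [k [kj kr]] := cross _ _ _ _ nz' Wf.
(* Initial values of a solution [y] with wronskian 1 against [(j, r)]; constancy of the wronskian
   makes its jump parallel to [(j 0, r 0)] as well. *)
have [c2 c2E] : exists c : R[i] * R[i], j 0 * c.2 - r 0 * c.1 = 1.
  have [j0|j0] := eqVneq (j 0) 0.
    have r0 : r 0 != 0 by case: nz'; rewrite ?j0 ?eqxx.
    by exists (- (r 0)^-1, 0); rewrite /= mulr0 sub0r mulrN opprK divff.
  by exists (0, (j 0)^-1); rewrite /= mulr0 subr0 divff.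
have [y hy y0] := Sol_exists l c2 hs.
have hS : Sol l s j r by have [_] := (psol0 _ _ _ hs).1 h; case: ((psol0 l j r hs).1 h).
have y1 : y.1 0 = c2.1 by rewrite -y0. have y2 : y.2 0 = c2.2 by rewrite -y0.
have W2 x : j x * y.2 x - y.1 x * r x = 1.
  by rewrite (sol_wronskian hS hy) y1 y2 -c2E; ring.
have Wy : j 0 * (y.2 (2 * pi) - y.2 0) - r 0 * (y.1 (2 * pi) - y.1 0) = 0.
  have := W2 (2 * pi); rewrite -(W2 0) pj pr => /eqP; rewrite -subr_eq0 => /eqP <-; ring.
have [k2 [k2j k2r]] := cross _ _ _ _ nz' Wy.
have [_ _ hy1 hy2] := hy; have [by1 by2] := sol_bm hy.
(* A zero jump would make [y] a second, independent eigenvector. Otherwise a multiple of [y] cancels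
   the jump of [(jf, rf)]. *)
have [k20|k20] := eqVneq k2 0.
  have py1 : y.1 (2 * pi) = y.1 0 by apply/eqP; rewrite -subr_eq0 k2j k20 mul0r.
  have py2 : y.2 (2 * pi) = y.2 0 by apply/eqP; rewrite -subr_eq0 k2r k20 mul0r.
  have iy2 : cintegral y.2 = 0.
    have := prim_2pi hy1; rewrite py1 -[X in X = _]addr0 => /addrI/esym.
    rewrite /ca cintegralZ; last exact: bm_cint.
    by move/eqP; rewrite mulf_eq0 oppr_eq0 (negbTE l0) => /eqP.
  have h2 : psol l s (fun=> 0) (fun=> 0) y.1 y.2 by apply/psol0.
  have [c hc] := simple_unique hs sl h nz h2.
  have := W2 0; have [-> ->] := hc 0.
  by rewrite (_ : _ - _ = 0) => [/esym/eqP|]; [rewrite oner_eq0|ring].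
pose a := k / k2.
pose jg x := jf x - a * y.1 x; pose rg x := rf x - a * y.2 x.
have hjg : prim jg (fun x => ca l x * rg x + - r x).
  by apply: prim_eq (primB hjf (primZ a hy1)) _ => x; rewrite /rg; ring.
have hrg : prim rg (fun x => cb l s x * jg x + - j x).
  by apply: prim_eq (primB hrf (primZ a hy2)) _ => x; rewrite /jg; ring.
have pjg : jg (2 * pi) = jg 0.
  apply/eqP; rewrite -subr_eq0 /jg; apply/eqP.
  transitivity ((jf (2 * pi) - jf 0) - a * (y.1 (2 * pi) - y.1 0)); first by ring.
  by rewrite kj k2j /a; field.
have prg : rg (2 * pi) = rg 0.
  apply/eqP; rewrite -subr_eq0 /rg; apply/eqP.
  transitivity ((rf (2 * pi) - rf 0) - a * (y.2 (2 * pi) - y.2 0)); first by ring.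
  by rewrite kr k2r /a; field.
have brg := prim_bm hrg; have bjg := prim_bm hjg.
have irg : cintegral rg = 0.
  have := prim_2pi hjg; rewrite pjg -[X in X = _]addr0 => /addrI/esym.
  rewrite /ca cintegralD; [|exact: bm_cint (bmZ _ brg)|exact: bm_cint (bmN br)].
  rewrite cintegralZ ?cintegralN ?ri ?oppr0 ?addr0; try exact: bm_cint.
  by move/eqP; rewrite mulf_eq0 oppr_eq0 (negbTE l0) => /eqP.
have hg : psol l s (fun x => - r x) (fun x => - j x) jg rg by split.
have [c hc] := simple_collinear hs sl h nz h hg.
have h3 := psol_lin 1 (- c) hg h.
have j0 : {ae mu, forall x, 1 * jg x + - c * j x = 0} by apply: aeS hc => y' [-> _]; ring.
have r0 : {ae mu, forall x, 1 * rg x + - c * r x = 0} by apply: aeS hc => y' [_ ->]; ring.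
have [_ E] := psol_ae0 h3 j0 r0.
have rr : {ae mu, forall x, r x = 0}.
  by apply: aeS E => x [+ _]; rewrite mulr0 addr0 mul1r => /eqP; rewrite oppr_eq0 => /eqP.
have jj : {ae mu, forall x, j x = 0}.
  by apply: aeS E => x [_ +]; rewrite mulr0 addr0 mul1r => /eqP; rewrite oppr_eq0 => /eqP.
have [E2 _] := psol_ae0 h jj rr.
by move: nz; have [-> ->] := E2 0; rewrite N0 addr0 ltxx.
Qed.

End Simple.

(** * Limits of perturbed eigenvalues *)

Section Perturbation.
Variable R : realType.
Let mu := torus R.
Implicit Types (s tau : R -> R) (z l : R[i]) (j r : R -> R[i]).

Lemma to0M (u v : nat -> R) : to0 u -> to0 v -> to0 (fun n => u n * v n).
Proof.
move=> hu hv; rewrite /to0 -[X in _ --> X](mulr0 (0 : R)).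
by apply: cvgM.
Qed.

Lemma peig_psol0 s z : rbm s -> peig s z <->
  exists j r, psol z s (fun=> 0) (fun=> 0) j r /\ 0 < N (j 0) + N (r 0).
Proof.
move=> hs; split=> [[j [r [[h1 h2 h3 h4] h5]]]|[j [r [/(psol0 _ _ _ hs)[h1 h2 h3 h4] h5]]]].
  by exists j, r; split => //; apply/psol0.
by exists j, r.
Qed.

(** The real part of the integral of [(j conj r)'] over the period. *)
Lemma energy s z j r : rbm s -> psol z s (fun=> 0) (fun=> 0) j r ->
  Re z * J (fun x => N (r x) ^+ 2 + N (j x) ^+ 2) + J (fun x => s x * N (j x) ^+ 2) = 0.
Proof.
move=> hs [hj hr pj pr ri]; have bj := prim_bm hj; have br := prim_bm hr.
have := prim_2pi (primM hj (primJ hr)).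
rewrite pj pr -[X in X = _]addr0 => /addrI/esym/(congr1 (@complex.Re R)); rewrite Re_cintegral /=.
have Nj := bm_rbmN bj; have Nr := bm_rbmN br.
have i1 : rint (fun x => N (r x) ^+ 2 + N (j x) ^+ 2).
  by apply: rbm_rint; apply: rbmD; under eq_fun do rewrite expr2; exact: rbmM.
have i2 : rint (fun x => s x * N (j x) ^+ 2).
  by apply: rbm_rint; apply: rbmM => //; under eq_fun do rewrite expr2; exact: rbmM.
rewrite -JZ// -JD//; last exact: rintZ.
rewrite (_ : (fun x => Re _) = fun x => - (Re z * (N (r x) ^+ 2 + N (j x) ^+ 2) + s x * N (j x) ^+ 2)).
  by rewrite JN => [/eqP|]; [rewrite oppr_eq0 => /eqP|apply: rintD => //; exact: rintZ].
by apply/funext => x; rewrite !N_sqr !reimE /=; ring.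
Qed.

Lemma psol_norm_gt0 s z j r : rbm s -> psol z s (fun=> 0) (fun=> 0) j r -> 0 < N (j 0) + N (r 0) ->
  0 < J (fun x => N (r x) ^+ 2 + N (j x) ^+ 2).
Proof.
move=> hs h nz; have [hj hr _ _ _] := h; have bj := prim_bm hj; have br := prim_bm hr.
have Nj := bm_rbmN bj; have Nr := bm_rbmN br.
have i1 : rint (fun x => N (r x) ^+ 2 + N (j x) ^+ 2).
  by apply: rbm_rint; apply: rbmD; under eq_fun do rewrite expr2; exact: rbmM.
have p x : 0 <= N (r x) ^+ 2 + N (j x) ^+ 2 by rewrite addr_ge0 ?sqr_ge0.
rewrite lt0r J_ge0// andbT; apply/negP => /eqP J0.
have E : {ae mu, forall x, N (r x) ^+ 2 + N (j x) ^+ 2 = 0}.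
  by apply: J_eq0 => //; apply: ae_torus => x _.
have e x : N (r x) ^+ 2 + N (j x) ^+ 2 = 0 -> r x = 0 /\ j x = 0.
  move=> /eqP; rewrite paddr_eq0 ?sqr_ge0// !sqrf_eq0 !N_eq0 => /andP[/eqP -> /eqP ->].
  by [].
have [E2 _] := psol_ae0 h (aeS (fun x h => (e x h).2) E) (aeS (fun x h => (e x h).1) E).
by move: nz; have [-> ->] := E2 0; rewrite N0 addr0 ltxx.
Qed.

Lemma peig_Re_le0 s z : rbm s -> (forall x, 0 <= s x) -> peig s z -> Re z <= 0.
Proof.
move=> hs s0 /(peig_psol0 _ hs)[j [r [h nz]]].
have := energy hs h; have := psol_norm_gt0 hs h nz; set a := J _; set b := J _ => a0 E.
have b0 : 0 <= b by apply: J_ge0 => x; rewrite mulr_ge0 ?sqr_ge0.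
by rewrite leNgt; apply/negP => z0; have := mulr_gt0 z0 a0; lra.
Qed.

Section Limit.
Variables (s tau : R -> R) (e : nat -> R) (z : nat -> R[i]) (x K : R).
Hypotheses (hs : rbm s) (htau : rbm tau) (e_ge0 : forall n, 0 < e n) (e_to0 : to0 e).
Let sn n y := s y + e n * tau y.
Hypotheses (hz : forall n, peig (sn n) (z n)) (zK : forall n, N (z n) <= K)
  (zx : forall n, x - e n ^+ 2 <= Re (z n)).

(** The perturbed eigenvectors, normalised at 0, converge uniformly along a subsequence. A wronskian
    of perturbed eigenvector and limit is periodic, so its derivative integrates to zero, and the
    sign of the limit of that identity is the conclusion. *)
Lemma limit_peig : exists l j r, [/\ psol l s (fun=> 0) (fun=> 0) j r, 0 < N (j 0) + N (r 0),
  x <= Re l & Re l = x ->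
  0 <= Re (cintegral (fun y => (tau y)%:C * j y ^+ 2) *
           conjc (cintegral (fun y => r y ^+ 2 - j y ^+ 2)))].
Proof.
have hsn n : rbm (sn n) by apply: rbmD => //; apply: rbmM => //; exact: rbm_cst.
have [_ [M hM]] := hs; have [_ [Mt hMt]] := htau.
have M0 : 0 <= M by rewrite (le_trans _ (hM 0)).
have Mt0 : 0 <= Mt by rewrite (le_trans _ (hMt 0)).
have K0 : 0 <= K by rewrite (le_trans _ (zK 0)) ?N_ge0.
have /choice[jr hjr] n : exists p : (R -> R[i]) * (R -> R[i]),
    psol (z n) (sn n) (fun=> 0) (fun=> 0) p.1 p.2 /\ N (p.1 0) + N (p.2 0) = 1.
  have [j [r [h nz]]] := (peig_psol0 _ (hsn n)).1 (hz n).
  pose c : R[i] := (N (j 0) + N (r 0))^-1%:C.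
  exists ((fun y => c * j y), (fun y => c * r y)); split => /=.
    have := psol_lin c 0 h h.
    rewrite (_ : (fun y => c * 0 + 0 * 0) = fun=> 0); last by apply/funext => y; rewrite mulr0 mul0r addr0.
    rewrite (_ : (fun y => c * j y + 0 * _) = fun y => c * j y); last by apply/funext => y; rewrite mul0r addr0.
    by rewrite (_ : (fun y => c * r y + 0 * _) = fun y => c * r y)//; apply/funext => y; rewrite mul0r addr0.
  by rewrite !NM -mulrDr NC ger0_norm ?invr_ge0 ?(ltW nz)// mulVf// gt_eqF.
have jb n : N ((jr n).1 0) <= 1 by have [_ <-] := hjr n; rewrite lerDl N_ge0.
have rb n : N ((jr n).2 0) <= 1 by have [_ <-] := hjr n; rewrite lerDr N_ge0.
have [f1 k1 [l hl]] := bolzano_weierstrassC zK.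
have [f2 k2 [a ha]] := bolzano_weierstrassC (fun n => jb (f1 n)).
have [f3 k3 [b hb]] := bolzano_weierstrassC (fun n => rb (f1 (f2 n))).
pose f n := f1 (f2 (f3 n)).
have fk n : (n <= f n)%N by rewrite (leq_trans (k3 n))// (leq_trans (k2 _))// k1.
have k23 n : (n <= f2 (f3 n))%N by rewrite (leq_trans (k3 n))// k2.
have {}hl : to0 (fun n => N (z (f n) - l)) := to0_sub k23 hl.
have {}ha : to0 (fun n => N ((jr (f n)).1 0 - a)) := to0_sub k3 ha.
have {}hb : to0 (fun n => N ((jr (f n)).2 0 - b)) := hb.
have ef := to0_sub fk e_to0.
have [y hy y0] := Sol_exists l (a, b) hs.
have y1 : y.1 0 = a by case: y0. have y2 : y.2 0 = b by case: y0.
have [e1 he1] : exists e1, forall n, e n <= e1.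
  have /to0P /(_ 1 ltr01) [n0 hn0] := e_to0.
  exists (1 + \sum_(i < n0) e i) => n; have [nn|nn] := leqP n0 n.
    rewrite (le_trans (ler_norm _))// (le_trans (hn0 n nn))// lerDl sumr_ge0// => i _.
    exact: ltW.
  rewrite (bigD1 (Ordinal nn)) //= addrCA lerDl addr_ge0// sumr_ge0// => i _; exact: ltW.
have e10 : 0 <= e1 by exact: le_trans (ltW (e_ge0 0)) (he1 0).
pose C := K + N l + M + e1 * Mt + 1.
have lN := N_ge0 l; have eM0 : 0 <= e1 * Mt by exact: mulr_ge0.
have C0 : 0 < C by rewrite /C; lra.
have snM n t : `|sn n t| <= M + e1 * Mt.
  rewrite /sn (le_trans (ler_normD _ _))// lerD// normrM ler_pM//.
  by rewrite gtr0_norm.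
have B1 t : N (ca l t) <= C by apply: (le_trans (N_ca t (lexx _))); rewrite /C; lra.
have B2 t : N (cb l s t) <= C by apply: (le_trans (N_cb t (lexx _) hM)); rewrite /C; lra.
have B3 n t : N (ca (z n) t) <= C by apply: (le_trans (N_ca t (zK n))); rewrite /C; lra.
have B4 n t : N (cb (z n) (sn n) t) <= C.
  by apply: (le_trans (N_cb t (zK n) (snM n))); rewrite /C; lra.
pose L := 4 * (N (y.1 0) + N (y.2 0)) * expR (4 * C * pi).
have L0 : 0 <= L by rewrite !mulr_ge0 ?expR_ge0 ?addr_ge0 ?N_ge0.
have yL t : N (y.1 t) <= L /\ N (y.2 t) <= L.
  have := sol_bound hy C0 B1 B2 t; rewrite -/L; have := N_ge0 (y.1 t); have := N_ge0 (y.2 t).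
  by split; lra.
pose d n := N ((jr (f n)).1 0 - a) + N ((jr (f n)).2 0 - b).
pose D n := N (z (f n) - l) + e (f n) * Mt.
pose E n := 2 * (2 * d n + 4 * pi * (D n * L)) * expR (4 * C * pi).
have E0 : to0 E.
  have hd : to0 d by exact: to0D.
  have hD : to0 D.
    apply: to0D => //; have := to0Z Mt ef; congr to0; apply/funext => n; exact: mulrC.
  have := to0Z (2 * expR (4 * C * pi)) (to0D (to0Z 2 hd) (to0Z (4 * pi * L) hD)).
  by congr to0; apply/funext => n; rewrite /E; ring.
have close n t : N ((jr (f n)).1 t - y.1 t) <= E n /\ N ((jr (f n)).2 t - y.2 t) <= E n.
  have [hp _] := hjr (f n); have [hS _ _ _] := (psol0 _ _ _ (hsn (f n))).1 hp.
  have D0 : 0 <= D n by rewrite addr_ge0 ?N_ge0 ?mulr_ge0// ltW.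
  have d0 : 0 <= d n by rewrite addr_ge0 ?N_ge0.
  have h1 u : N (ca (z (f n)) u - ca l u) <= D n.
    by rewrite /ca -opprD NN lerDl mulr_ge0// ltW.
  have h2 u : N (cb (z (f n)) (sn (f n)) u - cb l s u) <= D n.
    rewrite /cb /sn -opprD NN.
    rewrite (_ : z (f n) + _ + - _ = (z (f n) - l) + (e (f n) * tau u)%:C); last first.
      by rewrite CD; ring.
    apply: (le_trans (leND _ _)); rewrite lerD2l NC normrM gtr0_norm//.
    by apply: ler_wpM2l; [exact: ltW|exact: hMt].
  have h3 : N ((jr (f n)).1 0 - y.1 0) <= d n by rewrite y1 lerDl N_ge0.
  have h4 : N ((jr (f n)).2 0 - y.2 0) <= d n by rewrite y2 lerDr N_ge0.
  have := sol_sub hS hy C0 d0 D0 L0 (B3 (f n)) (B4 (f n)) h1 h2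
    (fun t => (yL t).1) (fun t => (yL t).2) h3 h4 t.
  rewrite -/(E n); have := N_ge0 ((jr (f n)).1 t - y.1 t); have := N_ge0 ((jr (f n)).2 t - y.2 t).
  by split; lra.
have [by1 by2] := sol_bm hy; have [_ _ hy1 hy2] := hy.
have Ele k c : (forall n, c <= k * E n) -> c <= 0 by exact: to0_le_cst (to0Z k E0).
have pj : y.1 (2 * pi) = y.1 0.
  apply/eqP; rewrite -subr_eq0 -N_eq0 eq_le N_ge0 andbT; apply: (Ele 2) => n.
  have [hp _] := hjr (f n); have [_ _ pjn _ _] := hp.
  rewrite (_ : _ - _ = ((jr (f n)).1 0 - y.1 0) - ((jr (f n)).1 (2 * pi) - y.1 (2 * pi))).
    by apply: (le_trans (leNB _ _)); have [c1 _] := close n 0; have [c2 _] := close n (2 * pi); lra.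
  by rewrite pjn; ring.
have pr : y.2 (2 * pi) = y.2 0.
  apply/eqP; rewrite -subr_eq0 -N_eq0 eq_le N_ge0 andbT; apply: (Ele 2) => n.
  have [hp _] := hjr (f n); have [_ _ _ prn _] := hp.
  rewrite (_ : _ - _ = ((jr (f n)).2 0 - y.2 0) - ((jr (f n)).2 (2 * pi) - y.2 (2 * pi))).
    by apply: (le_trans (leNB _ _)); have [_ c1] := close n 0; have [_ c2] := close n (2 * pi); lra.
  by rewrite prn; ring.
have bjr n : bm (jr (f n)).1 /\ bm (jr (f n)).2.
  by have [[h1 h2 _ _ _] _] := hjr (f n); split; [exact: prim_bm h1|exact: prim_bm h2].
have ri : cintegral y.2 = 0.
  apply/eqP; rewrite -N_eq0 eq_le N_ge0 andbT; apply: (Ele (2 * pi)) => n.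
  have [[_ _ _ _ rn] _] := hjr (f n); have [_ b2] := bjr n.
  rewrite -NN -[X in N X]add0r -rn -cintegralB; [|exact: bm_cint|exact: bm_cint].
  apply: le_N_cintegral_bd => [|t _]; first by apply: bm_cint; exact: bmB.
  by have [_] := close n t.
have nz : 0 < N (y.1 0) + N (y.2 0).
  suff : 1 - (N (y.1 0) + N (y.2 0)) <= 0 by lra.
  apply: (Ele 2) => n; have [_ en] := hjr (f n); have [c1 c2] := close n 0.
  have := leND ((jr (f n)).1 0 - y.1 0) (y.1 0); have := leND ((jr (f n)).2 0 - y.2 0) (y.2 0).
  by rewrite !subrK; lra.
exists l, y.1, y.2; split => //; first by apply/psol0.
  rewrite -subr_le0; apply: (to0_le_cst (to0D (to0M ef ef) hl)) => n.
  have := zx (f n); have := Re_leN (z (f n) - l); rewrite ReB ler_norml expr2 => /andP[_].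
  by lra.
move=> lx; set T := cintegral _; set B := cintegral _.
pose Bn n := cintegral (fun t => y.2 t * (jr (f n)).2 t - y.1 t * (jr (f n)).1 t).
pose Tn n := cintegral (fun t => (tau t)%:C * (y.1 t * (jr (f n)).1 t)).
have btau : bm (fun t => (tau t)%:C) by exact: bmC.
(* An exact identity: [Bn] and [Tn] mix the perturbed eigenvector with the limit, so no second-order
   term appears. *)
have idn n : (z (f n) - l) * Bn n = (e (f n))%:C * Tn n.
  have [[h1 h2 pjn prn _] _] := hjr (f n); have [b1 b2] := bjr n.
  have := prim_2pi (primB (primM hy1 h2) (primM hy2 h1)).
  rewrite pj pr pjn prn -[X in X = _]addr0 => /addrI/esym.
  rewrite (_ : (fun t => _) = (fun t => (z (f n) - l) *
      (y.2 t * (jr (f n)).2 t - y.1 t * (jr (f n)).1 t) -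
      (e (f n))%:C * ((tau t)%:C * (y.1 t * (jr (f n)).1 t)))); last first.
    apply/funext => t; have sE : (sn (f n) t)%:C = (s t)%:C + (e (f n))%:C * (tau t)%:C :> R[i].
      by rewrite -CM -CD.
    by rewrite /ca /cb sE; ring.
  have i1 : cint (fun t => y.2 t * (jr (f n)).2 t - y.1 t * (jr (f n)).1 t).
    by apply: bm_cint; apply: bmB; exact: bmM.
  have i2 : cint (fun t => (tau t)%:C * (y.1 t * (jr (f n)).1 t)).
    by apply: bm_cint; apply: bmM => //; exact: bmM.
  rewrite cintegralB ?cintegralZ//; [|exact: cintZ|exact: cintZ].
  by move/eqP; rewrite subr_eq0 => /eqP.
pose be := 4 * pi * L; pose ta := 2 * pi * (Mt * L).
have E_ge0 n : 0 <= E n by have [h _] := close n 0; exact: le_trans (N_ge0 _) h.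
have Bc n : N (Bn n - B) <= be * E n.
  have [b1 b2] := bjr n.
  have i1 : bm (fun t => y.2 t * (jr (f n)).2 t - y.1 t * (jr (f n)).1 t).
    by apply: bmB; exact: bmM.
  have i2 : bm (fun t => y.2 t ^+ 2 - y.1 t ^+ 2).
    by apply: bmB; under eq_fun do rewrite expr2; exact: bmM.
  rewrite /Bn /B -cintegralB; [|exact: bm_cint|exact: bm_cint].
  have -> : be * E n = 2 * pi * (L * E n + L * E n) by rewrite /be; ring.
  apply: le_N_cintegral_bd => [|t _]; first by apply: bm_cint; exact: bmB.
  have [c1 c2] := close n t; have [L1 L2] := yL t.
  rewrite (_ : _ - _ = y.2 t * ((jr (f n)).2 t - y.2 t) - y.1 t * ((jr (f n)).1 t - y.1 t)); last by ring.
  by apply: (le_trans (leNB _ _)); apply: lerD; rewrite NM; apply: ler_pM; rewrite ?N_ge0.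
have Tc n : N (Tn n - T) <= ta * E n.
  have [b1 b2] := bjr n.
  have i1 : bm (fun t => (tau t)%:C * (y.1 t * (jr (f n)).1 t)).
    by apply: bmM => //; exact: bmM.
  have i2 : bm (fun t => (tau t)%:C * y.1 t ^+ 2).
    by apply: bmM => //; under eq_fun do rewrite expr2; exact: bmM.
  rewrite /Tn /T -cintegralB; [|exact: bm_cint|exact: bm_cint].
  have -> : ta * E n = 2 * pi * (Mt * (L * E n)) by rewrite /ta; ring.
  apply: le_N_cintegral_bd => [|t _]; first by apply: bm_cint; exact: bmB.
  have [c1 c2] := close n t; have [L1 L2] := yL t.
  rewrite (_ : _ - _ = (tau t)%:C * (y.1 t * ((jr (f n)).1 t - y.1 t))); last by ring.
  rewrite NM NC; apply: ler_pM => //; first exact: N_ge0.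
  by rewrite NM; apply: ler_pM; rewrite ?N_ge0.
have be0 : 0 <= be by rewrite /be mulr_ge0// mulr_ge0// ltW// pi_gt0.
have BnN n : N (Bn n) <= N B + be * E n.
  by have := leND (Bn n - B) B; rewrite subrK; have := Bc n; lra.
pose Gn n := N B ^+ 2 * e (f n) + 2 * N B * be * (e (f n) * E n) +
  be ^+ 2 * (e (f n) * (E n * E n)) + (ta * N B * E n + ta * be * (E n * E n)) + N T * be * E n.
have Gn0 : to0 Gn.
  have EE := to0M E0 E0; have eE := to0M ef E0; have eEE := to0M ef EE.
  apply: to0D; last exact: to0Z.
  apply: to0D; last by apply: to0D; exact: to0Z.
  by apply: to0D; [apply: to0D|]; exact: to0Z.
rewrite -oppr_le0; apply: (to0_le_cst Gn0) => n.
have en := e_ge0 (f n).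
have h1 : - (e (f n) * N (Bn n) ^+ 2) <= Re (Tn n * conjc (Bn n)).
  have /(congr1 (fun w => Re (w * conjc (Bn n)))) := idn n.
  rewrite -!mulrA N_mulJ [LHS]ReM ReC ImC mulr0 subr0 [RHS]ReM ReC ImC mul0r subr0 => idR.
  have h := zx (f n); rewrite -lx in h; rewrite ReB in idR.
  rewrite -(ler_pM2l en) -idR.
  have : - (e (f n)) ^+ 2 * N (Bn n) ^+ 2 <= (Re (z (f n)) - Re l) * N (Bn n) ^+ 2.
    by rewrite ler_wpM2r ?sqr_ge0//; lra.
  by apply: le_trans; rewrite le_eqVlt; apply/orP; left; apply/eqP; ring.
have h2 : N (Tn n * conjc (Bn n) - T * conjc B) <= ta * E n * (N B + be * E n) + N T * (be * E n).
  rewrite (_ : _ - _ = (Tn n - T) * conjc (Bn n) + T * conjc (Bn n - B)); last first.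
    have -> : conjc (Bn n - B) = conjc (Bn n) - conjc B by apply: ceqP; rewrite !reimE; ring.
    ring.
  apply: (le_trans (leND _ _)); rewrite !NM !NJ; apply: lerD; apply: ler_pM; rewrite ?N_ge0//.
have h3 : e (f n) * N (Bn n) ^+ 2 <= e (f n) * (N B + be * E n) ^+ 2.
  rewrite ler_wpM2l ?(ltW en)// ler_pXn2r ?nnegrE ?N_ge0//.
  by apply: addr_ge0; [exact: N_ge0|exact: mulr_ge0].
have h4 := Re_leN (Tn n * conjc (Bn n) - T * conjc B); rewrite ReB ler_norml in h4.
have {h4} /andP[_ h4] := h4.
have -> : Gn n = e (f n) * (N B + be * E n) ^+ 2 + (ta * E n * (N B + be * E n) + N T * (be * E n)).
  by rewrite /Gn; ring.
have := le_trans h4 h2; lra.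
Qed.

End Limit.
End Perturbation.

(** * The first variation at an optimal rate *)

Section FirstVariation.
Variable R : realType.
Let mu := torus R.
Implicit Types (s tau : R -> R) (z l : R[i]) (j r : R -> R[i]).

(** For the second part: otherwise [eig_exists] would yield eigenvalues with imaginary part above
    [|Im l|], hence distinct from [l] and its conjugate, and with real parts as close to [Re l] as
    desired or larger. The rest of the spectrum would then reach [Re l]. *)
Lemma gap_rest s l : rbm s -> gap_determined_by s l ->
  (forall z, peig s z -> z != l -> z != conjc l -> Re z < Re l) /\ - (J s / (4 * pi)) < Re l.
Proof.
move=> hs [_]; set S := [set _ | _ in _] => Sl.
have inS z : peig s z -> z != l -> z != conjc l -> ((Re z)%:E <= ereal_sup S)%E.
  move=> /(spectrumP _ hs) hz zl zl'; apply: ereal_sup_ubound; exists z => //.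
  by split => // -[] /eqP; [rewrite (negbTE zl)|rewrite (negbTE zl')].
split.
  by move=> z hz zl zl'; rewrite -lte_fin (le_lt_trans (inS z hz zl zl')).
have pi0 := pi_gt0 R.
rewrite ltNge; apply/negP => lJ.
have [n hn] : exists n : nat, `|Im l| < n%:R.
  by exists (Num.bound `|Im l|); exact: archi_boundP.
have ex rho : 0 < rho -> 2 * pi * rho <= 1 -> ((Re l - rho)%:E <= ereal_sup S)%E.
  move=> r0 r1; have [z [hz zRe zIm]] := eig_exists n hs r0 r1.
  apply: (@le_trans _ _ (Re z)%:E); first by rewrite lee_fin; lra.
  have hI := ler_norm (Im l); have hI' := ler_norm (- Im l); rewrite normrN in hI'.
  apply: inS => //; apply/negP => /eqP e; move: zIm; rewrite e ?ImJ; lra.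
have rho0 : 0 < (4 * pi)^-1 :> R by rewrite invr_gt0 mulr_gt0.
have c1 : 2 * pi * (4 * pi)^-1 <= 1 :> R.
  by move: (pi : R) pi0 => q q0; rewrite -[_^-1]mul1r mulrA ler_pdivrMr ?mulr_gt0//; lra.
have := ex _ rho0 c1; case E : (ereal_sup S) Sl ex => [y| |] //.
rewrite lte_fin => yl ex _.
pose rho := Num.min (4 * pi)^-1 ((Re l - y) / 2).
have r0 : 0 < rho by rewrite lt_min rho0/=; lra.
have := ex rho r0; rewrite lee_fin => /(_ _) h.
have : Re l - rho <= y.
  apply: h; apply: le_trans c1; rewrite ler_pM2l ?twopi_gt0//.
  by rewrite ge_min lexx.
have : rho <= (Re l - y) / 2 by rewrite ge_min lexx orbT.
lra.
Qed.

Lemma gap_le_exists s t (x e : R) : rbm t -> spectral_gap s = (- x)%:E ->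
  (spectral_gap t <= spectral_gap s)%E -> 0 < e -> exists2 z, peig t z & x - e <= Re z.
Proof.
move=> ht ->; rewrite /spectral_gap EFinN leeN2 => h e0.
have [_ [z /(spectrumP _ ht) hz <-]] : exists2 y, [set (Re z)%:E | z in spectrum t] y & ((x - e)%:E < y)%E.
  by apply: ereal_sup_gt; apply: lt_le_trans h; rewrite lte_fin; lra.
by rewrite lte_fin => h2; exists z => //; exact: ltW.
Qed.

Section Variation.
Variables (s tau : R -> R) (l : R[i]) (d : R).
Hypotheses (hs : rbm s) (s0 : forall x, 0 <= s x) (htau : rbm tau) (d0 : 0 < d).
Hypothesis feasible : forall e x, 0 < e <= d -> 0 <= s x + e * tau x.
Hypothesis optimal : forall e : R, 0 < e <= d ->
  (spectral_gap (fun x => s x + e * tau x)%R <= spectral_gap s)%E.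
Hypotheses (sl : simple_eigenvalue s l) (gl : gap_determined_by s l).

Let e (n : nat) := d * n.+1%:R^-1.
Let sn n x := s x + e n * tau x.

Let e_itv n : 0 < e n <= d.
Proof.
by rewrite /e mulr_gt0 ?invr_gt0//= -[leRHS]mulr1 ler_pM2l// invf_le1// ler1n.
Qed.
Let e_to0 : to0 e. Proof. exact: to0Z (@to0_invS R). Qed.
Let hsn n : rbm (sn n).
Proof. by apply: rbmD => //; apply: rbmM => //; exact: rbm_cst. Qed.

(** Optimality gives eigenvalues within [e n ^+ 2] of the best real part. If their imaginary parts
    were unbounded, the oscillation would tend to 0 along a subsequence, against the lower bound of
    [eig_highfreq]. *)
Lemma optimal_sequence : exists z : nat -> R[i], (forall n, peig (sn n) (z n)) /\
  exists n0 K, forall n, Re l - e n ^+ 2 <= Re (z n) /\ N (z (n + n0)%N) <= K.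
Proof.
have [gE _] := gl.
have /choice[z hz] n : exists z, peig (sn n) z /\ Re l - e n ^+ 2 <= Re z.
  have [|z h1 h2] := gap_le_exists (hsn n) gE (optimal (e_itv n)) (_ : 0 < e n ^+ 2).
    by rewrite exprn_gt0//; case/andP: (e_itv n).
  by exists z.
exists z; split; first by move=> n; case: (hz n).
have [_ lJ] := gap_rest hs gl.
have [_ [M0 hM0]] := hs; have [_ [Mt hMt]] := htau.
have Mt0 : 0 <= Mt by rewrite (le_trans _ (hMt 0)).
pose M := M0 + d * Mt.
have hM t : `|s t| <= M by rewrite (le_trans (hM0 t))// lerDl mulr_ge0// ltW.
have hMn n t : `|sn n t| <= M.
  have /andP[e0 ed] := e_itv n; rewrite (le_trans (ler_normD _ _))// lerD//.
  by rewrite normrM gtr0_norm// ler_pM// ltW.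
have sn0 n t : 0 <= sn n t by exact: feasible.
pose B := `|Re l| + d ^+ 2.
have hB n : `|Re (z n)| <= B.
  have [h1 h2] := hz n; have h3 := peig_Re_le0 (hsn n) (sn0 n) h1.
  have /andP[e0 ed] := e_itv n.
  have : e n ^+ 2 <= d ^+ 2 by rewrite ler_pXn2r ?nnegrE// ltW.
  have := ler_norm (- Re l); rewrite normrN (ler0_norm h3) /B; lra.
(* One number serves as shift and as bound, so that the negation provides, for each [k], an index at
   least [k] with imaginary part beyond [k]. *)
suff [n0 hn0] : exists n0 : nat, forall n, `|Im (z (n + n0)%N)| <= n0%:R.
  exists n0, (B + n0%:R) => n; split; first by case: (hz n).
  exact: le_trans (N_leRI _) (lerD (hB _) (hn0 n)).
apply: contrapT => H.
have /choice[g0 hg0] k : exists n, k%:R < `|Im (z (n + k)%N)|.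
  apply: contrapT => h; apply: H; exists k => n; rewrite leNgt; apply/negP => h2.
  by apply: h; exists n.
pose g k := (g0 k + k)%N.
have gk k : (k <= g k)%N by rewrite leq_addl.
have dto0 : to0 (fun k => Mt * e (g k)) by apply: to0Z; exact: to0_sub.
have dist k t : `|sn (g k) t - s t| <= Mt * e (g k).
  rewrite /sn addrC addKr normrM mulrC; have /andP[e0 _] := e_itv (g k).
  by rewrite (gtr0_norm e0); apply: ler_wpM2r; [exact: ltW|exact: hMt].
have [f fk osc0] := osc2_subseq hs (fun k => hsn (g k)) hM (fun k => hMn (g k)) dto0 dist
  (fun k => hB (g k)) (fun k => ltW (hg0 k)).
(* Half the distance from [Re l] to the clustering line of [s]. The other half absorbs, for large
   [n], the slack [e n ^+ 2] and the displacement of that line when [s] becomes [sn n]. *)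
pose k0 := (Re l + J s / (4 * pi)) / 2.
have k00 : 0 < k0 by rewrite /k0; lra.
have gf k : (k <= g (f k))%N by rewrite (leq_trans (fk k)).
have w0 : to0 (fun n => e n * e n + (- (J tau / (4 * pi))) * e n).
  by apply: to0D; [exact: to0M|exact: to0Z].
have /to0P /(_ k0 k00) [n1 hn1] := w0.
have M_ge0 : 0 <= M by exact: le_trans (normr_ge0 _) (hM 0).
have fin k : 1 - expR (- (2 * pi * k0)) <=
    2 * Qk B M * osc2 (z (g (f (k + n1)%N))) (sn (g (f (k + n1)%N))).
  set n := g (f (k + n1)%N).
  have nn : (n1 <= n)%N by rewrite (leq_trans _ (gf _))// leq_addl.
  have [j [r [[hS pj pr nz] ri]]] := (hz n).1.
  rewrite -[leRHS]mulrA; apply: (eig_highfreq (hsn n) (hB n) (hMn n) hS pj pr nz k00).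
  have Jn : J (sn n) = J s + e n * J tau.
    rewrite /sn JD; [|exact: rbm_rint|by apply: rintZ; exact: rbm_rint].
    by rewrite JZ//; exact: rbm_rint.
  have := hn1 n nn; rewrite ler_norml => /andP[_ h1]; have [_ h2] := hz n.
  rewrite Jn; rewrite expr2 in h2.
  have -> : (J s + e n * J tau) / (4 * pi) = J s / (4 * pi) + J tau / (4 * pi) * e n.
    by move: (_^-1) => q; ring.
  by move: h1 h2; rewrite /k0; move: (J s / _) (J tau / _) => u v; nra.
have h0 := to0_sub (fun k => leq_addr n1 k) osc0.
have := to0_le_cst (to0Z (2 * Qk B M) h0) fin.
have : expR (- (2 * pi * k0)) < 1 by rewrite expR_lt1 oppr_lt0 mulr_gt0// twopi_gt0.
lra.
Qed.

(** The limit eigenvalue is [l] or its conjugate. Replacing the limit eigenvector by its conjugate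
    leaves the real part unchanged, and replacing it by [c] times itself multiplies the expression
    by [|c|^4], so the sign transfers to [(j, r)]. *)
Lemma first_variation j r : psol l s (fun=> 0) (fun=> 0) j r ->
  0 <= Re (cintegral (fun y => (tau y)%:C * j y ^+ 2) *
           conjc (cintegral (fun y => r y ^+ 2 - j y ^+ 2))).
Proof.
move=> h; have [z [hz [n0 [K hK]]]] := optimal_sequence.
have [rest _] := gap_rest hs gl.
have e0 n : 0 < e (n + n0)%N by case/andP: (e_itv (n + n0)%N).
have et := to0_sub (fun k => leq_addr n0 k) e_to0.
have [l' [j' [r' [h' nz' xl' pos]]]] := limit_peig hs htau e0 et
  (fun n => hz (n + n0)%N) (fun n => (hK n).2) (fun n => (hK (n + n0)%N).1).
have hl' : peig s l' by apply/(peig_psol0 _ hs); exists j', r'.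
have [hj hr _ _ _] := h; have bj := prim_bm hj; have br := prim_bm hr.
have btau : bm (fun t => (tau t)%:C) by exact: bmC.
have main j1 r1 : psol l s (fun=> 0) (fun=> 0) j1 r1 -> 0 < N (j1 0) + N (r1 0) ->
    0 <= Re (cintegral (fun y => (tau y)%:C * j1 y ^+ 2) *
             conjc (cintegral (fun y => r1 y ^+ 2 - j1 y ^+ 2))) ->
    0 <= Re (cintegral (fun y => (tau y)%:C * j y ^+ 2) *
             conjc (cintegral (fun y => r y ^+ 2 - j y ^+ 2))).
  move=> h1 nz1; have [c hc] := simple_unique hs sl h1 nz1 h.
  have [hj1 hr1 _ _ _] := h1; have bj1 := prim_bm hj1; have br1 := prim_bm hr1.
  have jj : bm (fun y => j1 y ^+ 2) by under eq_fun do rewrite expr2; exact: bmM.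
  have rr : bm (fun y => r1 y ^+ 2) by under eq_fun do rewrite expr2; exact: bmM.
  rewrite (_ : (fun y => (tau y)%:C * j y ^+ 2) = fun y => c ^+ 2 * ((tau y)%:C * j1 y ^+ 2)); last first.
    by apply/funext => y; have [-> _] := hc y; ring.
  rewrite (_ : (fun y => r y ^+ 2 - j y ^+ 2) = fun y => c ^+ 2 * (r1 y ^+ 2 - j1 y ^+ 2)); last first.
    by apply/funext => y; have [-> ->] := hc y; ring.
  rewrite !cintegralZ; [|exact: bm_cint (bmB rr jj)|exact: bm_cint (bmM btau jj)].
  set T := cintegral _; set B := cintegral _ => hTB.
  rewrite (_ : c ^+ 2 * T * conjc (c ^+ 2 * B) = (c ^+ 2 * conjc (c ^+ 2)) * (T * conjc B)).
    by rewrite N_mulJ ReM ReC ImC mul0r subr0 mulr_ge0// sqr_ge0.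
  by rewrite rmorphM /=; ring.
have [ll|ll] := eqVneq l' l; first by rewrite ll in h' pos; exact: main h' nz' (pos erefl).
have [lc|lc] := eqVneq l' (conjc l); last by have := rest _ hl' ll lc; rewrite ltNge xl'.
have rl : Re l' = Re l by rewrite lc ReJ.
have lcl : conjc l' = l by rewrite lc conjcK.
have [hj' hr' pj' pr' ri'] := h'; have bj' := prim_bm hj'; have br' := prim_bm hr'.
apply: (main (fun y => conjc (j' y)) (fun y => conjc (r' y))).
- split; rewrite ?pj' ?pr'//.
  + apply: prim_eq (primJ hj') _ => y; rewrite /ca -lcl.
    by rewrite !addr0 rmorphM rmorphN.
  + apply: prim_eq (primJ hr') _ => y; rewrite /cb -lcl !addr0.
    by apply: ceqP; rewrite !reimE; ring.
  + by rewrite cintegralJ ?ri' ?rmorph0//; exact: bm_cint.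
- by rewrite !NJ.
have jj : bm (fun y => j' y ^+ 2) by under eq_fun do rewrite expr2; exact: bmM.
have rr : bm (fun y => r' y ^+ 2) by under eq_fun do rewrite expr2; exact: bmM.
have := pos rl; set T := cintegral _; set B := cintegral _ => hTB.
rewrite (_ : cintegral _ = conjc T); last first.
  rewrite /T -cintegralJ; last exact: bm_cint (bmM btau jj).
  by congr cintegral; apply/funext => y; apply: ceqP; rewrite !expr2 !reimE; ring.
rewrite (_ : cintegral _ = conjc B); last first.
  rewrite /B -cintegralJ; last exact: bm_cint (bmB rr jj).
  by congr cintegral; apply/funext => y; apply: ceqP; rewrite !expr2 !reimE; ring.
by move: hTB; rewrite !reimE; congr (_ <= _); ring.
Qed.

End Variation.
End FirstVariation.

(** * Derivatives at maximum points *)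

Section CriticalSet.
Variable R : realType.
Let mu := torus R.

Lemma rmeas_eq0 (h : R -> R) : rmeas h -> rmeas (fun x => if h x == 0 then 1 else 0).
Proof.
move=> mh; apply: measurable_fun_ifT => //; try exact: measurable_cst.
by apply: measurable_fun_eqr => //; exact: measurable_cst.
Qed.

(* The derivative of a periodic function vanishes at almost every maximum:
   [\exp(n h) / n] tends to [0] uniformly while its derivative tends to that of
   [h] on [h = 0] and to [0] elsewhere. *)
Lemma derivative_at_max (h h1 : R -> R) : rbm h1 -> (forall x, h x = h 0 + Pr h1 x) ->
  h (2 * pi) = h 0 -> {ae mu, forall x, h x <= 0} -> {ae mu, forall x, h x = 0 -> h1 x = 0}.
Proof.
move=> bh1 hE hp h_le0; have ih1 := rbm_rint bh1.
have bh : rbm h.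
  have := rbmD (rbm_cst (h 0)) (rbm_Pr ih1); congr rbm.
  by apply/funext => x; rewrite -hE.
have [mh _] := bh; have [mh1 [K hK]] := bh1.
pose Z x : R := if h x == 0 then 1 else 0.
have mZ : rmeas Z := rmeas_eq0 mh.
have bZ : rbm Z.
  by split => //; exists 1 => x; rewrite /Z; case: ifP; rewrite ?normr1 ?normr0.
have bZh : rbm (fun x => h1 x * Z x) by exact: rbmM.
suff : {ae mu, forall x, h1 x * Z x = 0}.
  by apply: aeS => x + hx; rewrite /Z hx eqxx mulr1.
apply: trig_dense => [|k c]; first exact: rbm_rint.
pose E n x : R := expR (n%:R * h x).
have bcos := rbm_cos (R := R) k%:~R c.
have pE n : prim (fun x => (E n x)%:C) (fun x => (n%:R * h1 x * E n x)%:C).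
  have := primZ (expR (n%:R * h 0))%:C (prim_expR (rintZ n%:R ih1)).
  have e x : expR (n%:R * h 0) * expR (Pr (fun t => n%:R * h1 t) x) = E n x.
    by rewrite -expRD (Pr_scale n%:R x ih1) -mulrDr -hE.
  rewrite (_ : (fun x => _ * _) = fun x => (E n x)%:C); last by apply/funext => x; rewrite -CM e.
  by move/prim_eq; apply => x; rewrite -CM -e; congr (_%:C); ring.
have bE n : rbm (E n).
  by have := bm_rbm_Re (prim_bm (pE n)).
have iE n : J (fun x => h1 x * E n.+1 x * cos (k%:~R * x + c)) =
    - (n.+1%:R^-1 * J (fun x => E n.+1 x * (k%:~R * cos (k%:~R * x + c + pi / 2)))).
  have n0 : n.+1%:R != 0 :> R by rewrite pnatr_eq0.
  have per : (E n.+1 (2 * pi))%:C = (E n.+1 0)%:C :> R[i] by rewrite /E hp.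
  have := prim_weak (pE n.+1) per (smooth_periodic_cos k c); rewrite derive1_cos.
  rewrite !cintegralE => -[+ _].
  rewrite (_ : (fun x => _ - 0 * 0) = fun x => E n.+1 x * (k%:~R * cos (k%:~R * x + c + pi / 2))); last first.
    by apply/funext => x; rewrite mul0r subr0.
  move=> ->; rewrite (_ : (fun x => _ - 0 * 0) = fun x => n.+1%:R * (h1 x * E n.+1 x * cos (k%:~R * x + c))); last first.
    by apply/funext => x; ring.
  rewrite JZ; first by rewrite mulrN opprK mulKf.
  by apply: rbm_rint; apply: rbmM => //; exact: rbmM.
(* [- |h x|] agrees with [h x] almost everywhere and makes the domination by [K] valid at every
   point. *)
pose f n x := h1 x * expR (- (n.+1%:R * `|h x|)) * cos (k%:~R * x + c).
have K0 : 0 <= K by exact: le_trans (normr_ge0 _) (hK 0).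
have b2 n : rbm (fun x => expR (- (n.+1%:R * `|h x|))).
  split; last first.
    by exists 1 => x; rewrite ger0_norm ?expR_ge0// -expR0 ler_expR oppr_le0 mulr_ge0.
  apply: measurableT_comp => //; apply: rmeasN; apply: rmeasM; first exact: rmeas_cst.
  exact: rmeas_norm.
have fE n : J (f n) = J (fun x => h1 x * E n.+1 x * cos (k%:~R * x + c)).
  apply: J_ae.
  - by apply: rmeasM; [apply: rmeasM => //; case: (b2 n)|case: bcos].
  - by apply: rmeasM; [apply: rmeasM => //; case: (bE n.+1)|case: bcos].
  - by apply/ae_eqP; apply: aeS h_le0 => x hx; rewrite /f /E ler0_norm// mulrN opprK.
have bf n : rbm (f n) by apply: rbmM => //; exact: rbmM.
have Jf n : `|J (f n)| <= 2 * pi * `|k%:~R| * n.+1%:R^-1.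
  rewrite fE iE normrN normrM gtr0_norm ?invr_gt0// mulrC ler_wpM2r ?invr_ge0//.
  have bp := rbm_cos (R := R) k%:~R (c + pi / 2).
  have i1 : rint (fun x => E n.+1 x * (k%:~R * cos (k%:~R * x + c + pi / 2))).
    apply: rbm_rint; apply: rbmM => //; apply: rbmM; first exact: rbm_cst.
    by move: bp; congr rbm; apply/funext => x; rewrite addrA.
  apply: (le_trans (norm_J i1)); rewrite -J_cst; apply: le_J_ae; [exact: rint_norm|exact: rint_cst|].
  apply: aeS h_le0 => x hx; rewrite !normrM mulrC -[leRHS]mulr1; apply: ler_pM => //.
    by rewrite -[leRHS]mulr1 ler_wpM2l// ler_norml cos_geN1 cos_le1.
  by rewrite ger0_norm ?expR_ge0// -expR0 ler_expR mulr_ge0_le0.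
have f0 : to0 (fun n => `|J (f n)|).
  apply: (to0_le _ (to0Z (2 * pi * `|k%:~R|) (@to0_invS R))) => n.
  by rewrite normr_id.
have bl : rbm (fun x => h1 x * Z x * cos (k%:~R * x + c)) by exact: rbmM.
have D : to0 (fun n => J (fun x => `|f n x - h1 x * Z x * cos (k%:~R * x + c)|)).
  apply: (@J_dct R f _ (fun=> K)); [by move=> n; case: (bf n)|by case: bl|exact: rint_cst| |].
    move=> n x; rewrite /f !normrM -[leRHS]mulr1; apply: ler_pM => //; last exact: cos_max.
    rewrite -[leRHS]mulr1; apply: ler_pM => //.
    by rewrite ger0_norm ?expR_ge0// -expR0 ler_expR oppr_le0 mulr_ge0.
  move=> x _; rewrite /f /Z; have [hx|hx] := eqVneq (h x) 0.
    rewrite (_ : (fun n => _) = fun=> 0); first exact: cvg_cst.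
    by apply/funext => n; rewrite hx normr0 mulr0 oppr0 expR0 subrr.
  have h0 : 0 < `|h x| by rewrite normr_gt0.
  apply: (to0_le _ (to0Z (K / `|h x|) (@to0_invS R))) => n.
  rewrite mulr0 mul0r subr0 !normrM -[leRHS]mulr1; apply: ler_pM => //; last exact: cos_max.
  rewrite -mulrA; apply: ler_pM => //; rewrite -invfM ger0_norm ?expR_ge0// expRN.
  rewrite lef_pV2 ?posrE ?expR_gt0 ?mulr_gt0// mulrC.
  by apply: le_trans (expR_ge1Dx _); rewrite lerDr.
apply/eqP; rewrite -normr_le0; apply: (to0_le_cst (to0D D f0)) => n.
rewrite -lerBlDr -[X in X - _]normrN; apply: le_trans (lerB_normD _ _) _.
rewrite addrC -JB; [exact: norm_J (rintB (rbm_rint (bf n)) (rbm_rint bl))|exact: rbm_rint|exact: rbm_rint].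
Qed.

End CriticalSet.

(** * Consequences of optimality and the contradiction *)

Section Rigidity.
Variable R : realType.
Let mu := torus R.
Variables (s : R -> R) (l : R[i]) (j r : R -> R[i]) (eps : R).
Hypotheses (hs : rbm s) (s0 : forall x, 0 <= s x) (eps0 : 0 < eps).
Hypothesis optimal : forall t, rbm t -> (forall x, 0 <= t x) -> (forall x, `|t x - s x| <= eps) ->
  (spectral_gap t <= spectral_gap s)%E.
Hypotheses (sl : simple_eigenvalue s l) (gl : gap_determined_by s l).
Hypotheses (hjr : psol l s (fun=> 0) (fun=> 0) j r) (nz : 0 < N (j 0) + N (r 0)).

Let B := cintegral (fun y => r y ^+ 2 - j y ^+ 2).
(** This is [w] multiplied by [|B|^2], which avoids division by [B]. *)
Let W y := - (j y ^+ 2 * conjc B).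
Let h y := Re (W y).

Let bj : bm j. Proof. by case: hjr => h1 _ _ _ _; exact: prim_bm h1. Qed.
Let br : bm r. Proof. by case: hjr => _ h1 _ _ _; exact: prim_bm h1. Qed.
Let bjj : bm (fun y => j y ^+ 2). Proof. by under eq_fun do rewrite expr2; exact: bmM. Qed.
Let brr : bm (fun y => r y ^+ 2). Proof. by under eq_fun do rewrite expr2; exact: bmM. Qed.
Let bW : bm W. Proof. by apply: bmN; apply: bmM => //; exact: bm_cst. Qed.
Let bh : rbm h. Proof. exact: bm_rbm_Re bW. Qed.

Let B0 : B != 0.
Proof. by apply: (simple_form_neq0 hs _ sl hjr nz); apply: ae_torus => x _. Qed.

Let NB0 : 0 < N B ^+ 2. Proof. by rewrite exprn_gt0// N_gt0. Qed.

Let conjcM (a b : R[i]) : conjc (a * b) = conjc a * conjc b.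
Proof. by apply: ceqP; rewrite !reimE; ring. Qed.

Lemma variation_le0 tau c : rbm tau -> 0 < c ->
  (forall e x, 0 < e <= c -> 0 <= s x + e * tau x) -> J (fun x => tau x * h x) <= 0.
Proof.
move=> ht c0 hf; have [_ [M hM]] := ht.
have M0 : 0 <= M by rewrite (le_trans _ (hM 0)).
have M1 : 0 < M + 1 by rewrite ltr_wpDl.
(* The second bound keeps [s + e tau] within [eps] of [s]. *)
pose d := Num.min c (eps / (M + 1)).
have d0 : 0 < d by rewrite lt_min c0 divr_gt0.
have dc e : 0 < e <= d -> 0 < e <= c.
  by move=> /andP[-> ed] /=; rewrite (le_trans ed)// ge_min lexx.
have opt (e : R) : 0 < e <= d -> (spectral_gap (fun x => s x + e * tau x)%R <= spectral_gap s)%E.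
  move=> he; apply: optimal; first by apply: rbmD => //; apply: rbmM => //; exact: rbm_cst.
    by move=> x; apply: hf; exact: dc.
  move=> x; rewrite addrC addKr normrM; case/andP: he => e0 ed; rewrite gtr0_norm//.
  have ee : e <= eps / (M + 1) by rewrite (le_trans ed)// ge_min lexx orbT.
  rewrite (le_trans (ler_pM _ _ ee (hM x)))//; first exact: ltW.
  by rewrite mulrAC ler_pdivrMr// ler_pM2l// lerDl.
have := first_variation hs ht d0 (fun e x he => hf e x (dc e he)) opt sl gl hjr.
have bt : bm (fun y => (tau y)%:C : R[i]) by exact: bmC.
rewrite -/B [X in Re X]mulrC -cintegralZ; last exact: bm_cint (bmM bt bjj).
rewrite Re_cintegral (_ : (fun x => Re _) = fun x => - (tau x * h x)).
  by rewrite JN ?oppr_ge0//; apply: rbm_rint; exact: rbmM.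
by apply/funext => x; rewrite mulrC -mulrA [LHS]ReM ReC ImC mul0r subr0 /h /W ReN; ring.
Qed.

Lemma h_le0 : {ae mu, forall x, h x <= 0}.
Proof.
pose g x := (h x + `|h x|) / 2.
have bn : rbm (fun x => `|h x|).
  by have [mh [K hK]] := bh; split; [exact: rmeas_norm|exists K => x; rewrite normr_id].
have bg : rbm g by apply: rbmM; [exact: rbmD|exact: rbm_cst].
have g0 x : 0 <= g x by rewrite /g; have := ler_norm (- h x); rewrite normrN; lra.
have gh x : g x * h x = g x ^+ 2.
  by rewrite /g; have [h0|h0] := leP 0 (h x); [rewrite ger0_norm//|rewrite ltr0_norm//]; field.
have J0 : J (fun x => g x ^+ 2) = 0.
  apply/eqP; rewrite eq_le J_ge0 ?andbT => [|x]; last exact: sqr_ge0.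
  under eq_fun do rewrite -gh; apply: (variation_le0 bg ltr01) => e x /andP[e0 _].
  by rewrite addr_ge0// mulr_ge0// ltW.
have i : rint (fun x => g x ^+ 2).
  by apply: rbm_rint; under eq_fun do rewrite expr2; exact: rbmM.
have := J_eq0 i (ae_torus (fun x _ => sqr_ge0 (g x))) J0.
apply: aeS => x /eqP; rewrite sqrf_eq0 => /eqP; rewrite /g.
by have := ler_norm (h x); have := normr_ge0 (h x); lra.
Qed.

Lemma s_h : {ae mu, forall x, s x * h x = 0}.
Proof.
have [_ [K hK]] := bh; have K0 : 0 <= K by exact: le_trans (normr_ge0 _) (hK 0).
have bsh : rbm (fun x => s x * h x) by exact: rbmM.
have bshh : rbm (fun x => s x * h x * h x) by exact: rbmM.
have p x : 0 <= s x * h x * h x by rewrite -mulrA mulr_ge0// -expr2 sqr_ge0.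
have J0 : J (fun x => s x * h x * h x) = 0.
  apply/eqP; rewrite eq_le J_ge0 ?andbT//.
  apply: (@variation_le0 _ (K + 1)^-1) => //; first by rewrite invr_gt0 ltr_wpDl.
  move=> e x /andP[e0 ek].
  (* In this factored form feasibility reduces to [1 + e h >= 0], which [e <= 1 / (K + 1)]
     ensures. *)
  have -> : s x + e * (s x * h x) = s x * (1 + e * h x) by ring.
  rewrite mulr_ge0//.
  have : e * (K + 1) <= 1 by rewrite -ler_pdivlMr ?ltr_wpDl// mul1r.
  have : - (e * h x) <= e * K.
    by rewrite -mulrN ler_pM2l//; have := ler_norm (- h x); rewrite normrN; have := hK x; lra.
  by lra.
have := J_eq0 (rbm_rint bshh) (ae_torus (fun x _ => p x)) J0.
by apply: aeS => x /eqP; rewrite mulf_eq0 => /orP[/eqP//|/eqP ->]; rewrite mulr0.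
Qed.

(** Integrate [(j r)' = - l r^2 - (l + s) j^2] over the period, and write [l r^2 + (l + s) j^2] as
    [l (r^2 - j^2) + (2 l + s) j^2]. *)
Lemma form_identity : cintegral (fun x => (2 * l + (s x)%:C) * W x) = l * (N B ^+ 2)%:C.
Proof.
have [hj hr pj pr ri] := hjr.
have := prim_2pi (primM hj hr); rewrite pj pr -[X in X = _]addr0 => /addrI/esym E.
have bs : bm (fun x => (s x)%:C : R[i]) by exact: bmC.
have i1 : cint (fun x => r x ^+ 2 - j x ^+ 2) by apply: bm_cint; exact: bmB.
have i2 : cint (fun x => (2 * l + (s x)%:C) * j x ^+ 2).
  by apply: bm_cint; apply: bmM => //; apply: bmD => //; exact: bm_cst.
have E1 : cintegral (fun x => (2 * l + (s x)%:C) * j x ^+ 2) = - (l * B).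
  apply/eqP; rewrite -addr_eq0 /B -cintegralZ// -cintegralD//; last exact: cintZ.
  rewrite -oppr_eq0 -cintegralN; last by apply: cintD => //; exact: cintZ.
  apply/eqP; rewrite -[RHS]E; congr cintegral; apply/funext => x; rewrite /ca /cb; ring.
rewrite (_ : (fun x => _) = fun x => - conjc B * ((2 * l + (s x)%:C) * j x ^+ 2)); last first.
  by apply/funext => x; rewrite /W; ring.
by rewrite cintegralZ// E1 -N_mulJ; ring.
Qed.

(** At [l = 0] the eigenvector is a constant current, so [h] is a positive constant; this
    contradicts the variation [tau = 1]. *)
Let l_neq0 : l != 0.
Proof.
apply/negP => /eqP l0; have := hjr; rewrite l0 => h0.
have [_ jc r0 j0] := psol_zero hs (ae_torus (fun x _ => s0 x)) h0 nz.
have BE : B = - ((2 * pi)%:C * j 0 ^+ 2).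
  rewrite /B (_ : (fun x => _) = fun=> - j 0 ^+ 2); first by rewrite cintegral_cst mulrN.
  by apply/funext => x; rewrite r0 jc expr0n sub0r.
have hE x : h x = 2 * pi * N (j 0) ^+ 4.
  rewrite /h /W jc BE.
  rewrite (_ : - (j 0 ^+ 2 * _) = (2 * pi)%:C * (j 0 ^+ 2 * conjc (j 0 ^+ 2))).
    by rewrite N_mulJ -CM ReC NX -exprM.
  have conjE (k : R) (a : R[i]) : conjc (- (k%:C * a)) = - (k%:C * conjc a).
    by apply: ceqP; rewrite !reimE; ring.
  rewrite conjE; ring.
have := variation_le0 (rbm_cst 1) ltr01 => /(_ _).
rewrite (_ : (fun x => 1 * h x) = fun=> 2 * pi * N (j 0) ^+ 4); last first.
  by apply/funext => x; rewrite mul1r hE.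
rewrite J_cst => H.
have : 2 * pi * (2 * pi * N (j 0) ^+ 4) <= 0.
  by apply: H => e x /andP[e0 _]; rewrite addr_ge0// mulr1 ltW.
have p0 := twopi_gt0 R; have n4 : 0 < N (j 0) ^+ 4 by rewrite exprn_gt0// N_gt0.
by rewrite leNgt (mulr_gt0 p0 (mulr_gt0 p0 n4)).
Qed.

(* The current [q = Im (conj j * j')] satisfies
   [q' = Im l * (2 Re l + s) * |j|^2] and vanishes where [s > 0]. *)
Lemma current_eq0 : Im l != 0 -> Re l != 0 -> {ae mu, forall x, (2 * Re l + s x)%:C * W x = 0}.
Proof.
move=> Il Rl; have [hj hr pj pr ri] := hjr.
pose p x := conjc (j x) * (- l * r x).
have hp := primM (primJ hj) (primZ (- l) hr).
pose q x := Im (p x); pose q1 x := Im l * (2 * Re l + s x) * N (j x) ^+ 2.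
have bNj : rbm (fun x => N (j x) ^+ 2).
  by have := bm_rbmN bj => b; under eq_fun do rewrite expr2; exact: rbmM.
have bq1 : rbm q1.
  by apply: rbmM => //; apply: rbmM; [exact: rbm_cst|apply: rbmD => //; exact: rbm_cst].
have hq : prim (fun x => (q x)%:C) (fun x => (q1 x)%:C).
  apply: prim_real; first exact: rbm_rint.
  move=> x; have [_ /(_ x) /(congr1 (@complex.Im R))] := hp; rewrite ImD Im_P => e.
  rewrite [LHS]e; congr (_ + Pr _ x); apply/funext => t.
  by rewrite /q1 N_sqr /ca /cb !reimE; ring.
have pq : (q (2 * pi))%:C = (q 0)%:C :> R[i] by rewrite /q /p pj pr.
have bq : rbm q := bm_rbm_Re (prim_bm hq).
have hdh : prim (fun x => (h x)%:C) (fun x => (Re (2 * (j x * (l * r x)) * conjc B))%:C).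
  apply: prim_real.
    apply: rbm_rint; apply: (@bm_rbm_Re R); apply: bmM; last exact: bm_cst.
    by apply: bmZ; apply: bmM => //; exact: bmZ.
  move=> x.
  have hW : prim W (fun x => 2 * (j x * (l * r x)) * conjc B).
    rewrite (_ : W = fun t => - conjc B * (j t * j t)); last by apply/funext => t; rewrite /W; ring.
    apply: prim_eq (primZ (- conjc B) (primM hj hj)) _ => t; rewrite /ca; ring.
  by have [_ /(_ x) /(congr1 (@complex.Re R))] := hW; rewrite ReD Re_P.
have hh1 : {ae mu, forall x, h x = 0 -> Re (2 * (j x * (l * r x)) * conjc B) = 0}.
  apply: derivative_at_max.
  - apply: (@bm_rbm_Re R); apply: bmM; last exact: bm_cst.
    by apply: bmZ; apply: bmM => //; exact: bmZ.
  - move=> x; have [_ /(_ x) /(congr1 (@complex.Re R))] := hdh; rewrite ReD Re_P.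
    by [].
  - by rewrite /h /W pj.
  - exact: h_le0.
have sq : {ae mu, forall x, s x * q x = 0}.
  apply: aeS (aeI s_h hh1) => x [/eqP]; rewrite mulf_eq0 => /orP[/eqP -> _|/eqP hx /(_ hx) h1].
    by rewrite mul0r.
  suff -> : q x = 0 by rewrite mulr0.
  have [j0|j0] := eqVneq (j x) 0; first by rewrite /q /p j0 rmorph0 mul0r.
  (* Here [j^2 conj B] and [j j' conj B] have zero real part, the first because [h = 0], the second
     because [h' = 0]. The product of one with the conjugate of the other is therefore real, and it
     is [j conj j'] times a positive number. *)
  have e : (N (j x) ^+ 2 * N B ^+ 2)%:C * (j x * conjc (- l * r x)) =
      (j x ^+ 2 * conjc B) * conjc (j x * (- l * r x) * conjc B).
    rewrite [in LHS]CM -!N_mulJ !(conjcM (_ * (- l * r x))) (conjcM (j x)) conjcK; ring.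
  have Im_jj : Im (j x * conjc (- l * r x)) = 0.
    have : Im ((N (j x) ^+ 2 * N B ^+ 2)%:C * (j x * conjc (- l * r x))) = 0.
      rewrite e [LHS]ImM ReJ ImJ.
      have -> : Re (j x ^+ 2 * conjc B) = 0 by apply/eqP; rewrite -oppr_eq0 -ReN; apply/eqP.
      have -> : Re (j x * (- l * r x) * conjc B) = 0.
        move: h1; rewrite (_ : 2 * _ * _ = (- 2)%:C * (j x * (- l * r x) * conjc B)).
          by rewrite ReM ReC ImC mul0r subr0 => /eqP; rewrite mulf_eq0 oppr_eq0 pnatr_eq0 /= => /eqP.
        by rewrite CN (_ : 2%:C = 2); [ring|rewrite rmorph_nat].
      by rewrite mul0r mulr0 addr0.
    have Imr (k : R) (a : R[i]) : Im (k%:C * a) = k * Im a by rewrite !reimE; ring.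
    rewrite Imr => /eqP; rewrite mulf_eq0 => /orP[|/eqP//].
    by rewrite mulf_eq0 !sqrf_eq0 !N_eq0 (negbTE j0) (negbTE B0).
  rewrite /q /p -[LHS]opprK -ImJ conjcM conjcK Im_jj oppr0.
  by [].
(* The weight [q^2] has a factor [q], which removes the [s] term through [sq], and it is
   nonnegative, so what remains has constant sign. *)
have q2 : J (fun x => q x ^+ 2 * q1 x) = 0.
  have := prim_2pi (primM (primM hq hq) hq); rewrite pq -[X in X = _]addr0 => /addrI/esym.
  rewrite (_ : (fun x => _) = fun x => (3 * (q x ^+ 2 * q1 x))%:C).
    rewrite cintegralE => -[+ _]; rewrite JZ => [/eqP|].
      by rewrite mulf_eq0 pnatr_eq0 /= => /eqP.
    by apply: rbm_rint; apply: rbmM => //; under eq_fun do rewrite expr2; exact: rbmM.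
  apply/funext => x; apply: ceqP; rewrite !reimE /=; ring.
have qj : {ae mu, forall x, q x = 0}.
  have b2 : rbm (fun x => q x ^+ 2 * N (j x) ^+ 2).
    by apply: rbmM => //; under eq_fun do rewrite expr2; exact: rbmM.
  have J0 : J (fun x => q x ^+ 2 * N (j x) ^+ 2) = 0.
    have : J (fun x => (Im l * (2 * Re l)) * (q x ^+ 2 * N (j x) ^+ 2)) = 0.
      rewrite -q2; apply: J_ae.
      - by apply: rmeasM; [exact: rmeas_cst|case: b2].
      - have b3 : rbm (fun x => q x ^+ 2 * q1 x).
          by apply: rbmM => //; under eq_fun do rewrite expr2; exact: rbmM.
        by case: b3.
      - apply/ae_eqP; apply: aeS sq => x e.
        rewrite (_ : q x ^+ 2 * q1 x = Im l * (2 * Re l) * (q x ^+ 2 * N (j x) ^+ 2) +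
          (s x * q x) * (q x * Im l * N (j x) ^+ 2)); first by rewrite e mul0r addr0.
        rewrite /q1; ring.
    rewrite JZ; last exact: rbm_rint.
    by move/eqP; rewrite !mulf_eq0 (negbTE Il) (negbTE Rl) pnatr_eq0 /= => /eqP.
  have p0 x : 0 <= q x ^+ 2 * N (j x) ^+ 2 by rewrite mulr_ge0 ?sqr_ge0.
  have := J_eq0 (rbm_rint b2) (ae_torus (fun x _ => p0 x)) J0.
  apply: aeS => x /eqP; rewrite mulf_eq0 !sqrf_eq0 N_eq0 => /orP[/eqP//|/eqP j0].
  by rewrite /q /p j0 rmorph0 mul0r.
have [_ q10] := prim_ae0 hq pq (aeS (fun x (e : q x = 0) => congr1 _ e) qj).
apply: aeS q10 => x /(congr1 (@complex.Re R)); rewrite ReC /= /q1 => /eqP.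
rewrite mulf_eq0 sqrf_eq0 N_eq0 mulf_eq0 (negbTE Il) /= => /orP[/eqP ->|/eqP j0]; first by rewrite mul0r.
by rewrite /W j0 expr0n mul0r oppr0 mulr0.
Qed.

(** In every case [form_identity] yields [2 * J h = N B ^+ 2], that is, [\int Re w = 1 / 2], whereas
    [tau = 1] gives [J h <= 0]. *)
Lemma optimal_not_simple : False.
Proof.
have Jh : J h <= 0.
  have := variation_le0 (rbm_cst 1) ltr01; rewrite (_ : (fun x => 1 * h x) = h).
    by apply => e x /andP[e0 _]; rewrite addr_ge0// mulr1 ltW.
  by apply/funext => x; rewrite mul1r.
suff : 2 * J h = N B ^+ 2 by have := NB0; lra.
have cW := bm_cint bW.
have bs : bm (fun x => (s x)%:C : R[i]) by exact: bmC.
have bsW : bm (fun x => (s x)%:C * W x) by exact: bmM.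
have reW : Re (cintegral W) = J h by [].
have id := form_identity.
have [Il|Il] := eqVneq (Im l) 0.
  have lr : l = (Re l)%:C by apply: ceqP.
  have Rl : Re l != 0 by apply: contra_neq l_neq0 => e; rewrite lr e.
  (* For real [l] the term with [s] is [s h], which vanishes; dividing by [l] leaves the claim. *)
  have := congr1 (@complex.Re R) id; rewrite Re_cintegral ReM ReC ImC mulr0 subr0.
  rewrite (@J_ae _ _ (fun x => 2 * Re l * h x)).
  - rewrite JZ; last exact: rbm_rint.
    by move=> e; apply: (mulfI Rl); rewrite -e; ring.
  - have b : bm (fun x => (2 * l + (s x)%:C) * W x) by apply: bmM => //; apply: bmD => //; exact: bm_cst.
    by case: (bm_rbm_Re b).
  - by apply: rmeasM; [exact: rmeas_cst|case: bh].
  - apply/ae_eqP; apply: aeS s_h => x e.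
    rewrite -[RHS]addr0 -[in RHS]e /h (_ : 2 * l = l + l); last by ring.
    by rewrite !reimE Il; ring.
have key : {ae mu, forall x, (2 * Re l + s x)%:C * W x = 0}.
  have [Rl|Rl] := eqVneq (Re l) 0; last exact: current_eq0.
  (* On the imaginary axis the energy identity reduces to [\int s |j|^2 = 0], so [s j = 0]. *)
  have := energy hs hjr; rewrite Rl mul0r add0r => Js.
  have bNj : rbm (fun x => N (j x) ^+ 2).
    by have := bm_rbmN bj => b; under eq_fun do rewrite expr2; exact: rbmM.
  have p0 x : 0 <= s x * N (j x) ^+ 2 by rewrite mulr_ge0 ?sqr_ge0.
  have := J_eq0 (rbm_rint (rbmM hs bNj)) (ae_torus (fun x _ => p0 x)) Js.
  apply: aeS => x /eqP; rewrite mulf_eq0 sqrf_eq0 N_eq0 => /orP[/eqP sx|/eqP j0].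
    by rewrite sx mulr0 addr0 mul0r.
  by rewrite /W j0 expr0n mul0r oppr0 mulr0.
(* By [key] the integrand is [2 i Im l * W], whose imaginary part is [2 Im l * h]. *)
have := congr1 (@complex.Im R) id; rewrite Im_cintegral ImM ReC ImC mulr0 add0r.
rewrite (@J_ae _ _ (fun x => 2 * Im l * h x)).
- rewrite JZ; last exact: rbm_rint.
  by move=> e; apply: (mulfI Il); rewrite -e; ring.
- have b : bm (fun x => (2 * l + (s x)%:C) * W x) by apply: bmM => //; apply: bmD => //; exact: bm_cst.
  by case: (bm_rbm_Im b).
- by apply: rmeasM; [exact: rmeas_cst|case: bh].
- apply/ae_eqP; apply: aeS key => x e0; have e : Im ((2 * Re l + s x)%:C * W x) = 0 by rewrite e0.
  rewrite -[RHS]addr0 -[in RHS]e /h (_ : 2 * l = l + l); last by ring.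
  by rewrite !reimE; ring.
Qed.

End Rigidity.

(** * Passing to a bounded nonnegative representative of the jump rate *)

Section Representative.
Variable R : realType.
Let mu := torus R.
Implicit Types (s sigma : R -> R) (l : R[i]).

Lemma generator_ae sigma s : {ae mu, forall x, sigma x = s x} -> generator sigma = generator s.
Proof.
have imp (s1 s2 : R -> R) f h : {ae mu, forall x, s1 x = s2 x} -> generator s1 f h -> generator s2 f h.
  move=> e [lf lh [dr [dj [h1 h2 w1 w2 [e1 /ae_eqP e2]]]]]; split => //.
  exists dr, dj; split => //; split => //; apply/ae_eqP.
  by apply: aeS (aeI e e2) => x [e0 ->]; rewrite /= e0.
move=> e; apply/funext => f; apply/funext => h; apply/propext; split; apply: imp => //.
by apply: aeS e => x ->.
Qed.

Lemma generator_gap sigma s : generator sigma = generator s ->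
  [/\ spectral_gap sigma = spectral_gap s,
      forall l, simple_eigenvalue sigma l -> simple_eigenvalue s l &
      forall l, gap_determined_by sigma l -> gap_determined_by s l].
Proof.
move=> G; have E1 : resolvent_eq sigma = resolvent_eq s by rewrite /resolvent_eq G.
have E2 : resolvent_set sigma = resolvent_set s by rewrite /resolvent_set E1.
have E3 : spectrum sigma = spectrum s by rewrite /spectrum E2.
split=> [|l|l]; rewrite /spectral_gap /gap_determined_by /spectral_gap ?E3//.
by rewrite /simple_eigenvalue /Defs.eigenvalue /spectral_projection G E1 E2.
Qed.

(** The analysis above uses bounds valid at every real point; a jump rate has them only almost
    everywhere. *)
Lemma jump_rate_representative sigma : jump_rate sigma ->
  exists s, [/\ rbm s, forall x, 0 <= s x & {ae mu, forall x, sigma x = s x}].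
Proof.
move=> [/Lfun_oo_bounded [ms [K K0 hK]] s0].
exists (fun x => Num.min K `|sigma x|); split.
- split; first by apply: measurable_minr; [exact: rmeas_cst|exact: rmeas_norm].
  by exists K => x; rewrite ger0_norm ?le_min ?K0 ?normr_ge0// ge_min lexx.
- by move=> x; rewrite le_min K0 normr_ge0.
- by apply: aeS (aeI hK s0) => x [h1 h2]; rewrite min_r// ger0_norm.
Qed.

End Representative.

Theorem theorem2 (R : realType) (sigma : R -> R) :
  jump_rate sigma -> gap_locally_maximised sigma ->
  ~ (exists lambda : complex R,
       simple_eigenvalue sigma lambda /\ gap_determined_by sigma lambda).
Proof.
move=> jsigma [eps eps0 hmax] [l [sl gl]].
have [s [hs s0 es]] := jump_rate_representative jsigma.
have [gE /(_ _ sl) sl' /(_ _ gl) gl'] := generator_gap (generator_ae es).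
have [j [r [hjr nz]]] := (peig_psol0 l hs).1 ((eigenvalue_peig l hs).1 sl'.1).
(* Half the radius turns the pointwise bound with [<=] into the strict bound on the norm. *)
have e2 : 0 < eps / 2 by rewrite divr_gt0.
apply: (optimal_not_simple hs s0 e2 _ sl' gl' hjr nz) => t ht t0 ts.
rewrite -gE; apply: hmax.
  by split; [exact: rbm_Lfun_oo|exact: ae_torus].
apply: (@le_lt_trans _ _ (eps / 2)%:E); last by rewrite lte_fin; lra.
apply: Lnorm_oo_le; first exact: ltW.
by apply: aeS es => x /= ->.
Qed.
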